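(* Let $\mathcal G^{(n)}$ denote the subcomplex of the rational commutative graph complex spanned by connected graphs with fundamental group of rank $n$. The rational homology $H_i(\mathcal G^{(n)})$ is zero for all $2\le n\le 7$ and all $i$, except for $$H_2(\mathcal G^{(2)})\cong\mathbb Q,\quad H_4(\mathcal G^{(3)})\cong\mathbb Q,\quad H_6(\mathcal G^{(4)})\cong\mathbb Q,\quad H_8(\mathcal G^{(5)})\cong\mathbb Q^2,$$ $$H_{10}(\mathcal G^{(6)})\cong\mathbb Q^2,\quad H_7(\mathcal G^{(6)})\cong\mathbb Q,\quad H_{12}(\mathcal G^{(7)})\cong\mathbb Q^3,\quad H_9(\mathcal G^{(7)})\cong\mathbb Q.$$
   Context: A graph is a finite nonempty 1-dimensional CW complex (multiple edges and loops allowed) in which every vertex has valence at least $3$. An orientation of a graph is an ordering of its vertices together with a direction on each edge, where an odd permutation of the vertices or the reversal of one edge changes the orientation to the opposite one, so that every graph has exactly two orientations. The commutative graph complex $\mathcal G$ is the $\mathbb Q$-vector space spanned by isomorphism classes of connected oriented graphs, modulo the relation that $G$ with the opposite orientation equals $-G$. (Isomorphisms are taken on the level of half-edges; a graph with an orientation-reversing automorphism, e.g. a graph with a loop, is therefore $0$.) $\mathcal G$ is graded by the number of vertices: $\mathcal G_k$ is spanned by graphs with $k$ vertices. For an edge $e$ of $G$ joining two distinct vertices, $G_e$ is the graph obtained by collapsing $e$ to a point, oriented as follows: represent the orientation of $G$ so that $e$ goes from the first vertex to the second vertex; then in $G_e$ the merged vertex is first, followed by the other vertices in their given order, and the remaining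 edges keep their directions. If $e$ is a loop, $G_e:=0$. The boundary operator $\partial:\mathcal G_k\to\mathcal G_{k-1}$ is $\partial(G)=\sum_{e} G_e$, the sum over all edges. It preserves the rank of the fundamental group, so $\mathcal G^{(n)}$ is a subcomplex; $H_i(\mathcal G^{(n)})$ is its homology in degree $i$ (i.e. at graphs with $i$ vertices). *)

(* Defs.v *)
From HB Require Import structures.
From mathcomp Require Import all_boot all_order all_algebra all_fingroup.
Set Implicit Arguments. Unset Strict Implicit. Unset Printing Implicit Defensive.
Import GRing.Theory.
Local Open Scope ring_scope.

Section Quotient.
Variables (K : fieldType) (vT : vectType K) (U : {vspace vT}).

(* The quotient space vT / U, carried by a complement of U. That quot_pi is a
   quotient map is the content of lker_quot_pi and limg_quot_pi. *)
Definition quotv : vectType K := subvs_of (U^C)%VS.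

Definition quot_pi : 'Hom(vT, quotv) :=
  (linfun (vsproj (U^C)%VS) \o (\1 - projv U))%VF.

Definition quot_repr : 'Hom(quotv, vT) := linfun (@vsval K vT (U^C)%VS).

Lemma quot_reprK_mod v : v - quot_repr (quot_pi v) \in U.
Proof.
rewrite /quot_repr /quot_pi comp_lfunE !lfunE /= lfunE /= opp_lfunE.
by rewrite vsprojK ?memv_projC // opprB addrCA subrr addr0 memv_proj.
Qed.

Lemma quot_pi_eq0 v : (quot_pi v == 0) = (v \in U).
Proof.
apply/idP/idP => [/eqP v0|vU].
  by have := quot_reprK_mod v; rewrite v0 linear0 subr0.
rewrite /quot_pi comp_lfunE !lfunE /= opp_lfunE lfunE /=.
by rewrite projv_id // subrr linear0.
Qed.

Lemma lker_quot_pi : lker quot_pi = U.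
Proof. by apply/vspaceP => v; rewrite memv_ker quot_pi_eq0. Qed.

Lemma quot_reprK x : quot_pi (quot_repr x) = x.
Proof.
apply/eqP; rewrite -subr_eq0; set y := _ - x.
suff : vsval y \in (U :&: U^C)%VS.
  by rewrite capv_compl memv0 => /eqP y0; apply/eqP/subvs_inj; rewrite y0 linear0.
rewrite memv_cap subvsP andbT.
have := quot_reprK_mod (quot_repr x).
by rewrite /quot_repr [X in _ - X]lfunE [X in X - _]lfunE -memvN opprB -linearB.
Qed.

Lemma limg_quot_pi : limg quot_pi = fullv.
Proof.
apply/eqP; rewrite eqEsubv subvf /=; apply/subvP => x _.
by rewrite -(quot_reprK x) memv_img ?memvf.
Qed.

End Quotient.

Section QuotientMap.
Variables (K : fieldType) (vT wT : vectType K).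
Variables (U : {vspace vT}) (W : {vspace wT}).

(* The map vT / U -> wT / W induced by an f that maps U into W. *)
Definition quot_map (f : 'Hom(vT, wT)) : 'Hom(quotv U, quotv W) :=
  (quot_pi W \o f \o quot_repr U)%VF.

Lemma quot_mapE f v :
  (f @: U <= W)%VS -> quot_map f (quot_pi U v) = quot_pi W (f v).
Proof.
move=> fU; have -> x : quot_map f x = quot_pi W (f (quot_repr U x)).
  by rewrite /quot_map !comp_lfunE.
apply/esym/eqP; rewrite -subr_eq0 -linearB -linearB quot_pi_eq0.
by apply: (subvP fU); rewrite memv_img // quot_reprK_mod.
Qed.

End QuotientMap.

Definition isomorphic (K : fieldType) (V W : lmodType K) :=
  exists f : {linear V -> W}, bijective f.

(* The half-edges (e, false) and (e, true) are the initial and the terminal half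
   of the directed edge e. *)
Definition halfedge m := ('I_m * bool)%type.
Definition flip m (x : halfedge m) : halfedge m := (x.1, ~~ x.2).

(* A graph on k ordered vertices with m directed edges, hence an oriented graph:
   the function sends a half-edge to the vertex it is attached to. *)
Definition graph k m := {ffun halfedge m -> 'I_k}.

Section Graph.
Variables k m : nat.
Implicit Types (G : graph k m).

Definition source G (e : 'I_m) := G (e, false).
Definition target G (e : 'I_m) := G (e, true).

Definition valence G (v : 'I_k) := #|[set x | G x == v]|.

Definition adjacent G : rel 'I_k :=
  [rel u v | [exists x, (G x == u) && (G (flip x) == v)]].

Definition connected G := (0 < k)%N && [forall u, forall v, connect (adjacent G) u v].

Definition admissible G := connected G && [forall v, 2 < valence G v]%N.

Definition agraph := {G : graph k m | admissible G}.

(* Graph isomorphisms, ignoring the orientations: a bijection s of the vertices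
   and a bijection h of the half-edges. *)
Definition is_iso (s : {perm 'I_k}) (h : {perm halfedge m}) G G' :=
  [forall x, (h (flip x) == flip (h x)) && (G' (h x) == s (G x))].

(* +1 or -1 as the isomorphism preserves or reverses orientations: the sign of
   the vertex permutation, times -1 for each edge whose direction is reversed. *)
Definition iso_sign (s : {perm 'I_k}) (h : {perm halfedge m}) : rat :=
  (-1) ^+ s * \prod_(e : 'I_m) (-1) ^+ (h (e, false)).2.

(* The free vector space on admissible graphs, with basis the ket G; ket G = 0 if
   G is not admissible, which contract_admissible excludes in collapse. *)
Definition free_space : vectType rat := {ffun agraph -> rat^o}.

Definition ket G : free_space := [ffun A : agraph => (val A == G)%:R].

(* Isomorphic oriented graphs are identified, and a graph with the opposite
   orientation is minus the graph. *)
Definition relators : {vspace free_space} :=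
  (\sum_(G : agraph) \sum_(G' : agraph)
     \sum_(s : {perm 'I_k})
       \sum_(h : {perm halfedge m} | is_iso s h (val G) (val G'))
         <[ket (val G) - iso_sign s h *: ket (val G')]>)%VS.

Definition chain_space : vectType rat := quotv relators.

Definition graph_class G : chain_space := quot_pi relators (ket G).

Lemma mem_relators G G' s h : admissible G -> admissible G' -> is_iso s h G G' ->
  ket G - iso_sign s h *: ket G' \in relators.
Proof.
move=> aG aG' iso; pose A : agraph := Sub G aG; pose A' : agraph := Sub G' aG'.
rewrite /relators (bigD1 A) //= (bigD1 A') //= (bigD1 s) //= (bigD1 h) //=.
have -> : G = val A by []. have -> : G' = val A' by [].
by do 4![apply: (subvP (addvSl _ _))]; exact: memv_line.
Qed.

Lemma graph_class_iso G G' s h :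
  admissible G -> admissible G' -> is_iso s h G G' ->
  graph_class G = iso_sign s h *: graph_class G'.
Proof.
move=> aG aG' iso; apply/eqP; rewrite -subr_eq0 /graph_class.
by rewrite -linearZ -linearB quot_pi_eq0; apply: mem_relators.
Qed.

End Graph.

(* A vertex permutation making a the first vertex and b (if b <> a) the second. *)
Definition to_front k (a b : 'I_k.+2) : {perm 'I_k.+2} :=
  (tperm a ord0 * tperm (tperm a ord0 b) (lift ord0 ord0))%g.

Definition merge01 k (v : 'I_k.+2) : 'I_k.+1 := inord v.-1.

Section Collapse.
Variables k m : nat.
Implicit Types (G : graph k.+2 m.+1).

(* Delete the edge e from the graph G with its vertices reordered by s, and merge
   the first two vertices. *)
Definition contract G (e : 'I_m.+1) (s : {perm 'I_k.+2}) : graph k.+1 m :=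
  [ffun x => merge01 (s (G (lift e x.1, x.2)))].

(* Reordering the vertices by s multiplies the orientation by (-1) ^+ s. *)
Definition collapse G (e : 'I_m.+1) : free_space k.+1 m :=
  if source G e == target G e then 0
  else let s := to_front (source G e) (target G e) in
       (-1) ^+ s *: ket (contract G e s).

Definition free_boundary_fun (x : free_space k.+2 m.+1) : free_space k.+1 m :=
  \sum_(G : agraph k.+2 m.+1) (x G : rat) *: \sum_(e : 'I_m.+1) collapse (val G) e.

Definition free_boundary : 'Hom(free_space k.+2 m.+1, free_space k.+1 m) :=
  linfun free_boundary_fun.

Definition collapse_boundary : 'Hom(chain_space k.+2 m.+1, chain_space k.+1 m) :=
  quot_map (relators k.+2 m.+1) (relators k.+1 m) free_boundary.

End Collapse.

(* The space spanned by connected graphs with i vertices and fundamental group of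
   rank n; by Euler characteristic these have i - 1 + n edges. *)
Definition chains n i : vectType rat := chain_space i (i.-1 + n).

(* On graphs with one vertex all edges are loops. *)
Definition boundary n i : 'Hom(chains n i, chains n i.-1) :=
  match i with
  | j.+2 => collapse_boundary j (j + n)
  | _ => 0
  end.

(* The image of boundary n i.+1 lies in the kernel of boundary n i (boundaryK), so
   its preimage under the inclusion vsval of that kernel is this image itself. *)
Definition cycles n i : vectType rat := subvs_of (lker (boundary n i)).

Definition boundaries n i : {vspace cycles n i} :=
  (linfun vsval @^-1: limg (boundary n i.+1))%VS.

Definition homology n i : vectType rat := quotv (boundaries n i).

Lemma lfunZ (K : fieldType) (V W : vectType K) (f : 'Hom(V, W)) a v :
  f (a *: v) = a *: f v.
Proof. exact: linearZ. Qed.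

Lemma lfunB (K : fieldType) (V W : vectType K) (f : 'Hom(V, W)) u v :
  f (u - v) = f u - f v.
Proof. exact: linearB. Qed.

Lemma lfun_sum (K : fieldType) (V W : vectType K) (f : 'Hom(V, W)) (I : finType)
    (F : I -> V) : f (\sum_i F i) = \sum_i f (F i).
Proof. exact: linear_sum. Qed.

Section CollapseTheory.
Variables k m : nat.
Implicit Types (G : graph k.+2 m.+1) (s t : {perm 'I_k.+2}).

Lemma merge01_0 : merge01 (ord0 : 'I_k.+2) = ord0.
Proof. by apply: val_inj; rewrite /merge01 /= inordK. Qed.

Lemma merge01_lift (w : 'I_k.+1) : merge01 (lift ord0 w) = w.
Proof. exact: inord_val. Qed.

Lemma to_frontP (a b : 'I_k.+2) : a != b ->
  to_front a b a = ord0 /\ to_front a b b = lift ord0 ord0.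
Proof.
move=> ab; rewrite !permM tpermL tpermL; split=> //.
apply: tpermD => //; apply/eqP => h; move/eqP: ab; apply.
by apply: (@perm_inj _ (tperm a ord0)); rewrite tpermL h.
Qed.

Lemma contract_admissible G e s :
  admissible G -> s (source G e) = ord0 -> s (target G e) = lift ord0 ord0 ->
  admissible (contract G e s).
Proof.
move=> /andP[/andP[_ /forallP cG] /forallP vG] s0 s1.
have merge_e b : merge01 (s (G (e, b))) = ord0.
  by case: b; rewrite -/(target G e) -/(source G e) ?s0 ?s1 ?merge01_lift ?merge01_0.
have surj w : {v | merge01 (s v) = w}.
  by exists ((s^-1)%g (lift ord0 w)); rewrite permKV merge01_lift.
have inj_l : injective (fun x : halfedge m => (lift e x.1, x.2) : halfedge m.+1).
  by move=> [i b] [j c] h; move: (congr1 fst h) (congr1 snd h) => /= /lift_inj -> ->.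
have imgE (A : {set halfedge m.+1}) (B : {set halfedge m}) :
    (forall x, x \in A -> x.1 != e) ->
    (forall x, (lift e x.1, x.2) \in A -> x \in B) -> (#|A| <= #|B|)%N.
  move=> nA AB; rewrite -(card_imset (mem B) inj_l); apply/subset_leq_card/subsetP.
  move=> [i b] xA; have := nA _ xA; rewrite eq_sym /= => /unlift_some[j ij _].
  by apply/imsetP; exists (j, b); rewrite /= ?ij // AB //= -ij.
apply/andP; split; [apply/andP; split=> // | apply/forallP => w]; last first.
  pose A := [set x | merge01 (s (G x)) == w & x.1 != e].
  apply: (@leq_trans #|A|); last first.
    apply: imgE => x; rewrite !inE; first by case/andP.
    by case/andP=> /eqP h _; rewrite ffunE h.
  pose Av v := [set x | G x == v].
  have [w0|w0] := eqVneq w ord0.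
    pose E := [set ((e, false) : halfedge m.+1); (e, true)].
    have dA : [disjoint Av (source G e) & Av (target G e)].
      rewrite -setI_eq0; apply/eqP/setP => x; rewrite !inE.
      apply/negP => /andP[/eqP h0 /eqP h1].
      by have := s1; rewrite -h1 h0 s0.
    have : (#|(Av (source G e) :|: Av (target G e)) :\: E| <= #|A|)%N.
      apply/subset_leq_card/subsetP => -[i b]; rewrite !inE /= => /andP[iE].
      move=> h; apply/andP; split.
        by case/orP: h => /eqP ->; rewrite w0 ?s0 ?s1 ?merge01_lift ?merge01_0.
      by apply: contra iE => /eqP ->; case: (b); rewrite !eqxx ?orbT.
    apply: leq_trans; rewrite cardsD.
    have EU : (#|(Av (source G e) :|: Av (target G e)) :&: E| <= 2)%N.
      apply: leq_trans (subset_leq_card (subsetIr _ _)) _.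
      by rewrite cards2; case: eqP.
    rewrite cardsU (disjoint_setI0 dA) cards0 subn0.
    have := leq_add (vG (source G e)) (vG (target G e)).
    rewrite /valence -/(Av _) -/(Av _) => h.
    rewrite ltn_subRL; apply: leq_trans h; apply: leq_ltn_trans (leq_add EU (leqnn _)) _.
    by [].
  apply: leq_trans (vG ((s^-1)%g (lift ord0 w))) (subset_leq_card _).
  apply/subsetP => x; rewrite !inE => /eqP h; rewrite h permKV merge01_lift eqxx /=.
  apply/eqP => xe; move: h; case: x xe => _ b /= -> h.
  by have := merge_e b; rewrite h permKV merge01_lift => /eqP; rewrite (negPf w0).
apply/forallP => u; apply/forallP => v.
have [u' <-] := surj u; have [v' <-] := surj v.
have /forallP/(_ v')/connectP[p pth ->] := cG u'.
elim: p u' pth => [|x p IH] u' //= /andP[/existsP[y /andP[/eqP yu /eqP yx]] pth].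
apply: connect_trans (IH _ pth); rewrite -yu -yx.
case: y {yu yx} => i b; have [->|ei] := eqVneq i e.
  by rewrite /= !merge_e connect0.
rewrite eq_sym in ei; have [j ij _] := unlift_some ei; apply: connect1; apply/existsP; exists (j, b).
by rewrite !ffunE /= -ij !eqxx.
Qed.

Lemma perm_fix0 j (u : {perm 'I_j.+1}) :
  u ord0 = ord0 -> exists r, u = lift_perm ord0 ord0 r.
Proof.
move=> u0; have un w : {v | u (lift ord0 w) = lift ord0 v}.
  have : u ord0 != u (lift ord0 w) by rewrite (inj_eq perm_inj) neq_lift.
  by rewrite u0 => /unlift_some[v -> _]; exists v.
have f_inj : injective (fun w => sval (un w)).
  move=> w w' h; apply: (@lift_inj _ ord0); apply: (@perm_inj _ u).
  by rewrite [LHS](svalP (un w)) [RHS](svalP (un w')) h.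
exists (perm f_inj); apply/permP => v; case: (unliftP ord0 v) => [w|] ->.
  by rewrite lift_perm_lift permE -(svalP (un w)).
by rewrite lift_perm_id.
Qed.

Lemma merge01_perm (u : {perm 'I_k.+2}) (b : bool) :
  u ord0 = (if b then lift ord0 ord0 else ord0) ->
  u (lift ord0 ord0) = (if b then ord0 else lift ord0 ord0) ->
  exists2 r : {perm 'I_k.+1}, forall v, merge01 (u v) = r (merge01 v) &
    odd_perm r = odd_perm u (+) b.
Proof.
move=> u0 u1.
pose u' := (u * if b then tperm ord0 (lift ord0 ord0) else 1)%g.
have mu v : merge01 (u' v) = merge01 (u v).
  rewrite /u' permM; case: (b); rewrite ?perm1 //.
  by case: tpermP => // ->; rewrite merge01_0 merge01_lift.
have u'0 : u' ord0 = ord0.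
  by rewrite /u' permM u0; case: (b); rewrite ?perm1 ?tpermR.
have u'1 : u' (lift ord0 ord0) = lift ord0 ord0.
  by rewrite /u' permM u1; case: (b); rewrite ?perm1 ?tpermL.
have odd_u' : odd_perm u' = odd_perm u (+) b.
  by rewrite /u' odd_permM; case: (b); rewrite ?odd_tperm ?odd_perm1.
have [r er] := perm_fix0 u'0; exists r; last first.
  by rewrite -odd_u' er odd_lift_perm.
have r0 : r ord0 = ord0.
  by apply: (@lift_inj _ ord0); rewrite -u'1 er lift_perm_lift.
move=> v; rewrite -mu er; case: (unliftP ord0 v) => [w|] ->.
  by rewrite lift_perm_lift !merge01_lift.
by rewrite lift_perm_id merge01_0 r0.
Qed.

Lemma iso_flip (h : {perm halfedge m.+1}) s G G' : is_iso s h G G' ->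
  forall f b, h (f, b) = ((h (f, false)).1, (h (f, false)).2 (+) b).
Proof.
move=> /forallP iso f [].
  have /andP[/eqP] := iso (f, false); rewrite /flip /= => -> _.
  by rewrite addbT.
by rewrite addbF; case: (h _).
Qed.

Lemma iso_edge_inj (h : {perm halfedge m.+1}) s G G' : is_iso s h G G' ->
  injective (fun e => (h (e, false)).1).
Proof.
move=> iso f f' ff'; have hE := iso_flip iso.
have hf : h (f, (h (f, false)).2) = h (f', (h (f', false)).2).
  by rewrite [LHS]hE [RHS]hE !addbb; congr (_, _).
by have /(congr1 fst) := perm_inj hf.
Qed.

Lemma contract_iso G G' (e : 'I_m.+1) s h t t' : is_iso s h G G' ->
  let e' := (h (e, false)).1 in
  t (source G e) = ord0 -> t (target G e) = lift ord0 ord0 ->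
  t' (source G' e') = ord0 -> t' (target G' e') = lift ord0 ord0 ->
  exists (s1 : {perm 'I_k.+1}) (h1 : {perm halfedge m}),
    [/\ is_iso s1 h1 (contract G e t) (contract G' e' t'),
        iso_sign s1 h1 = (-1) ^+ t * (-1) ^+ t' * iso_sign s h
      & forall f, lift e' (h1 (f, false)).1 = (h (lift e f, false)).1].
Proof.
move=> iso e' ts tt t's t't; have hE := iso_flip iso.
have isoG x : G' (h x) = s (G x) by have /forallP/(_ x)/andP[_ /eqP] := iso.
pose b := (h (e, false)).2; pose u := (t^-1 * s * t')%g.
have uE v : u (t v) = t' (s v) by rewrite !permM permK.
have [r rP r_odd] : exists2 r : {perm 'I_k.+1},
    forall v, merge01 (u v) = r (merge01 v) & odd_perm r = odd_perm u (+) b.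
  apply: merge01_perm.
    have -> : u ord0 = u (t (source G e)) by rewrite ts.
    rewrite uE -isoG hE -/e' -/b addbF; by case: (b); rewrite ?t's ?t't.
  have -> : u (lift ord0 ord0) = u (t (target G e)) by rewrite tt.
  rewrite uE -isoG hE -/e' -/b addbT; by case: (b); rewrite ?t's ?t't.
pose he f := (h (f, false)).1.
have he_inj : injective he := iso_edge_inj iso.
have un f : {g | he (lift e f) = lift e' g}.
  have h0 : e' != he (lift e f).
    by rewrite /e' -/(he e) (inj_eq he_inj) neq_lift.
  by have [g -> _] := unlift_some h0; exists g.
have hl f c : h (lift e f, c) = (lift e' (sval (un f)), (h (lift e f, false)).2 (+) c).
  by rewrite hE -(svalP (un f)).
pose h1f (x : halfedge m) : halfedge m :=
  (sval (un x.1), (h (lift e x.1, false)).2 (+) x.2).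
have h1_inj : injective h1f.
  move=> [f c] [f' c'] E.
  have : h (lift e f, c) = h (lift e f', c').
    by rewrite [LHS]hl [RHS]hl; congr (lift e' _, _);
      [exact: (congr1 fst E) | exact: (congr1 snd E)].
  by move/perm_inj => E'; move: (congr1 fst E') (congr1 snd E') => /= /lift_inj -> ->.
exists r, (perm h1_inj); split; last 1 first.
- by move=> f; rewrite permE; exact/esym/(svalP (un f)).
- apply/forallP => -[f c]; rewrite !permE /h1f /flip /= addbN eqxx /=.
  by rewrite !ffunE /= -hl isoG -uE rP.
have swap (x y z w p : rat) : x * y * z * w * p = x * z * (y * (w * p)).
  by rewrite -!mulrA; congr (_ * _); rewrite mulrCA.
have sE : (-1) ^+ r = (-1) ^+ t * (-1) ^+ s * (-1) ^+ t' * (-1) ^+ b :> rat.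
  by rewrite r_odd /u !odd_permM odd_permV !signr_addb.
rewrite /iso_sign sE (bigD1_ord e) //= -/b -swap; congr (_ * _).
by apply: eq_bigr => f _; rewrite permE /h1f /= addbF.
Qed.

(* If the edge e is not a loop, any reordering that makes e go from the first to
   the second vertex computes the same oriented graph. *)
Lemma graph_class_contract G G' (e : 'I_m.+1) s h t t' :
  admissible G -> admissible G' -> is_iso s h G G' ->
  let e' := (h (e, false)).1 in
  t (source G e) = ord0 -> t (target G e) = lift ord0 ord0 ->
  t' (source G' e') = ord0 -> t' (target G' e') = lift ord0 ord0 ->
  (-1) ^+ t *: graph_class (contract G e t) =
    (iso_sign s h * (-1) ^+ t') *: graph_class (contract G' e' t').
Proof.
move=> aG aG' iso e' ts tt t's t't.
have [s1 [h1 [iso1 sgn1 _]]] := contract_iso iso ts tt t's t't.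
rewrite (graph_class_iso _ _ iso1) ?contract_admissible // scalerA sgn1.
by move: (iso_sign s h) => x; rewrite !mulrA -expr2 sqrr_sign mul1r mulrC.
Qed.

Lemma iso_loop G G' s h (e : 'I_m.+1) : is_iso s h G G' ->
  (source G' (h (e, false)).1 == target G' (h (e, false)).1) =
  (source G e == target G e).
Proof.
move=> iso; have hE := iso_flip iso.
have isoG x : G' (h x) = s (G x) by have /forallP/(_ x)/andP[_ /eqP] := iso.
rewrite -[in RHS](inj_eq (@perm_inj _ s)) /source /target -!isoG.
rewrite [h (e, true)]hE addbT [h (e, false)]surjective_pairing.
by case: (h (e, false)).2 => //=; rewrite eq_sym.
Qed.

Lemma free_boundary_fun_is_linear : linear (@free_boundary_fun k m).
Proof.
move=> a x y; rewrite /free_boundary_fun scaler_sumr -big_split /=.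
by apply: eq_bigr => G _; rewrite !ffunE scalerDl scalerA.
Qed.

Lemma free_boundary_ket G : admissible G ->
  free_boundary k m (ket G) = \sum_(e : 'I_m.+1) collapse G e.
Proof.
move=> aG; pose A : agraph k.+2 m.+1 := Sub G aG.
pose HL := GRing.isLinear.Build _ _ _ _ _ free_boundary_fun_is_linear.
pose F : {linear _ -> _} := HB.pack (@free_boundary_fun k m) HL.
rewrite /free_boundary -[free_boundary_fun (m:=m)]/(F : _ -> _) lfunE /=.
rewrite /free_boundary_fun (bigD1 A) //= [X in _ + X]big1 => [|B BA].
  by rewrite addr0 ffunE eqxx scale1r.
by rewrite ffunE -[G]/(val A) (inj_eq val_inj) (negPf BA) scale0r.
Qed.

Lemma collapse_iso G G' s h (e : 'I_m.+1) :
  admissible G -> admissible G' -> is_iso s h G G' ->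
  quot_pi (relators k.+1 m) (collapse G e) =
  iso_sign s h *: quot_pi (relators k.+1 m) (collapse G' (h (e, false)).1).
Proof.
move=> aG aG' iso; rewrite /collapse (iso_loop e iso).
have [_|nl] := eqVneq; first by rewrite linear0 scaler0.
have [ts tt] := to_frontP nl.
have nl' := nl; rewrite -(iso_loop e iso) in nl'.
have [t's t't] := to_frontP nl'.
rewrite !lfunZ scalerA.
exact: (graph_class_contract aG aG' iso ts tt t's t't).
Qed.

Lemma free_boundary_relators :
  (free_boundary k m @: relators k.+2 m.+1 <= relators k.+1 m)%VS.
Proof.
apply/subvP => _ /memv_imgP[x xR ->].
suff sub : (relators k.+2 m.+1 <=
             lker (quot_pi (relators k.+1 m) \o free_boundary k m))%VS.
  by have := subvP sub _ xR; rewrite memv_ker comp_lfunE quot_pi_eq0.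
apply/subv_sumP => G _; apply/subv_sumP => G' _; apply/subv_sumP => s _.
apply/subv_sumP => h iso; rewrite -memvE memv_ker comp_lfunE.
rewrite lfunB lfunZ !free_boundary_ket ?(valP _) //.
rewrite lfunB lfunZ !lfun_sum subr_eq0 scaler_sumr.
rewrite [X in _ == X](reindex_inj (iso_edge_inj iso)) /=.
apply/eqP/eq_bigr => e _; exact: collapse_iso (valP _) (valP _) iso.
Qed.

Lemma collapse_boundaryE G : admissible G ->
  collapse_boundary k m (graph_class G) =
  \sum_(e : 'I_m.+1) quot_pi (relators k.+1 m) (collapse G e).
Proof.
move=> aG; rewrite /collapse_boundary quot_mapE ?free_boundary_relators //.
by rewrite free_boundary_ket // lfun_sum.
Qed.

Lemma collapse_class G (e : 'I_m.+1) t : admissible G ->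
  t (source G e) = ord0 -> t (target G e) = lift ord0 ord0 ->
  quot_pi (relators k.+1 m) (collapse G e) =
  (-1) ^+ t *: graph_class (contract G e t).
Proof.
move=> aG ts tt.
have nl : source G e != target G e.
  by apply/eqP => h; move: tt; rewrite -h ts.
have iso1 : is_iso 1 1 G G by apply/forallP => x; rewrite !perm1 !eqxx.
have [t0s t0t] := to_frontP nl.
rewrite /collapse (negPf nl) lfunZ.
have := graph_class_contract (e := e) (t := to_front (source G e) (target G e))
  (t' := t) aG aG iso1.
rewrite perm1 /= => -> //; congr (_ *: _).
rewrite /iso_sign odd_perm1 expr0 mul1r big1 ?mul1r // => f _.
by rewrite perm1.
Qed.

Lemma merge01_tperm (v : 'I_k.+2) :
  merge01 (tperm ord0 (lift ord0 ord0) v) = merge01 v.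
Proof. by case: tpermP => // ->; rewrite merge01_0 merge01_lift. Qed.

Lemma collapse_class_half G (x : halfedge m.+1) t : admissible G ->
  t (G x) = ord0 -> t (G (flip x)) = lift ord0 ord0 ->
  quot_pi (relators k.+1 m) (collapse G x.1) =
  ((-1) ^+ x.2 * (-1) ^+ t) *: graph_class (contract G x.1 t).
Proof.
case: x => e [] aG /= ts tt; last by rewrite mul1r; apply: collapse_class.
pose t' := (t * tperm ord0 (lift ord0 ord0))%g.
rewrite (@collapse_class _ _ t') /t' ?permM /source /target //; first last.
- by rewrite ts tpermL.
- by rewrite tt tpermR.
rewrite odd_permM odd_tperm signr_addb mulrC; congr (_ *: graph_class _).
by apply/ffunP => y; rewrite !ffunE permM merge01_tperm.
Qed.

Lemma contract_admissible_half G (x : halfedge m.+1) t : admissible G ->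
  t (G x) = ord0 -> t (G (flip x)) = lift ord0 ord0 ->
  admissible (contract G x.1 t).
Proof.
move=> aG; case: x => e [] /= ts tt; last exact: contract_admissible.
pose t' := (t * tperm ord0 (lift ord0 ord0))%g.
have -> : contract G e t = contract G e t'.
  by apply/ffunP => y'; rewrite !ffunE permM merge01_tperm.
apply: contract_admissible => //; rewrite /t' permM /source /target.
  by rewrite tt tpermR.
by rewrite ts tpermL.
Qed.

End CollapseTheory.

Section BoundarySquare.
Variables k m : nat.
Implicit Types (G : graph k.+3 m.+2) (t : {perm 'I_k.+3}).
Notation q := (quot_pi (relators k.+1 m)).

Lemma collapse_reorder G (e : 'I_m.+2) t t' (f : 'I_m.+1) : admissible G ->
  t (source G e) = ord0 -> t (target G e) = lift ord0 ord0 ->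
  t' (source G e) = ord0 -> t' (target G e) = lift ord0 ord0 ->
  (-1) ^+ t *: q (collapse (contract G e t) f) =
  (-1) ^+ t' *: q (collapse (contract G e t') f).
Proof.
move=> aG ts tt t's t't.
have iso1 : is_iso 1 1 G G by apply/forallP => x; rewrite !perm1 !eqxx.
have := contract_iso (e := e) (t := t) (t' := t') iso1.
rewrite perm1 /= => /(_ ts tt t's t't)[s1 [h1 [iso sgn hf]]].
rewrite (collapse_iso f (contract_admissible aG ts tt) (contract_admissible aG t's t't) iso).
have -> : (h1 (f, false)).1 = f by apply: (@lift_inj _ e); rewrite hf perm1.
rewrite scalerA sgn /iso_sign odd_perm1 expr0 mul1r big1 => [|j _]; last first.
  by rewrite perm1.
by rewrite mulr1 mulrA -expr2 sqrr_sign mul1r.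
Qed.

Lemma collapse_reorder_half G (x : halfedge m.+2) t t' (f : 'I_m.+1) : admissible G ->
  t (G x) = ord0 -> t (G (flip x)) = lift ord0 ord0 ->
  t' (source G x.1) = ord0 -> t' (target G x.1) = lift ord0 ord0 ->
  (-1) ^+ t' *: q (collapse (contract G x.1 t') f) =
  ((-1) ^+ x.2 * (-1) ^+ t) *: q (collapse (contract G x.1 t) f).
Proof.
case: x => e [] aG /= ts tt t's t't; last by rewrite mul1r; apply: collapse_reorder.
pose u := (t * tperm ord0 (lift ord0 ord0))%g.
have us : u (source G e) = ord0 by rewrite permM /source tt tpermR.
have ut : u (target G e) = lift ord0 ord0 by rewrite permM /target ts tpermL.
rewrite (collapse_reorder f aG t's t't us ut) odd_permM odd_tperm signr_addb mulrC.
congr (_ *: q (collapse _ _)).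
by apply/ffunP => y; rewrite !ffunE permM merge01_tperm.
Qed.

(* The image of the second collapse, of the edge lift e f of G. *)
Definition collapse2 G (e : 'I_m.+2) (f : 'I_m.+1) : chain_space k.+1 m :=
  if source G e == target G e then 0
  else let s := to_front (source G e) (target G e) in
       (-1) ^+ s *: q (collapse (contract G e s) f).

Lemma collapse2_half G (x : halfedge m.+2) (y : halfedge m.+1) t (u : {perm 'I_k.+2}) :
  admissible G ->
  t (G x) = ord0 -> t (G (flip x)) = lift ord0 ord0 ->
  u (contract G x.1 t y) = ord0 ->
  u (contract G x.1 t (flip y)) = lift ord0 ord0 ->
  collapse2 G x.1 y.1 =
  ((-1) ^+ x.2 * (-1) ^+ y.2 * (-1) ^+ t * (-1) ^+ u) *:
    graph_class (contract (contract G x.1 t) y.1 u).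
Proof.
move=> aG ts tt us ut; have nl : source G x.1 != target G x.1.
  apply/eqP; case: x ts tt {us ut} => e [] /=.
    by rewrite /source /target => ts tt h; move: tt; rewrite h ts.
  by rewrite /source /target => ts tt h; move: tt; rewrite -h ts.
have aC := contract_admissible_half aG ts tt.
rewrite /collapse2 (negPf nl); have [t0s t0t] := to_frontP nl.
rewrite (collapse_reorder_half _ aG ts tt) // (collapse_class_half aC us ut).
by rewrite scalerA mulrACA [in LHS]mulrA.
Qed.

Lemma collapse_boundary2E G : admissible G ->
  collapse_boundary k m (collapse_boundary k.+1 m.+1 (graph_class G)) =
  \sum_e \sum_f collapse2 G e f.
Proof.
move=> aG; rewrite collapse_boundaryE // lfun_sum; apply: eq_bigr => e _ /=.
rewrite /collapse2 /collapse; case: eqVneq => [_|nl].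
  by rewrite !linear0 big1.
have [t0s t0t] := to_frontP nl.
rewrite lfunZ lfunZ collapse_boundaryE ?contract_admissible //.
by rewrite scaler_sumr.
Qed.

End BoundarySquare.

Local Notation o0 := ord0.
Local Notation o1 := (lift ord0 ord0).
Local Notation o2 := (lift ord0 (lift ord0 ord0)).
Local Notation o3 := (lift ord0 (lift ord0 (lift ord0 ord0))).

Definition cyc3 n : {perm 'I_n.+3} := (tperm o0 o1 * tperm o1 o2)%g.

Lemma cyc3_0 n : cyc3 n o0 = o2. Proof. by rewrite permM !tpermL. Qed.
Lemma cyc3_1 n : cyc3 n o1 = o0. Proof. by rewrite permM tpermR tpermD. Qed.
Lemma cyc3_2 n : cyc3 n o2 = o1.
Proof. by rewrite permM (@tpermD _ o0 o1) // tpermR. Qed.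
Lemma cyc3_lift n w : cyc3 n (lift ord0 (lift ord0 (lift ord0 w))) =
  lift ord0 (lift ord0 (lift ord0 w)).
Proof. by rewrite permM !tpermD. Qed.
Lemma odd_cyc3 n : odd_perm (cyc3 n) = false.
Proof. by rewrite odd_permM !odd_tperm. Qed.

Definition swap4 n : {perm 'I_n.+4} := (tperm o0 o2 * tperm o1 o3)%g.

Lemma swap4_0 n : swap4 n o0 = o2. Proof. by rewrite permM tpermL tpermD. Qed.
Lemma swap4_1 n : swap4 n o1 = o3.
Proof. by rewrite permM (@tpermD _ o0 o2) // tpermL. Qed.
Lemma swap4_2 n : swap4 n o2 = o0. Proof. by rewrite permM tpermR tpermD. Qed.
Lemma swap4_3 n : swap4 n o3 = o1.
Proof. by rewrite permM (@tpermD _ o0 o2) // tpermR. Qed.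
Lemma swap4_lift n w :
  swap4 n (lift ord0 (lift ord0 (lift ord0 (lift ord0 w)))) =
  lift ord0 (lift ord0 (lift ord0 (lift ord0 w))).
Proof. by rewrite permM !tpermD. Qed.
Lemma odd_swap4 n : odd_perm (swap4 n) = false.
Proof. by rewrite odd_permM !odd_tperm. Qed.

Lemma front3 n (a b c : 'I_n.+3) : uniq [:: a; b; c] ->
  exists p : {perm 'I_n.+3}, [/\ p a = o0, p b = o1 & p c = o2].
Proof.
rewrite /= !inE negb_or => /and3P[/andP[ab ac] bc _].
have [pa pb] := to_frontP ab; move: (to_front a b) pa pb => p pa pb.
exists (p * tperm (p c) o2)%g; rewrite !permM tpermL pa pb.
split=> //; apply: tpermD => //.
  by rewrite -pa (inj_eq perm_inj) eq_sym.
by rewrite -pb (inj_eq perm_inj) eq_sym.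
Qed.

Lemma front4 n (a b c d : 'I_n.+4) : uniq [:: a; b; c; d] ->
  exists p : {perm 'I_n.+4}, [/\ p a = o0, p b = o1, p c = o2 & p d = o3].
Proof.
move=> u; have [dabc abc] : d \notin [:: a; b; c] /\ uniq [:: a; b; c].
  by move: u; rewrite -[[:: a; b; c; d]]/(rcons [:: a; b; c] d) rcons_uniq => /andP[].
have [p [pa pb pc]] := front3 abc.
move: dabc; rewrite !inE !negb_or => /and3P[da db dc].
exists (p * tperm (p d) o3)%g; rewrite !permM tpermL pa pb pc.
split=> //; apply: tpermD => //.
- by rewrite -pa (inj_eq perm_inj).
- by rewrite -pb (inj_eq perm_inj).
by rewrite -pc (inj_eq perm_inj).
Qed.

Section Antisymmetry.
Variables m : nat.

Lemma lift_lift (e e2 : 'I_m.+2) (f f' : 'I_m.+1) (j : 'I_m) :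
  lift e f = e2 -> lift e2 f' = e -> lift e (lift f j) = lift e2 (lift f' j).
Proof.
move=> h h'; apply: val_inj; move: (congr1 val h) (congr1 val h') => /= {}h {}h'.
rewrite bumpC h; congr (bump e2 (bump _ j)).
rewrite -[val f'](bumpK e2) h' /unbump -h /bump.
by case: (leqP e f) => le; rewrite ?add0n ?add1n ?le // !ltnNge leqW ?le.
Qed.

Lemma collapse2_loop k (G : graph k.+3 m.+2) (e : 'I_m.+2) (f : 'I_m.+1) :
  G (lift e f, false) = G (lift e f, true) ->
  collapse2 G e f = 0.
Proof.
move=> h; rewrite /collapse2; case: eqVneq => // nl.
by rewrite /collapse /source /target !ffunE /= h eqxx linear0 scaler0.
Qed.

Lemma collapse2_parallel k (G : graph k.+3 m.+2) (e : 'I_m.+2) (f : 'I_m.+1) b :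
  G (lift e f, b) = G (e, false) -> G (lift e f, ~~ b) = G (e, true) ->
  collapse2 G e f = 0.
Proof.
move=> h h'; rewrite /collapse2; case: eqVneq => // nl.
have [s0 s1] := to_frontP nl.
rewrite /collapse /source /target !ffunE /=.
suff -> : merge01 (to_front (G (e, false)) (G (e, true)) (G (lift e f, false))) =
          merge01 (to_front (G (e, false)) (G (e, true)) (G (lift e f, true))).
  by rewrite eqxx linear0 scaler0.
by case: b h h' => /= -> ->; rewrite -/(source G e) -/(target G e) s0 s1
  merge01_0 merge01_lift.
Qed.

Lemma collapse2_loop1 k (G : graph k.+3 m.+2) (e : 'I_m.+2) (f : 'I_m.+1) :
  G (e, false) = G (e, true) -> collapse2 G e f = 0.
Proof. by rewrite /collapse2 /source /target => ->; rewrite eqxx. Qed.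

(* The two edges share exactly one vertex. *)
Lemma collapse2_path k (G : graph k.+3 m.+2) (x y : halfedge m.+2) (f f' : 'I_m.+1) :
  admissible G -> lift x.1 f = y.1 -> lift y.1 f' = x.1 ->
  G (flip x) = G y -> uniq [:: G x; G y; G (flip y)] ->
  collapse2 G x.1 f = - collapse2 G y.1 f'.
Proof.
move=> aG fE f'E xy /front3[p [px py pz]].
have cE b : contract G x.1 p (f, b) = merge01 (p (G (y.1, b))).
  by rewrite ffunE /= fE.
have c'E b : contract G y.1 (p * cyc3 k) (f', b) = merge01 ((p * cyc3 k)%g (G (x.1, b))).
  by rewrite ffunE /= f'E.
have flipE z : flip z = (z.1, ~~ z.2) :> halfedge m.+2 by [].
have yE : G (y.1, y.2) = G y by rewrite -surjective_pairing.
have xE : G (x.1, x.2) = G x by rewrite -surjective_pairing.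
rewrite (@collapse2_half _ _ G x (f, y.2) p 1) //; first last.
- by rewrite perm1 cE -flipE pz merge01_lift.
- by rewrite perm1 cE yE py merge01_lift.
- by rewrite xy.
rewrite (@collapse2_half _ _ G y (f', ~~ x.2) (p * cyc3 k)%g 1) //; first last.
- by rewrite perm1 c'E negbK xE permM px cyc3_0 merge01_lift.
- by rewrite perm1 c'E -flipE xy permM py cyc3_1 merge01_0.
- by rewrite permM pz cyc3_2.
- by rewrite permM py cyc3_1.
rewrite -scaleNr; congr (_ *: graph_class _).
  rewrite odd_perm1 odd_permM odd_cyc3 addbF signrN mulrN !mulNr opprK.
  by rewrite ![_ * (-1) ^+ x.2]mulrC.
apply/ffunP => -[j b]; rewrite !ffunE /= (lift_lift _ fE f'E) !perm1 permM.
move: (p _) => v; case: (unliftP o0 v) => [w|] ->; last first.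
  by rewrite cyc3_0 !(merge01_0, merge01_lift).
case: (unliftP o0 w) => [{}w|] ->; last first.
  by rewrite cyc3_1 !(merge01_0, merge01_lift).
case: (unliftP o0 w) => [{}w|] ->; last by rewrite cyc3_2 !(merge01_0, merge01_lift).
by rewrite cyc3_lift.
Qed.

(* The two edges are disjoint. *)
Lemma collapse2_disjoint k (G : graph k.+4 m.+2) (x y : halfedge m.+2) (f f' : 'I_m.+1) :
  admissible G -> lift x.1 f = y.1 -> lift y.1 f' = x.1 ->
  uniq [:: G x; G (flip x); G y; G (flip y)] ->
  collapse2 G x.1 f = - collapse2 G y.1 f'.
Proof.
move=> aG fE f'E /front4[p [px px' py py']].
pose r := (p * swap4 k)%g.
have rx : r (G x) = o2 by rewrite permM px swap4_0.
have rx' : r (G (flip x)) = o3 by rewrite permM px' swap4_1.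
have ry : r (G y) = o0 by rewrite permM py swap4_2.
have ry' : r (G (flip y)) = o1 by rewrite permM py' swap4_3.
have cE b : contract G x.1 p (f, b) = merge01 (p (G (y.1, b))).
  by rewrite ffunE /= fE.
have c'E b : contract G y.1 r (f', b) = merge01 (r (G (x.1, b))).
  by rewrite ffunE /= f'E.
have flipE z : flip z = (z.1, ~~ z.2) :> halfedge m.+2 by [].
have yE : G (y.1, y.2) = G y by rewrite -surjective_pairing.
have xE : G (x.1, x.2) = G x by rewrite -surjective_pairing.
have c0 : cyc3 k (contract G x.1 p (f, y.2)) = o0.
  by rewrite cE yE py merge01_lift cyc3_1.
have c1 : cyc3 k (contract G x.1 p (flip (f, y.2))) = o1.
  by rewrite cE -flipE py' merge01_lift cyc3_2.
have c'0 : cyc3 k (contract G y.1 r (f', x.2)) = o0.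
  by rewrite c'E xE rx merge01_lift cyc3_1.
have c'1 : cyc3 k (contract G y.1 r (flip (f', x.2))) = o1.
  by rewrite c'E -flipE rx' merge01_lift cyc3_2.
rewrite (collapse2_half aG px px' c0 c1) (collapse2_half aG ry ry' c'0 c'1) /=.
have iso : is_iso (tperm o0 o1) 1
    (contract (contract G x.1 p) f (cyc3 k)) (contract (contract G y.1 r) f' (cyc3 k)).
  apply/forallP => -[j b]; rewrite !perm1 eqxx /= !ffunE /= (lift_lift _ fE f'E) [r _]permM.
  move: (p _) => v; apply/eqP; case: (unliftP o0 v) => [w|] ->; last first.
    by rewrite swap4_0 merge01_lift merge01_0 cyc3_0 cyc3_1 merge01_0 merge01_lift tpermR.
  case: (unliftP o0 w) => [{}w|] ->; last first.
    by rewrite swap4_1 !merge01_lift cyc3_0 cyc3_2 !merge01_lift tpermR.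
  case: (unliftP o0 w) => [{}w|] ->; last first.
    by rewrite swap4_2 merge01_lift merge01_0 cyc3_0 cyc3_1 merge01_0 merge01_lift tpermL.
  case: (unliftP o0 w) => [{}w|] ->; last first.
    by rewrite swap4_3 !merge01_lift cyc3_0 cyc3_2 !merge01_lift tpermL.
  by rewrite swap4_lift !merge01_lift cyc3_lift !merge01_lift tpermD.
have a1 := contract_admissible_half (contract_admissible_half aG px px') c0 c1.
have a2 := contract_admissible_half (contract_admissible_half aG ry ry') c'0 c'1.
rewrite (graph_class_iso a1 a2 iso) scalerA -scaleNr; congr (_ *: _).
have r_odd : odd_perm r = odd_perm p by rewrite odd_permM odd_swap4 addbF.
rewrite /iso_sign odd_tperm big1 => [|e _]; last by rewrite perm1.
rewrite mulr1 mulrN1 odd_cyc3 r_odd; congr (- _).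
by rewrite [_ ^+ x.2 * _]mulrC.
Qed.

(* Collapsing two edges in the two possible orders gives opposite graphs. *)
Lemma collapse2_anti k (G : graph k.+3 m.+2) (e e2 : 'I_m.+2) (f f' : 'I_m.+1) :
  admissible G -> lift e f = e2 -> lift e2 f' = e ->
  collapse2 G e f = - collapse2 G e2 f'.
Proof.
move=> aG fE f'E.
have zero : collapse2 G e f = 0 -> collapse2 G e2 f' = 0 ->
  collapse2 G e f = - collapse2 G e2 f' by move=> -> ->; rewrite oppr0.
have [le|ne] := eqVneq (G (e, false)) (G (e, true)).
  by apply: zero; [apply: collapse2_loop1 | apply: collapse2_loop; rewrite f'E].
have [lf|nf] := eqVneq (G (e2, false)) (G (e2, true)).
  by apply: zero; [apply: collapse2_loop; rewrite fE | apply: collapse2_loop1].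
have path (b c : bool) : G (e, ~~ b) = G (e2, c) -> G (e, b) != G (e2, ~~ c) ->
    collapse2 G e f = - collapse2 G e2 f'.
  move=> h n; apply: (@collapse2_path _ G (e, b) (e2, c)) => //=.
  rewrite /flip /= !inE !negb_or n -h !andbT.
  rewrite [X in X && _](_ : _ = true) /=; first by rewrite h; case: (c); rewrite // eq_sym.
  by case: (b); rewrite // eq_sym.
have [ac|nac] := eqVneq (G (e, false)) (G (e2, false)).
  have [bd|nbd] := eqVneq (G (e, true)) (G (e2, true)); last exact: (path true false).
  by apply: zero; [apply: (@collapse2_parallel _ G e f false)
                  |apply: (@collapse2_parallel _ G e2 f' false)]; rewrite ?fE ?f'E.
have [ad|nad] := eqVneq (G (e, false)) (G (e2, true)).
  have [bc|nbc] := eqVneq (G (e, true)) (G (e2, false)); last exact: (path true true).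
  by apply: zero; [apply: (@collapse2_parallel _ G e f true)
                  |apply: (@collapse2_parallel _ G e2 f' true)]; rewrite ?fE ?f'E.
have [bc|nbc] := eqVneq (G (e, true)) (G (e2, false)); first exact: (path false false).
have [bd|nbd] := eqVneq (G (e, true)) (G (e2, true)); first exact: (path false true).
have u4 : uniq [:: G (e, false); G (e, true); G (e2, false); G (e2, true)].
  by rewrite /= !inE !negb_or ne nac nad nbc nbd nf.
case: k G aG zero path ne nf nac nad nbc nbd u4 => [|k] G aG _ _ _ _ _ _ _ _ u4.
  by have := max_card (mem [:: G (e, false); G (e, true); G (e2, false); G (e2, true)]);
    rewrite (card_uniqP u4) card_ord.
exact: (@collapse2_disjoint _ G (e, false) (e2, false)).
Qed.

Lemma collapse_boundary2_class k (G : graph k.+3 m.+2) : admissible G ->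
  collapse_boundary k m (collapse_boundary k.+1 m.+1 (graph_class G)) = 0.
Proof.
move=> aG; rewrite collapse_boundary2E //.
pose D e e2 := if unlift e e2 is Some f then collapse2 G e f else 0.
have DE e : \sum_f collapse2 G e f = \sum_e2 D e e2.
  rewrite (bigD1_ord e) //= {1}/D unlift_none add0r.
  by apply: eq_bigr => f _; rewrite /D liftK.
have Danti e e2 : D e e2 = - D e2 e.
  rewrite /D; case: unliftP => [f fE|eE]; case: unliftP => [f' f'E|eE'].
  - by apply: collapse2_anti.
  - by move: fE; rewrite eE' => /eqP; rewrite (negPf (neq_lift _ _)).
  - by move: f'E; rewrite eE => /eqP; rewrite (negPf (neq_lift _ _)).
  by rewrite oppr0.
rewrite (eq_bigr _ (fun e _ => DE e)); set S := \sum_e _.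
have SN : S = - S.
  rewrite {1}/S exchange_big /S -sumrN; apply: eq_bigr => e _.
  by rewrite -sumrN; apply: eq_bigr => e2 _; exact: Danti.
have : (2%:R : rat) *: S = 0 by rewrite scaler_nat mulr2n {1}SN addNr.
by move/eqP; rewrite scaler_eq0 => /orP[//|/eqP].
Qed.

End Antisymmetry.

Lemma chain_span k m (V : vectType rat) (F : 'Hom(chain_space k m, V)) :
  (forall G, admissible G -> F (graph_class G) = 0) -> F = 0.
Proof.
move=> F0; apply/lfunP => x; rewrite zero_lfunE -(quot_reprK x).
move: (quot_repr _ x) => y.
have -> : y = \sum_(A : agraph k m) (y A : rat) *: ket (val A).
  apply/ffunP => B; rewrite sum_ffunE (bigD1 B) //= !ffunE eqxx.
  rewrite big1 ?addr0 => [|A AB]; first by rewrite /GRing.scale /= mulr1.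
  by rewrite !ffunE eq_sym (inj_eq val_inj) (negPf AB) /GRing.scale /= mulr0.
rewrite lfun_sum lfun_sum big1 // => A _.
by rewrite !lfunZ -/(graph_class _) F0 ?(valP A) // scaler0.
Qed.

Lemma boundaryK n i : (boundary n i.-1 \o boundary n i = 0)%VF.
Proof.
case: i => [|[|[|i]]] /=; rewrite ?comp_lfun0l ?comp_lfun0r //.
by apply: chain_span => G aG; rewrite comp_lfunE; apply: collapse_boundary2_class.
Qed.

(* Main.v *)
(** Graphs with a loop vanish and isomorphic graphs agree up to sign, so the complex
    of rank n is described by finite tables of loopless graphs with k vertices,
    2 <= k <= 2n - 2. The trivalent graphs, k = 2n - 2, are exhausted by growing
    connected partial graphs one edge at a time. Every other graph is obtained by
    contracting an edge at a trivalent vertex, so a table that is closed under such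
    contractions of the graphs of the table above it is complete.

    A graph with an odd automorphism vanishes, and the remaining ones, the even
    graphs, span. The signed number of isomorphisms to a fixed graph is a functional
    on chains, so pairwise non-isomorphic even graphs are linearly independent.
    Triangular blocks in the matrices of the boundary operators (discrete Morse
    matchings, with two rows combined from several graphs when n = 7) bound the
    ranks from below; since the square of the boundary is zero, these bounds are
    sharp next to each exceptional degree, and all other homology vanishes.

    The tables, the isomorphisms and the pivots come from an unverified search. Its
    output is a certificate, which a verified procedure checks. *)
Require Import Defs.
From Corelib Require Import PosDef.
Import BinNums.
From HB Require Import structures.
From mathcomp Require Import all_boot all_order all_algebra all_fingroup.
Set Implicit Arguments. Unset Strict Implicit. Unset Printing Implicit Defensive.
Import GRing.Theory.

(** The evidence is asymmetric. One odd automorphism shows that a graph vanishes, and one relabeling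
    shows that a contraction lies in a table; evenness and non-isomorphism speak of all isomorphisms
    and cost a backtracking search. Evenness is therefore tested only where a lower bound uses it:
    at the pivots, and for whole tables in the exceptional degrees. Elsewhere an upper bound of the
    chain dimension and lower bounds of the two adjacent ranks already leave no room for homology.
    The edges of a code lead from the smaller to the larger vertex. The sign of an isomorphism is
    then determined by its vertex permutation, and interchanging parallel edges contributes no sign;
    so isomorphisms are searched among bijections of vertices only. The checking functions are meant
    for call-by-value evaluation: they use structural comparisons on [nat] and [positive] and, where
    it matters, conditionals in place of [||], of which both sides would be computed. *)

Notation edge := (nat * nat)%type.
(* The list of the lists, one for each vertex [i], of the [j > i] adjacent to [i],
   with multiplicities. *)
Notation code := (seq (seq nat)).
Notation uint := Hexadecimal.uint.

(** * Graphs as lists of edges *)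

(** Inversions modulo 2: the sign of a permutation given by its list of values. *)
Fixpoint parity (l : seq nat) : bool :=
  if l is x :: l' then
    parity l' (+) foldr (fun y b => if Nat.ltb y x then ~~ b else b) false l'
  else false.

Definition ledge (p : seq nat) (e : edge) : edge := (nth 0 p e.1, nth 0 p e.2).

Definition flips (p : seq nat) (es : seq edge) : bool :=
  foldr (fun e b => if Nat.ltb (nth 0 p e.2) (nth 0 p e.1) then ~~ b else b) false es.

Lemma nat_leb m n : Nat.leb m n = (m <= n).
Proof. by elim: m n => [|m IH] [|n] //=; rewrite IH. Qed.

Lemma nat_ltb m n : Nat.ltb m n = (m < n).
Proof. exact: nat_leb. Qed.

Lemma nat_eqb m n : Nat.eqb m n = (m == n).
Proof. by elim: m n => [|m IH] [|n] //=; rewrite IH. Qed.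

Definition norm (e : edge) : edge := if e.1 <= e.2 then e else (e.2, e.1).

Definition relab (p : seq nat) (es : seq edge) := [seq norm (ledge p e) | e <- es].

Definition in_range K (es : seq edge) := all (fun e => (e.1 < K) && (e.2 < K)) es.

Section Realize.
Variables k m : nat.

Definition realize (es : seq edge) : graph k.+1 m :=
  [ffun x : halfedge m => inord (let e := nth (0, 0) es x.1 in if x.2 then e.2 else e.1)].

Definition edge_list (G : graph k.+1 m) : seq edge :=
  [seq (nat_of_ord (source G e), nat_of_ord (target G e)) | e <- enum 'I_m].

Lemma size_edge_list G : size (edge_list G) = m.
Proof. by rewrite size_map size_enum_ord. Qed.

Lemma edge_list_in_range G : in_range k.+1 (edge_list G).
Proof. by apply/allP => _ /mapP[e _ ->] /=; rewrite !ltn_ord. Qed.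

Lemma nth_edge_list G (e : 'I_m) :
  nth (0, 0) (edge_list G) e = (nat_of_ord (source G e), nat_of_ord (target G e)).
Proof. by rewrite (nth_map e) ?size_enum_ord // nth_ord_enum. Qed.

Lemma realizeK G : realize (edge_list G) = G.
Proof.
apply/ffunP => -[e b]; rewrite ffunE /= nth_edge_list /=.
by case: b; rewrite /= inord_val.
Qed.

Lemma val_realize es (e : 'I_m) b : size es = m -> in_range k.+1 es ->
  realize es (e, b) = (if b then (nth (0, 0) es e).2 else (nth (0, 0) es e).1) :> nat.
Proof.
move=> sz /allP /(_ (nth (0, 0) es e)); rewrite mem_nth ?sz // => /(_ isT)/andP[h1 h2].
by rewrite ffunE /= inordK //; case: b.
Qed.

End Realize.

Lemma perm_of_seq n (l : seq nat) : perm_eq l (iota 0 n) ->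
  {s : {perm 'I_n} | forall i : 'I_n, s i = nth 0 l i :> nat}.
Proof.
move=> pl; have sl : size l = n by rewrite (perm_size pl) size_iota.
have ul : uniq l by rewrite (perm_uniq pl) iota_uniq.
have lt (i : 'I_n) : nth 0 l i < n.
  have : nth 0 l i \in l by rewrite mem_nth ?sl.
  by rewrite (perm_mem pl) mem_iota.
have inj : injective (fun i => Ordinal (lt i)).
  move=> i j /(congr1 val) /= /eqP; rewrite nth_uniq ?sl // => /eqP; exact: val_inj.
by exists (perm inj) => i; rewrite permE.
Qed.

Lemma parity_mono (f : nat -> nat) l : {mono f : x y / x < y} ->
  parity (map f l) = parity l.
Proof.
move=> fm; elim: l => //= x l ->; congr (_ (+) _).
by elim: l => //= y l ->; rewrite !nat_ltb fm.
Qed.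

Lemma odd_foldr T (P : pred T) l :
  foldr (fun y b => if P y then ~~ b else b) false l = odd (count P l).
Proof. by elim: l => //= y l ->; rewrite oddD; case: (P y). Qed.

Lemma count_enum_ltn n x : x < n -> count (fun y => y < x) (iota 0 n) = x.
Proof.
move=> xn; rewrite -size_filter -[in RHS](size_iota 0 x); congr size.
rewrite -(subnKC (ltnW xn)) iotaD filter_cat add0n.
rewrite (_ : filter _ (iota 0 x) = iota 0 x); last first.
  by apply/all_filterP/allP => y; rewrite mem_iota.
rewrite (_ : filter _ _ = [::]) ?cats0 //; apply/eqP; rewrite -(negbK (_ == _)) -has_filter.
by apply/hasPn => y; rewrite mem_iota -leqNgt => /andP[].
Qed.

(** Induction on [n]: removing the point 0 leaves a permutation [t] whose values are shifted by
    [bump (s ord0)]. Exactly [s ord0] of the later values are smaller than the first one, which is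
    the sign in [odd_lift_perm]. *)
Lemma parity_perm n (s : {perm 'I_n}) :
  parity [seq nat_of_ord (s i) | i <- enum 'I_n] = odd_perm s.
Proof.
elim: n s => [|n IH] s.
  rewrite (_ : s = 1%g) ?odd_perm1; last by apply/permP => -[].
  by rewrite (size0nil (_ : size (enum 'I_0) = 0)) // size_enum_ord.
have [t ts] : exists t, s = lift_perm ord0 (s ord0) t.
  pose u := (s * (lift_perm (s ord0) ord0 1))%g.
  have u0 : u ord0 = ord0 by rewrite permM lift_perm_id.
  have [r ru] := perm_fix0 u0; exists r.
  apply: (mulIg (lift_perm (s ord0) ord0 1)).
  by rewrite lift_permM mulg1 -ru.
have -> : odd_perm s = odd (s ord0) (+) odd_perm t by rewrite [in LHS]ts odd_lift_perm.
rewrite -IH enum_ordSl /= -map_comp.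
rewrite (_ : [seq _ | _ <- enum 'I_n] = map (bump (s ord0)) [seq nat_of_ord (t i) | i <- enum 'I_n]); last first.
  by rewrite -map_comp; apply: eq_map => i /=; rewrite [in LHS]ts lift_perm_lift.
rewrite parity_mono; last by move=> x y; rewrite !ltnNge leq_bump2.
rewrite addbC; congr (_ (+) _).
rewrite (odd_foldr (fun y => Nat.ltb y (s ord0))); congr odd.
have pe : perm_eq [seq nat_of_ord (s i) | i <- enum 'I_n.+1] (iota 0 n.+1).
  rewrite -val_enum_ord; apply: uniq_perm.
  - by rewrite map_inj_uniq ?enum_uniq // => i j /val_inj/perm_inj.
  - by rewrite map_inj_uniq ?enum_uniq //; exact: val_inj.
  move=> x; apply/mapP/mapP => -[i _ ->]; first by exists (s i); rewrite ?mem_enum.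
  by exists ((s^-1)%g i); rewrite ?mem_enum ?permKV.
have E : count (fun y => Nat.ltb y (s ord0)) (iota 0 n.+1) = s ord0.
  by rewrite -[RHS](@count_enum_ltn n.+1 (s ord0)) //; apply: eq_count => y; rewrite nat_ltb.
rewrite -[RHS]E -(seq.permP pe) enum_ordSl /= nat_ltb ltnn add0n -map_comp; congr count.
by rewrite -!map_comp; apply: eq_map => i /=; rewrite [in RHS]ts lift_perm_lift.
Qed.

Lemma perm_of_perm_eq (T : eqType) (x0 : T) (s t : seq T) m : size t = m ->
  perm_eq s t -> exists r : {perm 'I_m}, forall i : 'I_m, nth x0 s i = nth x0 t (r i).
Proof.
move=> st /(perm_iotaP x0)[Is pI ->]; rewrite st in pI.
have [r rE] := perm_of_seq pI; exists r => i.
by rewrite rE (nth_map 0) // (perm_size pI) size_iota.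
Qed.

Lemma flipsE p es :
  flips p es = odd (count (fun e => nth 0 p e.2 < nth 0 p e.1) es).
Proof.
rewrite /flips (odd_foldr (fun e => Nat.ltb (nth 0 p e.2) (nth 0 p e.1))).
by congr odd; apply: eq_count => e; rewrite nat_ltb.
Qed.

Lemma perm_relab p es es' : perm_eq es es' -> perm_eq (relab p es) (relab p es').
Proof. exact: perm_map. Qed.

Lemma prod_sign (m : nat) (F : 'I_m -> bool) :
  (\prod_(e < m) (-1) ^+ F e = (-1) ^+ odd (count F (enum 'I_m)) :> rat)%R.
Proof.
rewrite -big_enum /=; elim: (enum _) => [|e l IH]; first by rewrite big_nil.
by rewrite big_cons IH /= oddD oddb signr_addb.
Qed.

Lemma count_enum_nth (T : Type) (x0 : T) (P : pred T) (s : seq T) m : size s = m ->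
  count (fun i : 'I_m => P (nth x0 s i)) (enum 'I_m) = count P s.
Proof.
move=> sm; rewrite -{2}(mkseq_nth x0 s) sm -[mkseq _ _]/(map (nth x0 s) (iota 0 m)).
by rewrite -val_enum_ord !count_map; apply: eq_count.
Qed.

Lemma is_iso_flip k m (s : {perm 'I_k}) (h : {perm halfedge m}) (G G' : graph k m) :
  is_iso s h G G' ->
  forall e b, h (e, b) = ((h (e, false)).1, (h (e, false)).2 (+) b).
Proof.
move=> /forallP iso e [].
  have /andP[/eqP] := iso (e, false); rewrite /flip /= => -> _.
  by rewrite addbT.
by rewrite addbF; case: (h _).
Qed.

Lemma is_iso_edge_inj k m (s : {perm 'I_k}) (h : {perm halfedge m}) (G G' : graph k m) :
  is_iso s h G G' -> injective (fun e => (h (e, false)).1).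
Proof.
move=> iso e e' ee'; have hE := is_iso_flip iso.
have he : h (e, (h (e, false)).2) = h (e', (h (e', false)).2).
  by rewrite [LHS]hE [RHS]hE !addbb; congr (_, _).
by have /(congr1 fst) := perm_inj he.
Qed.

(** * Isomorphisms as relabelings of edge lists *)

Section Iso.
Variables k m : nat.
Implicit Types (es : seq edge) (p : seq nat).

Lemma iso_of_relab es es' p :
  size es = m -> in_range k.+1 es -> perm_eq p (iota 0 k.+1) ->
  perm_eq (relab p es) es' ->
  exists (s : {perm 'I_k.+1}) (h : {perm halfedge m}),
    is_iso s h (realize k m es) (realize k m es') /\
    iso_sign s h = ((-1) ^+ (parity p (+) flips p es))%R.
Proof.
move=> sz r pp pe.
have sz' : size es' = m by rewrite -(perm_size pe) size_map.
have [s sE] := perm_of_seq pp; have [t tE] := perm_of_perm_eq (0, 0) sz' pe.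
have r' : in_range k.+1 es'.
  rewrite /in_range -(perm_all _ pe) all_map; apply/allP => e ee.
  move/allP: r => /(_ e ee)/andP[e1 e2] /=.
  have n1 : nth 0 p e.1 < k.+1 by rewrite -(sE (Ordinal e1)).
  have n2 : nth 0 p e.2 < k.+1 by rewrite -(sE (Ordinal e2)).
  by rewrite /norm; case: ifP => _ /=; rewrite n1 n2.
(* [norm] turns an edge around exactly when [fl] holds, so the halves of [e] go to those of the edge
   at position [t e], exchanged if [fl e]. *)
pose fl (e : 'I_m) := let x := nth (0, 0) es e in nth 0 p x.2 < nth 0 p x.1.
pose hf (x : halfedge m) : halfedge m := (t x.1, x.2 (+) fl x.1).
have hf_inj : injective hf.
  by move=> [e b] [e' b'] [/perm_inj ->] /(congr1 (addb^~ (fl e'))); rewrite -!addbA addbb !addbF => ->.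
exists s, (perm hf_inj); split.
  apply/forallP => -[e b]; rewrite !permE /hf /flip /= addNb eqxx /=.
  apply/eqP/val_inj => /=; rewrite val_realize // sE val_realize //.
  rewrite -tE (nth_map (0, 0)) ?sz // /norm /ledge /fl /=.
  by case: leqP => _ /=; case: b.
rewrite /iso_sign signr_addb; congr (_ * _)%R.
  congr (_ ^+ nat_of_bool _)%R; rewrite -parity_perm; congr parity.
  have sp : size p = k.+1 by rewrite (perm_size pp) size_iota.
  apply: (@eq_from_nth _ 0); rewrite size_map size_enum_ord ?sp // => i ik.
  by rewrite (nth_map (Ordinal ik)) ?size_enum_ord // sE nth_enum_ord.
rewrite (eq_bigr (fun e => (-1) ^+ fl e)%R) => [|e _]; last by rewrite permE.
rewrite prod_sign flipsE; congr (_ ^+ nat_of_bool (odd _))%R.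
exact: (count_enum_nth (0, 0) (fun e => nth 0 p e.2 < nth 0 p e.1)).
Qed.

Definition seq_of_perm (s : {perm 'I_k.+1}) : seq nat := [seq nat_of_ord (s i) | i <- enum 'I_k.+1].

Lemma nth_seq_of_perm s (i : 'I_k.+1) : nth 0 (seq_of_perm s) i = s i.
Proof. by rewrite (nth_map i) ?size_enum_ord // nth_ord_enum. Qed.

Lemma seq_of_perm_iota s : perm_eq (seq_of_perm s) (iota 0 k.+1).
Proof.
rewrite -val_enum_ord; apply: uniq_perm.
- by rewrite map_inj_uniq ?enum_uniq // => i j /val_inj/perm_inj.
- by rewrite map_inj_uniq ?enum_uniq //; exact: val_inj.
move=> x; apply/mapP/mapP => -[i _ ->]; first by exists (s i); rewrite ?mem_enum.
by exists ((s^-1)%g i); rewrite ?mem_enum ?permKV.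
Qed.

Lemma norm_swap (x y : nat) : norm (x, y) = norm (y, x).
Proof. by rewrite /norm /=; case: ltngtP => // ->. Qed.

Lemma relab_of_iso es es' s h : size es = m -> size es' = m ->
  in_range k.+1 es -> in_range k.+1 es' ->
  is_iso s h (realize k m es) (realize k m es') ->
  perm_eq (relab (seq_of_perm s) es) (map norm es').
Proof.
move=> sz sz' r r' iso; have hE := is_iso_flip iso.
have isoG x : realize k m es' (h x) = s (realize k m es x).
  by have /forallP/(_ x)/andP[_ /eqP] := iso.
have tinj := is_iso_edge_inj iso; pose t := perm tinj.
have e1 i (im : i < m) : nth 0 (seq_of_perm s) (nth (0, 0) es i).1
    = s (realize k m es (Ordinal im, false)).
  by rewrite -nth_seq_of_perm val_realize.
have e2 i (im : i < m) : nth 0 (seq_of_perm s) (nth (0, 0) es i).2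
    = s (realize k m es (Ordinal im, true)).
  by rewrite -nth_seq_of_perm val_realize.
apply/(perm_iotaP (norm (0, 0))); exists [seq nat_of_ord (t i) | i <- enum 'I_m].
  rewrite size_map sz' -val_enum_ord; apply: uniq_perm.
  - by rewrite map_inj_uniq ?enum_uniq // => i j /val_inj/perm_inj.
  - by rewrite map_inj_uniq ?enum_uniq //; exact: val_inj.
  move=> x; apply/mapP/mapP => -[i _ ->]; first by exists (t i); rewrite ?mem_enum.
  by exists ((t^-1)%g i); rewrite ?mem_enum ?permKV.
apply: (@eq_from_nth _ (norm (0, 0))) => [|i]; rewrite size_map sz; first by rewrite !size_map -enumT size_enum_ord.
move=> im.
rewrite (nth_map (0, 0)) ?sz // (nth_map 0) ?size_map ?size_enum_ord //.
rewrite (nth_map (Ordinal im)) ?size_enum_ord // (_ : nth (Ordinal im) (enum 'I_m) i = Ordinal im); last first.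
  by apply: val_inj; rewrite /= nth_enum_ord.
rewrite (nth_map (0, 0)) ?sz' // permE /ledge e1 e2 -!isoG.
rewrite (hE _ true) addbT; case: (h (Ordinal im, false)) => j [] /=.
  by rewrite !val_realize //= norm_swap -surjective_pairing.
by rewrite !val_realize //= -surjective_pairing.
by rewrite -enumT size_enum_ord.
Qed.

(** As every edge of [es'] points upward, an edge is reversed exactly when its image pair is
    decreasing. The sign therefore depends on [s] alone, whatever [h] does with parallel edges. *)
Lemma iso_sign_seq es es' s h : size es = m -> size es' = m ->
  in_range k.+1 es -> in_range k.+1 es' ->
  all (fun e => e.1 < e.2) es' ->
  is_iso s h (realize k m es) (realize k m es') ->
  iso_sign s h = ((-1) ^+ (parity (seq_of_perm s) (+) flips (seq_of_perm s) es))%R.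
Proof.
move=> sz sz' r r' lt' iso; have hE := is_iso_flip iso.
have isoG x : realize k m es' (h x) = s (realize k m es x).
  by have /forallP/(_ x)/andP[_ /eqP] := iso.
rewrite /iso_sign parity_perm signr_addb; congr (_ * _)%R.
rewrite (eq_bigr (fun e : 'I_m => (-1) ^+
   (let x := nth (0, 0) es e in nth 0 (seq_of_perm s) x.2 < nth 0 (seq_of_perm s) x.1)%N)%R).
  rewrite prod_sign flipsE; congr (_ ^+ nat_of_bool (odd _))%R.
  exact: (count_enum_nth (0, 0) (fun e => nth 0 (seq_of_perm s) e.2 < nth 0 (seq_of_perm s) e.1)).
move=> e _; congr (_ ^+ nat_of_bool _)%R.
have -> : nth 0 (seq_of_perm s) (nth (0, 0) es e).1 = s (realize k m es (e, false)).
  by rewrite -nth_seq_of_perm val_realize.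
have -> : nth 0 (seq_of_perm s) (nth (0, 0) es e).2 = s (realize k m es (e, true)).
  by rewrite -nth_seq_of_perm val_realize.
rewrite -!isoG (hE _ true) addbT; case: (h (e, false)) => j b /=; rewrite !val_realize //.
have /(allP lt') : nth (0, 0) es' j \in es' by rewrite mem_nth ?sz'.
by case: b => /= lt; [rewrite lt | rewrite ltnNge ltnW].
Qed.

End Iso.

(** * Classes of graphs under isomorphism and contraction *)

Section Class.
Variables k m : nat.
Implicit Types (G : graph k m).

Lemma is_iso_sym (s : {perm 'I_k}) (h : {perm halfedge m}) G G' :
  is_iso s h G G' -> is_iso s^-1%g h^-1%g G' G.
Proof.
move=> /forallP iso; apply/forallP => x.
have /andP[/eqP hf /eqP hG] := iso ((h^-1)%g x); rewrite permKV in hf hG.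
by rewrite -hf hG !permK !eqxx.
Qed.

Lemma admissible_iso_imp (s : {perm 'I_k}) (h : {perm halfedge m}) G G' :
  is_iso s h G G' -> admissible G -> admissible G'.
Proof.
move=> iso /andP[/andP[k0 /forallP cG] /forallP vG].
have isoG x : G' (h x) = s (G x) by have /forallP/(_ x)/andP[_ /eqP] := iso.
have isoF x : h (flip x) = flip (h x) by have /forallP/(_ x)/andP[/eqP] := iso.
apply/andP; split; [apply/andP; split=> //|].
  apply/forallP => u; apply/forallP => v.
  rewrite -(permKV s u) -(permKV s v); move: (s^-1%g u) (s^-1%g v) => {}u {}v.
  have /forallP/(_ v)/connectP[q pq ->] := cG u.
  elim: q u pq => //= w q IH u /andP[/existsP[x /andP[/eqP xu /eqP xw]] pq].
  apply: connect_trans (IH w pq); apply: connect1; apply/existsP; exists (h x).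
  by rewrite -isoF !isoG xu xw !eqxx.
apply/forallP => v; apply: leq_trans (vG (s^-1%g v)) _.
rewrite /valence -(card_imset (mem [set x | G x == (s^-1)%g v]) (@perm_inj _ h)).
apply: subset_leq_card; apply/subsetP => _ /imsetP[x xv ->].
by move: xv; rewrite !inE isoG => /eqP ->; rewrite permKV.
Qed.

Lemma admissible_iso (s : {perm 'I_k}) (h : {perm halfedge m}) G G' :
  is_iso s h G G' -> admissible G = admissible G'.
Proof.
move=> iso; apply/idP/idP; apply: admissible_iso_imp; first exact: iso.
exact: is_iso_sym iso.
Qed.

Lemma graph_class_eq0 G : ~~ admissible G -> graph_class G = 0%R.
Proof.
move=> nG; rewrite /graph_class (_ : ket G = 0%R) ?linear0 //.
by apply/ffunP => A; rewrite !ffunE; case: eqP => // AG; rewrite -AG (valP A) in nG.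
Qed.

Lemma graph_class_isoE (s : {perm 'I_k}) (h : {perm halfedge m}) G G' :
  is_iso s h G G' -> graph_class G = (iso_sign s h *: graph_class G')%R.
Proof.
move=> iso; have [aG|naG] := boolP (admissible G).
  by apply: graph_class_iso => //; rewrite -(admissible_iso iso).
by rewrite !graph_class_eq0 ?scaler0 // -(admissible_iso iso).
Qed.

Lemma rat_sign_eq0 (V : lmodType rat) (v : V) : (v = - v -> v = 0)%R.
Proof.
move=> vN; have : (2%:R *: v = 0)%R by rewrite scaler_nat mulr2n {1}vN addNr.
by move/eqP; rewrite scaler_eq0 => /orP[//|/eqP].
Qed.

(** Exchanging the two halves of the loop is an automorphism that reverses one edge and fixes all
    vertices, so it has sign -1. *)
Lemma graph_class_loop G (e : 'I_m) : G (e, false) = G (e, true) -> graph_class G = 0%R.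
Proof.
move=> loop; pose h := tperm ((e, false) : halfedge m) (e, true).
have hE f b : h (f, b) = (f, b (+) (f == e)).
  rewrite /h; case: tpermP => [[-> ->]|[-> ->]|]; rewrite ?eqxx //.
  by have [->|_] := eqVneq f e; case: b => //; rewrite addbF.
have iso : is_iso 1%g h G G.
  apply/forallP => -[f b]; rewrite perm1 /flip !hE /= addNb eqxx /=.
  by have [->|_] := eqVneq f e; rewrite ?addbF //; case: b => /=; rewrite loop.
apply: rat_sign_eq0; rewrite {1}(graph_class_isoE iso) -scaleN1r; congr (_ *: _)%R.
rewrite /iso_sign odd_perm1 mul1r (bigD1 e) //= hE eqxx big1 ?mulr1 // => f fe.
by rewrite hE (negPf fe).
Qed.

End Class.

Definition class k m (es : seq edge) : chain_space k.+1 m := graph_class (realize k m es).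

Lemma class_relab k m es es' p :
  size es = m -> in_range k.+1 es -> perm_eq p (iota 0 k.+1) ->
  perm_eq (relab p es) es' ->
  (class k m es = (-1) ^+ (parity p (+) flips p es) *: class k m es')%R.
Proof.
move=> sz r pp pe; have [s [h [iso sgn]]] := iso_of_relab sz r pp pe.
by rewrite /class (graph_class_isoE iso) sgn.
Qed.

Lemma class_loop k m es : size es = m -> in_range k.+1 es ->
  has (fun e => e.1 == e.2) es -> class k m es = 0%R.
Proof.
move=> sz r /(has_nthP (0, 0))[i]; rewrite sz => im /eqP l.
by apply: (@graph_class_loop _ _ _ (Ordinal im)); apply: ord_inj; rewrite !val_realize.
Qed.

Lemma perm_iota_surj (p : seq nat) n : size p = n -> {subset iota 0 n <= p} ->
  perm_eq p (iota 0 n).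
Proof.
move=> sz sub; rewrite perm_sym; apply: uniq_perm; first exact: iota_uniq.
  by apply: leq_size_uniq sub _; rewrite ?iota_uniq // size_iota sz.
have [] // := uniq_min_size (iota_uniq 0 n) sub.
by rewrite size_iota sz.
Qed.

(** Certificates describe a contraction by a vertex map [p] that agrees at [i] and [j], instead of
    [to_front] and [merge01]. The list that sends [i] to 0 and any other [x] to [p x + 1] is the
    permutation [to_front] followed by the induced relabeling of the contracted graph, shifted to
    fix 0; its parity contains both signs. *)
Lemma collapse_relab k m (pre post es' : seq edge) (i j : nat) (p : seq nat) (e : 'I_m.+1) :
  let es := pre ++ (i, j) :: post in
  size es = m.+1 -> in_range k.+2 es -> size pre = e -> i != j ->
  size p = k.+2 -> nth 0 p i = nth 0 p j -> {subset iota 0 k.+1 <= p} ->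
  perm_eq (relab p (pre ++ post)) es' ->
  admissible (realize k.+1 m.+1 es) ->
  (quot_pi (relators k.+1 m) (collapse (realize k.+1 m.+1 es) e) =
   (-1) ^+ (parity (set_nth 0 (map S p) i 0) (+) flips p (pre ++ post)) *: class k m es')%R.
Proof.
move=> es sz r se nij sp pij surj pe aG.
have szr : size (pre ++ post) = m.
  by move: sz; rewrite /es !size_cat /= addnS => -[].
have nthe : nth (0, 0) es e = (i, j) by rewrite nth_cat -se ltnn subnn.
have /andP[ik jk] : (i < k.+2) && (j < k.+2).
  by move/allP: r => /(_ (i, j)); apply; rewrite mem_cat inE eqxx orbT.
pose a : 'I_k.+2 := Ordinal ik; pose b : 'I_k.+2 := Ordinal jk.
have sE : source (realize k.+1 m.+1 es) e = a.
  by apply: ord_inj; rewrite /source val_realize // nthe.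
have tE : target (realize k.+1 m.+1 es) e = b.
  by apply: ord_inj; rewrite /target val_realize // nthe.
have [ta tb] : to_front a b a = ord0 /\ to_front a b b = lift ord0 ord0 by apply: to_frontP.
set t := to_front a b in ta tb.
rewrite (collapse_class aG (t := t)) ?sE ?tE //.
pose mu (v : nat) : nat := merge01 (t (inord v)).
(* The map induced by [p] on the merged vertices: [w] comes from the vertex that [t] sends to
   [w + 1]. For [w = 0] this is [b], and [a] gives the same value. *)
pose p' := [seq nth 0 p ((t^-1)%g (lift ord0 w)) | w <- enum 'I_k.+1].
have mu_lt v : mu v < k.+1 by rewrite ltn_ord.
have p'mu v : v < k.+2 -> nth 0 p' (mu v) = nth 0 p v.
  move=> vk; rewrite (nth_map ord0) ?size_enum_ord // nth_ord_enum.
  have -> : v = nat_of_ord (inord v : 'I_k.+2) by rewrite inordK.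
  rewrite /mu inord_val; move: (inord v : 'I_k.+2) => {vk}v.
  have [->|va] := eqVneq v a.
    by rewrite ta merge01_0 -tb permK pij.
  have : ord0 != t v by rewrite -ta (inj_eq perm_inj) eq_sym.
  move=> /unlift_some[w tv _]; rewrite tv merge01_lift -tv permK //.
have pp' : perm_eq p' (iota 0 k.+1).
  apply: perm_iota_surj; first by rewrite size_map size_enum_ord.
  move=> w /surj /(nthP 0)[v vp <-]; rewrite sp in vp; rewrite -p'mu //.
  by rewrite mem_nth // size_map size_enum_ord.
pose es1 := [seq (mu x.1, mu x.2) | x <- pre ++ post].
have rr : in_range k.+2 (pre ++ post).
  by move: r; rewrite /in_range !all_cat /= => /and3P[-> _ ->].
have cE : contract (realize k.+1 m.+1 es) e t = realize k m es1.
  apply/ffunP => -[f c]; apply: ord_inj.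
  rewrite val_realize ?size_map //; last by apply/allP => _ /mapP[x _ ->] /=; rewrite !mu_lt.
  rewrite (nth_map (0, 0)) ?szr // ffunE /=.
  have -> : realize k.+1 m.+1 es (lift e f, c) =
     inord (if c then (nth (0, 0) (pre ++ post) f).2 else (nth (0, 0) (pre ++ post) f).1).
    rewrite ffunE /=; congr inord.
    suff -> : nth (0, 0) es (bump e f) = nth (0, 0) (pre ++ post) f by [].
    rewrite /es !nth_cat se /bump; case: (leqP e f) => fe.
      by rewrite add1n ltnNge leqW //= subSn.
    by rewrite add0n fe.
  by rewrite /mu; case: c.
have r1 : in_range k.+1 es1 by apply/allP => _ /mapP[x _ ->] /=; rewrite !mu_lt.
have relE : relab p' es1 = relab p (pre ++ post).
  rewrite /relab -map_comp; apply/eq_in_map => x xin /=.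
  by move/allP: rr => /(_ x xin)/andP[x1 x2]; rewrite /ledge /= !p'mu.
have fE : flips p' es1 = flips p (pre ++ post).
  rewrite !flipsE count_map; congr odd; apply: eq_in_count => x xin /=.
  by move/allP: rr => /(_ x xin)/andP[x1 x2]; rewrite !p'mu.
rewrite cE -/(class k m es1) (class_relab (p := p') (es' := es')) ?size_map ?relE //.
rewrite scalerA fE [in LHS](signr_addb _ (parity p')) [in RHS](signr_addb _ (parity _)) mulrA; congr (_ * _ *: _)%R.
have [s' s'E] := perm_of_seq pp'.
have -> : parity p' = odd_perm s'.
  rewrite -parity_perm; congr parity.
  have sp' : size p' = k.+1 by rewrite size_map size_enum_ord.
  apply: (@eq_from_nth _ 0) => [|x]; rewrite sp'; first by rewrite size_map size_enum_ord.
  move=> xk.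
  by rewrite (nth_map (Ordinal xk) 0 (fun i => nat_of_ord (s' i))) ?size_enum_ord // s'E nth_enum_ord.
pose Q := (t * lift_perm ord0 ord0 s')%g.
suff -> : set_nth 0 (map S p) i 0 = seq_of_perm Q.
  by rewrite parity_perm /Q (odd_permM t) odd_lift_perm /= [in RHS](signr_addb _ (odd_perm t)).
apply: (@eq_from_nth _ 0).
  by rewrite size_set_nth size_map sp size_map size_enum_ord; apply/maxn_idPr.
rewrite size_set_nth size_map sp (maxn_idPr _) // => x xk.
rewrite nth_set_nth /= -[in RHS]/(nat_of_ord (Ordinal xk)) nth_seq_of_perm permM.
have [xi|xi] := eqVneq x i.
  by rewrite (_ : Ordinal xk = a) ?ta ?lift_perm_id //; apply: val_inj.
have : ord0 != t (Ordinal xk) by rewrite -ta (inj_eq perm_inj) eq_sym; apply: contra xi => /eqP/(congr1 val) /= ->.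
move=> /unlift_some[w tw _]; rewrite tw lift_perm_lift /= s'E.
rewrite (nth_map 0) ?sp // -p'mu // /bump /= add1n; congr (nth 0 p' _).+1.
by rewrite /mu (_ : inord x = Ordinal xk) ?tw ?merge01_lift //; apply: val_inj; rewrite /= inordK.
Qed.

(** * Admissible graphs and codes *)

Definition deg (v : nat) (es : seq edge) := count (fun e => e.1 == v) es + count (fun e => e.2 == v) es.

Definition loopless (es : seq edge) := all (fun e => e.1 != e.2) es.

(** Connectedness without paths. This form is easily transported through relabelings and vertex
    splittings, and it is what the marking procedure establishes. *)
Definition linked K (es : seq edge) := forall P : nat -> bool,
  (forall e, e \in es -> P e.1 = P e.2) -> forall i j, i < K -> j < K -> P i = P j.

Definition good K (es : seq edge) :=
  [/\ in_range K es, loopless es, forall v, v < K -> 2 < deg v es & linked K es].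

Lemma deg_perm v es es' : perm_eq es es' -> deg v es = deg v es'.
Proof. by move=> /seq.permP pe; rewrite /deg !pe. Qed.

Lemma deg_cons v e es : deg v (e :: es) = (e.1 == v) + (e.2 == v) + deg v es.
Proof. by rewrite /deg /= addnACA. Qed.

Lemma deg_norm v es : deg v (map norm es) = deg v es.
Proof.
elim: es => //= e es IH; rewrite !deg_cons IH /norm; case: ifP => _ //=.
by rewrite [X in X + _ = _]addnC.
Qed.

Lemma valence_realize k m es (v : 'I_k.+1) : size es = m -> in_range k.+1 es ->
  valence (realize k m es) v = deg v es.
Proof.
move=> sz r; rewrite /valence -sum1dep_card.
rewrite big_mkcond /= (eq_bigr (fun x : 'I_m * bool =>
  if realize k m es (x.1, x.2) == v then 1 else 0)); last by case.
rewrite -(pair_bigA _ (fun e b => if realize k m es (e, b) == v then 1 else 0)) /=.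
transitivity (\sum_(e < m) (((nth (0, 0) es e).1 == v) + ((nth (0, 0) es e).2 == v))).
  apply: eq_bigr => e _; rewrite big_bool /= addnC -!(inj_eq val_inj) /= !val_realize //.
rewrite big_split /= /deg; congr addn.
  rewrite -(count_enum_nth (0, 0) (fun e : edge => e.1 == v) sz) -sum1_count big_enum_cond [in RHS]big_mkcond /=.
  by apply: eq_bigr => i _; case: eqP.
rewrite -(count_enum_nth (0, 0) (fun e : edge => e.2 == v) sz) -sum1_count big_enum_cond [in RHS]big_mkcond /=.
by apply: eq_bigr => i _; case: eqP.
Qed.

Lemma linked_connected k m es : size es = m -> in_range k.+1 es -> linked k.+1 es ->
  connected (realize k m es).
Proof.
move=> sz r lk; apply/andP; split=> //; apply/forallP => u; apply/forallP => v.
pose P x := if insub x is Some w then connect (adjacent (realize k m es)) u w else false.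
have PE (w : 'I_k.+1) : P w = connect (adjacent (realize k m es)) u w by rewrite /P valK.
rewrite -PE -(lk P _ u v) ?PE // => e ee.
have /andP[e1 e2] : (e.1 < k.+1) && (e.2 < k.+1) by move/allP: r; apply.
rewrite -[e.1]/(nat_of_ord (Ordinal e1)) -[e.2]/(nat_of_ord (Ordinal e2)) !PE.
have im : index e es < m by rewrite -sz index_mem.
have adj b : adjacent (realize k m es) (realize k m es (Ordinal im, b)) (realize k m es (Ordinal im, ~~ b)).
  by apply/existsP; exists (Ordinal im, b); rewrite !eqxx.
have E1 : realize k m es (Ordinal im, false) = Ordinal e1.
  by apply: ord_inj; rewrite val_realize //= nth_index.
have E2 : realize k m es (Ordinal im, true) = Ordinal e2.
  by apply: ord_inj; rewrite val_realize //= nth_index.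
apply/idP/idP => h; apply: connect_trans h _; apply: connect1.
  by rewrite -E1 -E2; apply: (adj false).
by rewrite -E1 -E2; apply: (adj true).
Qed.

Lemma connected_linked k m (G : graph k.+1 m) : connected G -> linked k.+1 (edge_list G).
Proof.
move=> /andP[_ /forallP cG] P Pe i j ik jk.
have /forallP/(_ (Ordinal jk)) := cG (Ordinal ik).
rewrite -[i]/(nat_of_ord (Ordinal ik)) -[j]/(nat_of_ord (Ordinal jk)).
move: (Ordinal ik) (Ordinal jk) => {}i {}j {ik jk} /connectP[q pq ->].
elim: q i pq => //= x q IH i /andP[/existsP[[e b] /andP[/eqP yi /eqP yx]] pq].
rewrite -(IH x pq) -yi -yx; have := Pe (nth (0, 0) (edge_list G) e).
rewrite mem_nth ?size_edge_list // nth_edge_list => /(_ isT) /=; rewrite /source /target /flip /=.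
by case: b {yi yx} => ->.
Qed.

Lemma admissible_realize k m es : size es = m -> good k.+1 es -> admissible (realize k m es).
Proof.
move=> sz [r _ dg lk]; apply/andP; split; first exact: linked_connected.
by apply/forallP => v; rewrite valence_realize // dg.
Qed.

Lemma good_edge_list k m (G : graph k.+1 m) : admissible G ->
  (forall e : 'I_m, G (e, false) != G (e, true)) -> good k.+1 (edge_list G).
Proof.
move=> /andP[cG /forallP vG] ll; split.
- exact: edge_list_in_range.
- by apply/allP => _ /mapP[e _ ->] /=; apply: ll.
- move=> v vk; have := vG (Ordinal vk); rewrite -{1}(realizeK G).
  by rewrite valence_realize ?size_edge_list ?edge_list_in_range.
exact: connected_linked.
Qed.

(** * Codes of graphs and their validity *)

Fixpoint insert_sorted (j : nat) (r : seq nat) : seq nat :=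
  if r is x :: r' then if Nat.leb j x then j :: r else x :: insert_sorted j r'
  else [:: j].

Fixpoint insert_edge (i j : nat) (c : code) {struct c} : code :=
  match c, i with
  | r :: c', 0 => insert_sorted j r :: c'
  | r :: c', i'.+1 => r :: insert_edge i' j c'
  | [::], _ => [::]
  end.

Definition add_edge (a b : nat) (c : code) : code :=
  if Nat.ltb a b then insert_edge a b c else insert_edge b a c.

Fixpoint rows_edges (i : nat) (c : code) : seq edge :=
  if c is r :: c' then foldr (fun j es => (i, j) :: es) (rows_edges i.+1 c') r else [::].

Definition code_edges : code -> seq edge := rows_edges 0.

(** Sorted insertion gives equal codes for equal multisets of edges, so a comparison of graphs up to
    the order of edges is one [code_eqb]. *)
Definition add_edges (p : seq nat) (es : seq edge) (c : code) : code :=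
  foldr (fun e c => add_edge (nth 0 p e.1) (nth 0 p e.2) c) c es.

Lemma perm_insert_sorted j r : perm_eq (insert_sorted j r) (j :: r).
Proof.
elim: r => //= x r IH; case: Nat.leb => //.
by apply: perm_trans (_ : perm_eq _ [:: x, j & r]) _; rewrite ?perm_cons // (perm_catCA [:: x] [:: j]).
Qed.

Lemma rows_edges_cons i r c : rows_edges i (r :: c) = [seq (i, j) | j <- r] ++ rows_edges i.+1 c.
Proof. by rewrite /=; elim: r => //= j r ->. Qed.

Lemma perm_insert_edge i j n c : i < size c ->
  perm_eq (rows_edges n (insert_edge i j c)) ((n + i, j) :: rows_edges n c).
Proof.
elim: c i n => // r c IH [|i] n ic; rewrite [insert_edge _ _ _]/= !rows_edges_cons.
  rewrite addn0 -cat_cons perm_cat2r.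
  by have := perm_map (pair n) (perm_insert_sorted j r).
rewrite -cat1s perm_sym perm_catCA perm_cat2l perm_sym.
by have := IH i n.+1 ic; rewrite addSnnS.
Qed.

Lemma size_insert_edge i j c : size (insert_edge i j c) = size c.
Proof. by elim: c i => // r c IH [|i] //=; rewrite IH. Qed.

Lemma perm_add_edge a b c : a < size c -> b < size c ->
  perm_eq (code_edges (add_edge a b c)) (norm (a, b) :: code_edges c).
Proof.
move=> ac bc; rewrite /add_edge nat_ltb /norm /=.
case: ltngtP => [ab|ab|ab]; [exact: (@perm_insert_edge a b 0)|exact: (@perm_insert_edge b a 0)|].
by rewrite ab; apply: (@perm_insert_edge b b 0).
Qed.

Lemma size_add_edges p es c : size (add_edges p es c) = size c.
Proof. by elim: es => //= e es IH; rewrite /add_edge; case: ifP; rewrite size_insert_edge. Qed.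

Lemma perm_add_edges p es c : all (fun x => x < size c) p -> 0 < size c ->
  perm_eq (code_edges (add_edges p es c)) (relab p es ++ code_edges c).
Proof.
move=> pc c0; have lt x : nth 0 p x < size c.
  by case: (ltnP x (size p)) => [xp|px]; [apply: (allP pc); rewrite mem_nth | rewrite nth_default].
elim: es => //= e es IH; apply: perm_trans (perm_add_edge _ _) _; rewrite ?size_add_edges //.
by rewrite perm_cons.
Qed.

Lemma code_edges_nseq K : code_edges (nseq K [::]) = [::].
Proof. by rewrite /code_edges; elim: K 0 => //= K IH n. Qed.

Fixpoint seq_eqb (r s : seq nat) : bool :=
  match r, s with
  | [::], [::] => true
  | x :: r', y :: s' => Nat.eqb x y && seq_eqb r' s'
  | _, _ => false
  end.

Fixpoint code_eqb (c d : code) : bool :=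
  match c, d with
  | [::], [::] => true
  | x :: c', y :: d' => seq_eqb x y && code_eqb c' d'
  | _, _ => false
  end.

Lemma seq_eqbP r s : seq_eqb r s -> r = s.
Proof. by elim: r s => [|x r IH] [|y s] //= /andP[]; rewrite nat_eqb => /eqP -> /IH ->. Qed.

Lemma code_eqbP c d : code_eqb c d -> c = d.
Proof. by elim: c d => [|x c IH] [|y d] //= /andP[/seq_eqbP -> /IH ->]. Qed.

Definition edge_eqb (e f : edge) := Nat.eqb e.1 f.1 && Nat.eqb e.2 f.2.

Lemma edge_eqbE e f : edge_eqb e f = (e == f).
Proof. by rewrite /edge_eqb !nat_eqb; case: e f => a b [c d]. Qed.

Fixpoint update (T : Type) (f : T -> T) (s : seq T) (n : nat) {struct s} : seq T :=
  match s, n with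
  | x :: s', 0 => f x :: s'
  | x :: s', n'.+1 => x :: update f s' n'
  | [::], _ => [::]
  end.

Lemma nth_update T (x0 : T) f s n i : n < size s ->
  nth x0 (update f s n) i = if i == n then f (nth x0 s n) else nth x0 s i.
Proof. by elim: s n i => // x s IH [|n] [|i] //= /IH ->. Qed.

Lemma size_update T (f : T -> T) s n : size (update f s n) = size s.
Proof. by elim: s n => // x s IH [|n] //=; rewrite IH. Qed.

Definition degrees K (es : seq edge) : seq nat :=
  foldr (fun e ds => update S (update S ds e.1) e.2) (nseq K 0) es.

Lemma size_degrees K es : size (degrees K es) = K.
Proof. by elim: es => [|e es IH] /=; rewrite ?size_nseq // !size_update. Qed.

Lemma nth_degrees K es v : in_range K es -> v < K -> nth 0 (degrees K es) v = deg v es.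
Proof.
move=> + vK; elim: es v vK => [|e es IH] v vK /=; first by rewrite nth_nseq vK.
move=> /andP[/andP[e1 e2] r]; rewrite deg_cons !nth_update ?size_update ?size_degrees //.
rewrite !IH // [e.1 == v]eq_sym [e.2 == v]eq_sym.
have [->|_] := eqVneq v e.2; last by have [->|_] := eqVneq v e.1; rewrite ?addn0 ?add0n.
by have [->|_] := eqVneq e.2 e.1; rewrite ?addn0 ?add0n.
Qed.

Fixpoint increasing_from (x K : nat) (r : seq nat) : bool :=
  if r is y :: r' then [&& Nat.ltb x y, Nat.ltb y K & increasing_from x K r'] else true.

Fixpoint rows_ok (i K : nat) (c : code) : bool :=
  if c is r :: c' then increasing_from i K r && rows_ok i.+1 K c' else true.

Fixpoint mark (es : seq edge) (fl : seq bool) : seq bool :=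
  if es is e :: es' then
    if nth false fl e.1 || nth false fl e.2
    then mark es' (update (fun=> true) (update (fun=> true) fl e.1) e.2)
    else mark es' fl
  else fl.

(** In a connected graph each pass marks a further vertex until all are marked, so the [K] passes
    allowed by [code_ok] suffice. *)
Fixpoint all_marked (n : nat) (es : seq edge) (fl : seq bool) : bool :=
  if all id fl then true else if n is n'.+1 then all_marked n' es (mark es fl) else false.

Definition code_ok K m (c : code) : bool :=
  let es := code_edges c in
  [&& Nat.eqb (size c) K, rows_ok 0 K c, Nat.eqb (size es) m,
      all (fun d => Nat.ltb 2 d) (degrees K es) & all_marked K es (true :: nseq K.-1 false)].

Definition ordered K (es : seq edge) := all (fun e => (e.1 < e.2) && (e.2 < K)) es.

Lemma rows_okP i K c : rows_ok i K c -> ordered K (rows_edges i c).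
Proof.
elim: c i => // r c IH i; rewrite rows_edges_cons => /= /andP[h /IH oc].
rewrite /ordered all_cat [X in _ && X]oc andbT; elim: r h => //= x r IHr.
by rewrite !nat_ltb => /and3P[-> -> /IHr].
Qed.

Lemma ordered_in_range K es : ordered K es -> in_range K es.
Proof. by apply: sub_all => e /andP[h1 h2]; rewrite h2 (ltn_trans h1). Qed.

Lemma ordered_loopless K es : ordered K es -> loopless es.
Proof. by apply: sub_all => e /andP[/ltn_eqF -> _]. Qed.

Lemma ordered_norm K es : ordered K es -> map norm es = es.
Proof. by move=> /allP o; apply: map_id_in => e /o/andP[h _]; rewrite /norm ltnW. Qed.

Lemma size_mark es fl : size (mark es fl) = size fl.
Proof. by elim: es fl => //= e es IH fl; case: ifP => _; rewrite IH ?size_update. Qed.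

Lemma mark_constant K (P : nat -> bool) es fl : in_range K es -> size fl = K ->
  (forall e, e \in es -> P e.1 = P e.2) ->
  (forall v, nth false fl v -> P v = P 0) ->
  forall v, nth false (mark es fl) v -> P v = P 0.
Proof.
elim: es fl => //= e es IH fl /andP[/andP[e1 e2] r] sz Pe inv.
have Pes f : f \in es -> P f.1 = P f.2 by move=> fes; apply: Pe; rewrite inE fes orbT.
case: ifP => [h|_]; last exact: IH.
apply: IH => //; rewrite ?size_update // => v.
have P0 : P e.1 = P 0 by case/orP: h => /inv // <-; apply: Pe; rewrite mem_head.
rewrite !nth_update ?size_update ?sz //.
case: (v =P e.2) => [->|_]; first by rewrite -Pe ?mem_head.
by case: (v =P e.1) => [->|_ /inv].
Qed.

Lemma linked_marked K es fl n : in_range K es -> size fl = K ->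
  (forall P : nat -> bool, (forall e, e \in es -> P e.1 = P e.2) ->
     forall v, nth false fl v -> P v = P 0) ->
  all_marked n es fl -> linked K es.
Proof.
elim: n fl => [|n IH] fl r sz inv /=; case: ifP => [/all_nthP am _|_] //.
- by move=> P Pe i j iK jK; rewrite !(inv P Pe) //; apply: am; rewrite sz.
- by move=> P Pe i j iK jK; rewrite !(inv P Pe) //; apply: am; rewrite sz.
apply: IH => //; first by rewrite size_mark.
by move=> P Pe; apply: (mark_constant r sz Pe (inv P Pe)).
Qed.

Lemma code_okP K m c : 0 < K -> code_ok K m c ->
  [/\ size c = K, ordered K (code_edges c), size (code_edges c) = m & good K (code_edges c)].
Proof.
move=> K0 /and5P[]; rewrite !nat_eqb => /eqP sc /rows_okP o /eqP sm /allP dg mk.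
have r := ordered_in_range o; split=> //; split=> //.
- exact: ordered_loopless o.
- move=> v vK; rewrite -(nth_degrees r vK) -nat_ltb; apply: dg.
  by rewrite mem_nth // size_degrees.
apply: linked_marked mk => //; first by rewrite /= size_nseq prednK.
by move=> P _ [|v] //=; rewrite nth_nseq; case: ifP.
Qed.

(** * Tables closed under contraction *)

Definition covers K m (T : seq code) := forall es, size es = m -> good K es ->
  exists c, c \in T /\ exists p, perm_eq p (iota 0 K) /\ perm_eq (relab p es) (code_edges c).

Definition contracts_to K (p : seq nat) (e : edge) (pre post : seq edge) (c : code) : bool :=
  [&& all (fun x => Nat.ltb x K) p, Nat.eqb (size p) K.+1,
      Nat.eqb (nth 0 p e.1) (nth 0 p e.2) &
      code_eqb c (add_edges p pre (add_edges p post (nseq K [::])))].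

(** Here [s] will be the valence of the merged vertex. The test says that no other vertex of valence
    above 3 has a smaller valence, so the contraction creates a vertex of minimal valence above
    3. *)
Fixpoint others_ok (s : nat) (e : edge) (v : nat) (ds : seq nat) : bool :=
  if ds is d :: ds' then
    (if Nat.leb d 3 then true else if Nat.leb s d then true else if Nat.eqb v e.1 then true else Nat.eqb v e.2)
    && others_ok s e v.+1 ds'
  else true.

(* Every graph with a vertex of valence at least 4 arises by contracting such an
   edge: split off two half-edges at a vertex of minimal valence above 3. *)
Definition required (ds : seq nat) (e : edge) : bool :=
  let a := nth 0 ds e.1 in let b := nth 0 ds e.2 in
  (Nat.eqb a 3 || Nat.eqb b 3) && others_ok (a + b).-2 e 0 ds.

Lemma others_okP s e ds :
  (forall v, v < size ds -> v != e.1 -> v != e.2 -> nth 0 ds v <= 3 \/ s <= nth 0 ds v) ->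
  others_ok s e 0 ds.
Proof.
suff gen u : (forall v, v < size ds -> u + v != e.1 -> u + v != e.2 ->
    nth 0 ds v <= 3 \/ s <= nth 0 ds v) -> others_ok s e u ds.
  by move=> H; apply: gen => v; rewrite add0n; apply: H.
elim: ds u => //= d ds IH u H; apply/andP; split; last first.
  by apply: IH => v vs; rewrite addSnnS => ? ?; apply: (H v.+1).
have := H 0 isT; rewrite addn0 !nat_leb !nat_eqb /=.
case: (u == e.1); case: (u == e.2) => /=; do 2?case: ifP => //.
by move=> sd d3 /(_ isT isT)[]; rewrite ?sd ?d3.
Qed.

Lemma relab_comp p q es : in_range (size p) es ->
  relab q (relab p es) = relab [seq nth 0 q x | x <- p] es.
Proof.
move=> /allP r; rewrite /relab -map_comp; apply/eq_in_map => e /r/andP[e1 e2] /=.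
rewrite /ledge !(nth_map 0) //.
have nE x y : norm (x, y) = if x <= y then (x, y) else (y, x) by [].
by rewrite [norm (nth 0 p e.1, _)]nE; case: ifP => _ //=; rewrite norm_swap.
Qed.

Lemma relabE p es : relab p es = map norm (map (ledge p) es).
Proof. by rewrite -map_comp. Qed.

Lemma relab_cat p es es' : relab p (es ++ es') = relab p es ++ relab p es'.
Proof. exact: map_cat. Qed.

(** Surjectivity of [p] comes from the valences: each vertex of the code [c] lies on some relabeled
    edge. *)
Lemma contracts_toP K m p e pre post c : 0 < K -> code_ok K m c ->
  in_range K.+1 (pre ++ post) -> contracts_to K p e pre post c ->
  [/\ size p = K.+1, nth 0 p e.1 = nth 0 p e.2, {subset iota 0 K <= p} &
      perm_eq (relab p (pre ++ post)) (code_edges c)].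
Proof.
move=> K0 /(code_okP K0)[sc o sm [r ll dg lk]] rr /and4P[/allP lp].
rewrite !nat_eqb => /eqP sp /eqP pe /code_eqbP cE.
have alln : all (fun x => x < size (nseq K ([::] : seq nat))) p.
  by apply/allP => x /lp; rewrite nat_ltb size_nseq.
have pq : perm_eq (relab p (pre ++ post)) (code_edges c).
  rewrite cE perm_sym; apply: perm_trans (perm_add_edges _ _ _) _; rewrite ?size_add_edges ?size_nseq //.
    by move: alln; rewrite size_nseq.
  rewrite relab_cat perm_cat2l; apply: perm_trans (perm_add_edges _ alln _) _; rewrite ?size_nseq //.
  by rewrite code_edges_nseq cats0.
split=> // w; rewrite mem_iota add0n => /andP[_ wK].
have : 0 < deg w (relab p (pre ++ post)) by rewrite (deg_perm _ pq) (leq_trans _ (dg w wK)).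
rewrite relabE deg_norm /deg !count_map addn_gt0 -!has_count.
have mp x : x < K.+1 -> nth 0 p x \in p by move=> xK; rewrite mem_nth ?sp.
by move/allP: rr => rr /orP[] /hasP[x /rr/andP[x1 x2] /= /eqP <-]; apply: mp.
Qed.

Lemma sum_deg K es : in_range K es -> \sum_(v < K) deg v es = 2 * size es.
Proof.
elim: es => [|e es IH] /=; first by rewrite big1 ?muln0.
move=> /andP[/andP[e1 e2] r]; under eq_bigr do rewrite deg_cons.
rewrite big_split IH // mulnS; congr addn.
have one x : x < K -> \sum_(v < K) (x == v) = 1.
  move=> xK; rewrite (bigD1 (Ordinal xK)) //= eqxx big1 ?addn0 // => v vx.
  by rewrite eq_sym -(inj_eq val_inj) /= in vx; rewrite (negPf vx).
by rewrite big_split /= !one.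
Qed.

Lemma incident_edge v es : loopless es -> 0 < deg v es ->
  exists a es', a != v /\ (exists2 e, perm_eq es (e :: es') & norm e = norm (v, a)).
Proof.
move=> ll; rewrite /deg addn_gt0 -!has_count => /orP[] /hasP[e ee /eqP ev].
  exists e.2, (rem e es); split; first by rewrite -ev eq_sym; apply: (allP ll).
  by exists e; [exact: perm_to_rem | rewrite -ev -surjective_pairing].
exists e.1, (rem e es); split; first by rewrite -ev; apply: (allP ll).
by exists e; [exact: perm_to_rem | rewrite norm_swap -ev -surjective_pairing].
Qed.

Lemma norm_in_range K e : (norm e).1 < K -> (norm e).2 < K -> (e.1 < K) && (e.2 < K).
Proof. by rewrite /norm; case: ifP => _ /= -> ->. Qed.

Lemma good_norm K es : good K es -> good K (map norm es).
Proof.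
move=> [r l d lk]; split.
- rewrite /in_range all_map; apply: sub_all r => e /= /andP[h1 h2].
  by rewrite /norm; case: ifP => _ /=; rewrite h1 h2.
- rewrite /loopless all_map; apply: sub_all l => e /=.
  by rewrite /norm; case: ifP => _ //=; rewrite eq_sym.
- by move=> v; rewrite deg_norm; apply: d.
move=> P Pe; apply: lk => e ee; have := Pe (norm e) (map_f _ ee).
by rewrite /norm; case: ifP => _ /=.
Qed.

Lemma norm_idem e : norm (norm e) = norm e.
Proof.
have [h|h] := leqP e.1 e.2.
  by have E : norm e = e; [rewrite /norm h | rewrite !E].
have -> : norm e = (e.2, e.1) by rewrite /norm leqNgt h.
by rewrite /norm /= ltnW.
Qed.

Lemma relab_norm p es : relab p (map norm es) = relab p es.
Proof.
rewrite /relab -map_comp; apply: eq_map => e /=; rewrite [norm e]/norm /ledge.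
by case: ifP => _ //=; rewrite norm_swap.
Qed.

Lemma deg_relab K p es v : perm_eq p (iota 0 K) -> in_range K es -> v < K ->
  deg (nth 0 p v) (relab p es) = deg v es.
Proof.
move=> pp /allP r vK; have sp : size p = K by rewrite (perm_size pp) size_iota.
have up : uniq p by rewrite (perm_uniq pp) iota_uniq.
rewrite relabE deg_norm /deg !count_map; congr addn; apply: eq_in_count => e /r/andP[e1 e2] /=;
  by rewrite nth_uniq ?sp.
Qed.

Definition closed_under K (T : seq code) (c : code) :=
  forall l e r, code_edges c = l ++ e :: r ->
    required (degrees K.+1 (code_edges c)) e -> e \notin l -> e \notin r ->
  exists c' p, c' \in T /\ contracts_to K p e (rev l) r c'.

Lemma mem_split (T : eqType) (x : T) s : x \in s -> exists l r, s = l ++ x :: r.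
Proof. by case/splitPr => l r; exists l, r. Qed.

(** A vertex [v] of least valence above 3 is split: two of its edges, to [a] and [b], are moved to a
    new vertex [K] joined to [v]. The result is again good, so it occurs in [T], and contracting its
    edge between [v] and [K] returns the given graph. That edge is [required] by the choice of [v],
    and simple because [a] and [b] differ from [v]. *)
Lemma covers_contract K m (T T' : seq code) : 0 < K -> 3 * K < 2 * m ->
  (forall c, c \in T -> code_ok K.+1 m.+1 c) -> (forall c, c \in T' -> code_ok K m c) ->
  (forall c, c \in T -> closed_under K T' c) ->
  covers K.+1 m.+1 T -> covers K m T'.
Proof.
move=> K0 Km okT okT' clT cov es sz gd.
have [r0 ll0 dg0 lk0] := gd.
have [v [vK v4 vmin]] : exists v, [/\ v < K, 3 < deg v es &
    forall w, w < K -> 3 < deg w es -> deg v es <= deg w es].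
  (* If all valences were at most 3, their sum [2 * m] would be at most [3 * K]. *)
  have [w0 w04] : exists w0 : 'I_K, 3 < deg w0 es.
    apply/existsP; apply: contraTT Km; rewrite negb_exists => /forallP H.
    rewrite -leqNgt -sz -(sum_deg r0) mulnC -[X in _ <= X * _]card_ord -sum_nat_const.
    by apply: leq_sum => w _; rewrite leqNgt.
  by case: (@arg_minnP _ w0 (fun w => 3 < deg w es) (fun w => deg w es) w04) => v v4 vm;
    exists v; split=> // w wK; apply: (vm (Ordinal wK)).
have [a [es1 [av [e1 pe1 ne1]]]] := incident_edge ll0 (ltn_trans (isT : 0 < 3) v4).
have ll1 : loopless es1.
  by move: ll0; rewrite /loopless (perm_all _ pe1) => /andP[].
have deg1 u x y : norm x = norm y -> deg u [:: x] = deg u [:: y].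
  by move=> xy; rewrite -(deg_norm u [:: x]) -(deg_norm u [:: y]) /= xy.
have d1 u : deg u es = (v == u) + (a == u) + deg u es1.
  rewrite (deg_perm _ pe1) deg_cons; congr addn.
  by have := deg1 u _ _ ne1; rewrite !deg_cons /deg /= !addn0.
have [b [es2 [bv [e2 pe2 ne2]]]] : exists b es2, b != v /\
    exists2 e, perm_eq es1 (e :: es2) & norm e = norm (v, b).
  apply: incident_edge ll1 _; move: v4; rewrite d1 eqxx (negPf av) addn0 add1n ltnS.
  exact: leq_trans.
have d2 u : deg u es1 = (v == u) + (b == u) + deg u es2.
  rewrite (deg_perm _ pe2) deg_cons; congr addn.
  by have := deg1 u _ _ ne2; rewrite !deg_cons /deg /= !addn0.
have pe : perm_eq es [:: e1, e2 & es2].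
  by apply: perm_trans pe1 _; rewrite perm_cons.
have [/= e1K e2K r2] : [/\ (e1.1 < K) && (e1.2 < K), (e2.1 < K) && (e2.2 < K) & in_range K es2].
  by move: r0; rewrite /in_range (perm_all _ pe) /= => /and3P[].
have nr e : (e.1 < K) && (e.2 < K) -> ((norm e).1 < K) && ((norm e).2 < K).
  by rewrite /norm; case: ifP => //= _ /andP[-> ->].
have aK : a < K.
  by have /andP[h1 h2] := nr _ e1K; rewrite ne1 in h1 h2; have /andP[] := norm_in_range h1 h2.
have bK : b < K.
  by have /andP[h1 h2] := nr _ e2K; rewrite ne2 in h1 h2; have /andP[] := norm_in_range h1 h2.
have ll2 : loopless es2.
  by move: ll1; rewrite /loopless (perm_all _ pe2) => /andP[].
pose es' := [:: (v, K), (a, K), (b, K) & es2].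
have neqK x : x < K -> (x == K) = false by move=> xK; rewrite ltn_eqF.
have degK : deg K es2 = 0.
  apply/eqP; rewrite addn_eq0 !eqn0Ngt -!has_count; apply/andP.
  by split; apply/hasPn => x /(allP r2)/andP[x1 x2]; rewrite neqK.
have dE u : u < K -> deg u es' = if u == v then (deg v es).-1 else deg u es.
  move=> uK; rewrite /es' !deg_cons /= !(eq_sym K u) !(neqK u uK) !addn0.
  have [->|uv] := eqVneq u v; first by rewrite d1 d2 eqxx (negPf av) (negPf bv).
  by rewrite (d1 u) (d2 u) [v == u]eq_sym (negPf uv) !add0n.
have dK : deg K es' = 3.
  by rewrite /es' !deg_cons degK /= eqxx !neqK.
have gd' : good K.+1 es'.
  split.
  - rewrite /in_range /= !ltnSn !(leqW vK) !(leqW aK) !(leqW bK) /=.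
    by apply: sub_all r2 => x /andP[x1 x2]; rewrite !leqW.
  - by rewrite /loopless /= !neqK.
  - move=> u; rewrite ltnS leq_eqVlt => /orP[/eqP ->|uK]; first by rewrite dK.
    by rewrite dE //; case: eqP => [_|_]; [case: (deg v es) v4 | apply: dg0].
  move=> P Pe.
  have [Pv Pa Pb] : [/\ P v = P K, P a = P K & P b = P K].
    by split; [apply: (Pe (v, K)) | apply: (Pe (a, K)) | apply: (Pe (b, K))]; rewrite !inE eqxx ?orbT.
  have Pes : forall x, x \in map norm es -> P x.1 = P x.2.
    move=> _ /mapP[x xin ->]; move: xin; rewrite (perm_mem pe) !inE => /or3P[/eqP ->|/eqP ->|xe].
    - by rewrite ne1 /norm; case: ifP => _ /=; rewrite Pv Pa.
    - by rewrite ne2 /norm; case: ifP => _ /=; rewrite Pv Pb.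
    have := Pe x; rewrite !inE xe !orbT => /(_ isT).
    by rewrite /norm; case: ifP.
  have lk1 : forall i, i < K -> P i = P v.
    by move=> i iK; have [_ _ _ lkn] := good_norm gd; apply: (lkn P Pes).
  move=> i j; rewrite ltnS leq_eqVlt => /orP[/eqP ->|iK];
    rewrite ltnS leq_eqVlt => /orP[/eqP ->|jK] //.
  - by rewrite -Pv lk1.
  - by rewrite -Pv lk1.
  by rewrite !lk1.
have sz' : size es' = m.+1.
  by rewrite -sz (perm_size pe).
have [c [cT [p [pp pc]]]] := cov es' sz' gd'.
have sp : size p = K.+1 by rewrite (perm_size pp) size_iota.
have up : uniq p by rewrite (perm_uniq pp) iota_uniq.
have pK x : x < K.+1 -> nth 0 p x < K.+1.
  by move=> xK; have := mem_nth 0 (s := p) (n := x); rewrite sp (perm_mem pp) mem_iota; apply.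
have [sc oc smc [rc llc dgc lkc]] := code_okP (ltn0Sn K) (okT c cT).
have r' : in_range K.+1 es' by case: gd'.
pose f := norm (ledge p (v, K)).
have fc : f \in code_edges c by rewrite -(perm_mem pc) mem_head.
have [l [r cE]] := mem_split fc.
have injn x y z : x < K.+1 -> y < K.+1 -> z < K.+1 -> norm (ledge p (x, y)) = norm (ledge p (v, z)) ->
   ((x == v) && (y == z)) || ((x == z) && (y == v)).
  move=> xK yK zK; rewrite /norm /ledge /=.
  have vK1 : v < K.+1 by rewrite leqW.
  do 2!case: ifP => _; move=> [/eqP + /eqP]; rewrite !nth_uniq ?sp //.
  - by move=> -> ->.
  - by move=> -> ->; rewrite orbT.
  - by move=> -> ->; rewrite orbT.
  by move=> -> ->.
(* Only the edge between [v] and [K] can map to [f]: the other two edges at [K] end in [a] and [b],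
   and [es2] avoids [K]. *)
have cnt : count_mem f (code_edges c) = 1.
  rewrite -(seq.permP pc) count_map /= eqxx /=; apply/eqP; rewrite eqSS.
  have na : norm (ledge p (a, K)) != f.
    apply/eqP => /injn; rewrite !ltnSn !leqW // (negPf av) (eq_sym K) (neqK v) // andbF.
    by move=> /(_ isT isT isT).
  have nb : norm (ledge p (b, K)) != f.
    apply/eqP => /injn; rewrite !ltnSn !leqW // (negPf bv) (eq_sym K) (neqK v) // andbF.
    by move=> /(_ isT isT isT).
  rewrite (negPf na) (negPf nb) !add0n eqn0Ngt -has_count; apply/hasPn => -[x y] /(allP r2)/andP[/= xK yK].
  apply/eqP => /injn; rewrite ltnSn !leqW // !neqK // andbF.
  by move=> /(_ isT isT isT).
have [fl fr] : f \notin l /\ f \notin r.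
  move: cnt; rewrite cE count_cat /= eqxx addnCA add1n => -[] /eqP.
  by rewrite addn_eq0 => /andP[/eqP/count_memPn -> /eqP/count_memPn ->].
have dsE u : u < K.+1 -> nth 0 (degrees K.+1 (code_edges c)) (nth 0 p u) = deg u es'.
  by move=> uK; rewrite nth_degrees ?pK // -(deg_perm _ pc) (deg_relab pp).
have req : required (degrees K.+1 (code_edges c)) f.
  have dv : nth 0 (degrees K.+1 (code_edges c)) (nth 0 p v) = (deg v es).-1.
    by rewrite dsE ?leqW // dE // eqxx.
  have dKp : nth 0 (degrees K.+1 (code_edges c)) (nth 0 p K) = 3 by rewrite dsE.
  have [f1 f2] : (nth 0 (degrees K.+1 (code_edges c)) f.1 == 3) ||
      (nth 0 (degrees K.+1 (code_edges c)) f.2 == 3) /\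
      nth 0 (degrees K.+1 (code_edges c)) f.1 + nth 0 (degrees K.+1 (code_edges c)) f.2 = (deg v es).+2.
    have d3 : (deg v es).-1 + 3 = (deg v es).+2 by case: (deg v es) v4 => // ? _; rewrite addn3.
    rewrite /f /norm; case: ifP => _ /=; rewrite dv dKp eqxx ?orbT //; split=> //.
    by rewrite addnC.
  rewrite /required !nat_eqb f1 f2 /=; apply: others_okP => x; rewrite size_degrees => xK.
  have [y yK ->] : exists2 y, y < K.+1 & x = nth 0 p y.
    have : x \in p by rewrite (perm_mem pp) mem_iota.
    by move=> /(nthP 0)[y]; rewrite sp => yK <-; exists y.
  rewrite dsE // => h1 h2.
  have yv : y != v by apply/eqP => yE; move: h1 h2; rewrite yE /f /norm; case: ifP => _ /=; rewrite eqxx.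
  have yK' : y != K by apply/eqP => yE; move: h1 h2; rewrite yE /f /norm; case: ifP => _ /=; rewrite eqxx.
  move: yK; rewrite ltnS leq_eqVlt (negPf yK') /= => yK.
  rewrite dE // (negPf yv); case: (leqP (deg y es) 3) => [|y4]; [by left | right; exact: vmin].
have [c' [q [c'T cok]]] := clT c cT l f r cE req fl fr.
have ok' := okT' c' c'T.
have rlr : in_range K.+1 (rev l ++ r).
  move: rc; rewrite cE /in_range !all_cat /= => /and3P[rl _ ->].
  by rewrite all_rev rl.
have [sq qf sub pq] := contracts_toP K0 ok' rlr cok.
exists c'; split=> //.
(* The composite of [p] and [q] agrees at [v] and [K], so its restriction to the first [K] vertices
   relabels the given graph. *)
pose pK0 := [seq nth 0 q x | x <- p].
have ndef x : x < K.+1 -> nth 0 pK0 x = nth 0 q (nth 0 p x) by move=> xK; rewrite (nth_map 0) ?sp.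
have qvK : nth 0 pK0 v = nth 0 pK0 K.
  rewrite !ndef ?ltnSn ?(leqW vK) //; by move: qf; rewrite /f /norm; case: ifP => _ /= ->.
exists [seq nth 0 pK0 x | x <- iota 0 K].
have relE es0 : in_range K es0 -> relab [seq nth 0 pK0 x | x <- iota 0 K] es0 = relab pK0 es0.
  have nthI x : x < K -> nth 0 [seq nth 0 pK0 x | x <- iota 0 K] x = nth 0 pK0 x.
    by move=> xK; rewrite (nth_map 0) ?size_iota // nth_iota.
  by move=> /allP r3; apply/eq_in_map => x /r3/andP[x1 x2]; rewrite /ledge !nthI.
have plr : perm_eq (rev l ++ r) (relab p [:: (a, K), (b, K) & es2]).
  rewrite -(perm_cons f); apply: (@perm_trans _ (code_edges c)); last by rewrite perm_sym.
  by rewrite cE -cat_rcons -[f :: _ ++ _]cat_cons perm_cat2r perm_sym perm_rcons perm_cons perm_sym perm_rev.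
have pfin : perm_eq (relab [seq nth 0 pK0 x | x <- iota 0 K] es) (code_edges c').
  rewrite relE //; apply: perm_trans pq; rewrite perm_sym.
  apply: perm_trans (perm_relab q plr) _.
  rewrite relab_comp; last first.
    rewrite sp; case: gd' => + _ _ _; rewrite /in_range /= => /andP[_]; done.
  rewrite perm_sym; apply: perm_trans (perm_relab _ pe) _.
  rewrite -(relab_norm _ [:: e1, e2 & es2]) /= ne1 ne2.
  have swp x : norm (ledge pK0 (norm (v, x))) = norm (ledge pK0 (x, K)).
    have := relab_norm pK0 [:: (v, x)]; rewrite /relab /= => -[->].
    by rewrite norm_swap /ledge /= qvK.
  rewrite !swp; do 2!rewrite perm_cons.
  by have := relab_norm pK0 es2; rewrite /relab => ->.
split=> //; apply: perm_iota_surj; first by rewrite size_map size_iota.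
have [_ _ _ [_ _ dg' _]] := code_okP K0 ok'.
move=> w; rewrite mem_iota add0n => /andP[_ wK].
have : 0 < deg w (relab [seq nth 0 pK0 x | x <- iota 0 K] es).
  by rewrite (deg_perm _ pfin) (leq_trans _ (dg' w wK)).
rewrite relabE deg_norm /deg !count_map addn_gt0 -!has_count.
have mp x : x < K -> nth 0 [seq nth 0 pK0 x | x <- iota 0 K] x \in [seq nth 0 pK0 x | x <- iota 0 K].
  by move=> xK; rewrite mem_nth // size_map size_iota.
by move/allP: r0 => rr /orP[] /hasP[x /rr/andP[x1 x2] /= /eqP <-]; apply: mp.
Qed.

(** * Trivalent graphs *)

Fixpoint seq_uniqb (s : seq nat) : bool :=
  if s is x :: s' then ~~ has (Nat.eqb x) s' && seq_uniqb s' else true.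

Lemma has_eqb x s : has (Nat.eqb x) s = (x \in s).
Proof. by rewrite -has_pred1; apply: eq_has => y; rewrite nat_eqb eq_sym. Qed.

Lemma seq_uniqbE s : seq_uniqb s = uniq s.
Proof. by elim: s => //= x s ->; rewrite has_eqb. Qed.

Definition relabels q (p : seq nat) (es : seq edge) (c : code) : bool :=
  [&& Nat.eqb (size p) q, all (fun x => Nat.ltb x q) p, seq_uniqb p,
      Nat.eqb (size c) q & code_eqb c (add_edges p es (nseq q [::]))].

Lemma relabelsP q p es c : 0 < q -> relabels q p es c ->
  [/\ perm_eq p (iota 0 q), size c = q & perm_eq (relab p es) (code_edges c)].
Proof.
move=> q0 /and5P[]; rewrite !nat_eqb seq_uniqbE => /eqP sp /allP lp up /eqP sc /code_eqbP cE.
have sub : {subset p <= iota 0 q} by move=> x /lp; rewrite nat_ltb mem_iota.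
split=> //.
  apply: uniq_perm => //; first exact: iota_uniq.
  have [] // := uniq_min_size up sub.
  by rewrite size_iota sp.
rewrite cE perm_sym; apply: perm_trans (perm_add_edges _ _ _) _; rewrite ?size_nseq //.
  by apply/allP => x /lp; rewrite nat_ltb.
by rewrite code_edges_nseq cats0.
Qed.

(** A partial graph inside [es]: [f] lists the images of the vertices of [c], and [rest] holds the
    edges not yet grown. *)
Definition embeds K (es : seq edge) (c : code) : Prop :=
  in_range (size c) (code_edges c) /\ exists f rest,
  [/\ size f = size c, uniq f, {subset f <= iota 0 K} &
      perm_eq (map norm es) (relab f (code_edges c) ++ rest)].

(** A closed trivalent part on fewer than [K] vertices cannot lie in a connected trivalent graph on
    [K] vertices, so growth discards it. *)
Definition saturated K q (es : seq edge) : bool :=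
  Nat.ltb q K && all (fun d => Nat.eqb d 3) (degrees q es).

Section Grow.
Variables (K : nat) (T : seq code).

(* Every way of attaching one more edge to the vertex [v] of [c] leads to [T],
   unless it closes up a proper part of the graph. *)
Definition grows (c : code) : Prop := exists v, let es := code_edges c in
  [/\ v < size c, deg v es < 3,
   forall w, w < size c -> w != v -> deg w es < 3 ->
     saturated K (size c) ((v, w) :: es) \/
     exists c' p, c' \in T /\ relabels (size c) p ((v, w) :: es) c' &
   size c < K -> exists c' p, c' \in T /\ relabels (size c).+1 p ((v, size c) :: es) c'].

Lemma deg_relab_uniq f es v : uniq f -> in_range (size f) es -> v < size f ->
  deg (nth 0 f v) (relab f es) = deg v es.
Proof.
move=> uf /allP r vf; rewrite relabE deg_norm /deg !count_map.
by congr addn; apply: eq_in_count => e /r/andP[e1 e2] /=; rewrite nth_uniq.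
Qed.

Lemma deg_cat v es es' : deg v (es ++ es') = deg v es + deg v es'.
Proof. by rewrite /deg !count_cat addnACA. Qed.

Lemma relab_in_iota q p es : perm_eq p (iota 0 q) -> in_range q es -> in_range q (relab p es).
Proof.
move=> pp /allP r; have sp : size p = q by rewrite (perm_size pp) size_iota.
have lt x : x < q -> nth 0 p x < q.
  by move=> xq; have := mem_nth 0 (s := p) (n := x); rewrite sp (perm_mem pp) mem_iota; apply.
by apply/allP => _ /mapP[e /r/andP[e1 e2] ->]; rewrite /norm; case: ifP => _ /=; rewrite !lt.
Qed.

Lemma embeds_relabel es c q (f : seq nat) rest E p :
  0 < q -> in_range q E -> size f = q -> uniq f -> {subset f <= iota 0 K} ->
  perm_eq (map norm es) (relab f E ++ rest) -> relabels q p E c -> embeds K es c.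
Proof.
move=> q0 rE sf uf sub pe /(relabelsP q0)[pp sc pc].
have sp : size p = q by rewrite (perm_size pp) size_iota.
have up : uniq p by rewrite (perm_uniq pp) iota_uniq.
split; first by rewrite sc /in_range -(perm_all _ pc); apply: relab_in_iota pp rE.
(* [g] is [f] after the inverse of [p]: the vertex with label [x] is [index x p]. *)
pose g := [seq nth 0 f (index x p) | x <- iota 0 q].
have gf : perm_eq g f.
  have -> : g = map (nth 0 f) (map (index^~ p) (iota 0 q)) by rewrite -map_comp.
  rewrite -[X in perm_eq _ X](mkseq_nth 0) sf; apply: perm_map.
  apply: perm_trans (perm_map _ _) _; first by rewrite perm_sym; exact: pp.
  rewrite (_ : map _ p = iota 0 q) //.
  apply: (@eq_from_nth _ 0); rewrite size_map ?size_iota // => i ip.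
  by rewrite (nth_map 0) // index_uniq // nth_iota // -sp.
exists g, rest; split.
- by rewrite size_map size_iota sc.
- by rewrite (perm_uniq gf).
- by move=> x; rewrite (perm_mem gf); apply: sub.
apply: perm_trans pe _; rewrite perm_cat2r perm_sym.
apply: perm_trans (perm_relab g _) _; first by rewrite perm_sym; exact: pc.
rewrite relab_comp ?sp //; suff -> : [seq nth 0 g x | x <- p] = f by [].
apply: (@eq_from_nth _ 0); rewrite size_map ?sp ?sf // => i iq.
have pi : nth 0 p i < q.
  by have := mem_nth 0 (s := p) (n := i); rewrite sp (perm_mem pp) mem_iota; apply.
rewrite (nth_map 0) ?sp // (nth_map 0) ?size_iota // nth_iota // add0n index_uniq ?sp //.
Qed.

(** The vertex [v] has valence below 3 in [c] and exactly 3 in [es], so an edge of [rest] leaves its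
    image. The other end is new or the image of a vertex [w] of [c] that also has a free half-edge;
    these are the extensions listed in [grows]. *)
Lemma embeds_grow es c : good K es -> (forall v, v < K -> deg v es = 3) ->
  grows c -> embeds K es c -> exists2 c', c' \in T & embeds K es c'.
Proof.
move=> gd d3 [v [vq dv old new]] [rc [f [rest [sf uf sub pe]]]].
set q := size c in vq old new rc sf; set E := code_edges c in dv old new rc pe.
have q0 : 0 < q := leq_ltn_trans (leq0n v) vq.
have fK x : x < q -> nth 0 f x < K.
  by move=> xq; have := sub (nth 0 f x); rewrite mem_nth ?sf // mem_iota; apply.
have dE x : deg x es = deg x (relab f E) + deg x rest.
  by rewrite -deg_norm (deg_perm _ pe) deg_cat.
have [_ lln _ _] := good_norm gd.
have llr : loopless rest.
  by move: lln; rewrite /loopless (perm_all _ pe) all_cat => /andP[].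
have rr : in_range K rest.
  have [+ _ _ _] := good_norm gd.
  by rewrite /in_range (perm_all _ pe) all_cat => /andP[].
have dfv x : x < q -> deg (nth 0 f x) (relab f E) = deg x E.
  by move=> xq; rewrite deg_relab_uniq ?sf.
have [y [rest' [yv [e pr ne]]]] : exists y rest', y != nth 0 f v /\
    exists2 e, perm_eq rest (e :: rest') & norm e = norm (nth 0 f v, y).
  apply: incident_edge llr _; have := dE (nth 0 f v).
  by rewrite (d3 _ (fK _ vq)) dfv // => h; rewrite -(ltn_add2l (deg v E)) -h addn0.
have yK : y < K.
  have : (e.1 < K) && (e.2 < K) by apply: (allP rr); rewrite (perm_mem pr) mem_head.
  move=> /andP[e1 e2]; have : ((norm e).1 < K) && ((norm e).2 < K).
    by rewrite /norm; case: ifP => _ /=; rewrite e1 e2.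
  by rewrite ne => /andP[h1 h2]; have /andP[] := norm_in_range h1 h2.
have pe' : perm_eq (map norm es) (norm (nth 0 f v, y) :: relab f E ++ map norm rest').
  have : perm_eq (map norm (map norm es)) (map norm (relab f E ++ e :: rest')).
    by apply: perm_map; apply: perm_trans pe _; rewrite perm_cat2l.
  rewrite -map_comp (eq_map norm_idem) map_cat relabE -map_comp (eq_map norm_idem) /= ne => h.
  by apply: perm_trans h _; rewrite -cat1s perm_catCA.
have [yf|yf] := boolP (y \in f).
  have [w wq yE] : exists2 w, w < q & y = nth 0 f w.
    by move/(nthP 0): yf => [w]; rewrite sf => wq <-; exists w.
  have wv : w != v by apply: contraNneq yv => <-; rewrite yE.
  have dw : deg w E < 3.
    have := dE y; rewrite d3 // {1}yE dfv // => ->; rewrite -[X in X < _]addn0 ltn_add2l.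
    rewrite (deg_perm _ pr) deg_cons (leq_trans _ (leq_addr _ _)) //.
    have : deg y [:: e] = deg y [:: (nth 0 f v, y)].
      by rewrite -(deg_norm y [:: e]) -(deg_norm y [:: (nth 0 f v, y)]) /= ne.
    by rewrite !deg_cons /deg /= !addn0 eqxx => ->; rewrite addn1.
  have rE : in_range q ((v, w) :: E) by rewrite /in_range /= vq wq.
  have pe2 : perm_eq (map norm es) (relab f ((v, w) :: E) ++ map norm rest').
    by rewrite /= /ledge /= -yE.
  have [|[c' [p [cT rl]]]] := old w wq wv dw; last first.
    by exists c' => //; exact: embeds_relabel rE sf uf sub pe2 rl.
  rewrite /saturated nat_ltb => /andP[qK /allP sat]; exfalso.
  (* In a saturated part no remaining edge touches the image of [f]. Membership in [f] is then
     constant along the edges, and connectedness puts all [K] vertices into [f], against [q < K]. *)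
  pose P x := x \in f; have [_ _ _ lk] := good_norm gd.
  have dsat x : x < q -> deg x ((v, w) :: E) = 3.
    move=> xq; rewrite -(nth_degrees rE xq); apply/eqP; rewrite -nat_eqb.
    by apply: sat; rewrite mem_nth ?size_degrees.
  have norest x : x \in f -> deg x (map norm rest') = 0.
    move=> xf; have xK : x < K by move: (sub x xf); rewrite mem_iota.
    have := d3 x xK; rewrite -deg_norm (deg_perm _ pe2) deg_cat.
    move/(nthP 0): xf => [i]; rewrite sf => iq <-.
    by rewrite deg_relab_uniq ?sf // dsat // -[RHS]addn0 => /addnI.
  have Pe g : g \in map norm es -> P g.1 = P g.2.
    rewrite (perm_mem pe2) mem_cat => /orP[/mapP[h hE ->]|gr].
      have /andP[h1 h2] := allP rE h hE.
      by rewrite /P /norm; case: ifP => _ /=; rewrite !mem_nth ?sf.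
    apply/idP/idP => /norest /eqP; rewrite eqn0Ngt => /negP[]; rewrite /deg addn_gt0 -!has_count.
      by apply/orP; left; apply/hasP; exists g.
    by apply/orP; right; apply/hasP; exists g.
  have allf x : x < K -> x \in f.
    move=> xK; have := lk P Pe x (nth 0 f v) xK (fK v vq).
    by rewrite /P (mem_nth 0 (s := f)) ?sf // => ->.
  have := uniq_leq_size (iota_uniq 0 K) (s2 := f); rewrite size_iota sf leqNgt qK.
  by move=> /(_ _)/negP[] // => x; rewrite mem_iota; apply: allf.
have uf' : uniq (rcons f y) by rewrite rcons_uniq yf.
have sub' : {subset rcons f y <= iota 0 K}.
  by move=> x; rewrite mem_rcons inE => /orP[/eqP ->|/sub //]; rewrite mem_iota.
have qK : q < K.
  by have := uniq_leq_size uf' sub'; rewrite size_rcons size_iota sf.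
have [c' [p [cT rl]]] := new qK; exists c' => //.
have fE : relab (rcons f y) E = relab f E.
  apply/eq_in_map => x /(allP rc)/andP[x1 x2]; rewrite /ledge !nth_rcons sf x1 x2 //.
have rE : in_range q.+1 ((v, q) :: E).
  rewrite /in_range /= ltnSn leqW //=; apply: sub_all rc => x /andP[x1 x2].
  by rewrite !leqW.
apply: (embeds_relabel (ltn0Sn q) rE _ uf' sub' _ rl); first by rewrite size_rcons sf.
by rewrite /= fE /ledge /= !nth_rcons sf vq ltnn eqxx; exact: pe'.
Qed.

End Grow.

Lemma embeds_start K es : 0 < K -> embeds K es [:: [::]].
Proof.
move=> K0; split=> //; exists [:: 0], (map norm es); split=> //.
by move=> x; rewrite inE mem_iota => /eqP ->.
Qed.

(** Once all [m] edges are grown, [rest] is empty and the valences make [f] surjective; the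
    relabeling sought is its inverse. *)
Lemma embeds_all K m es c : size es = m -> good K es -> embeds K es c ->
  size (code_edges c) = m ->
  exists p, perm_eq p (iota 0 K) /\ perm_eq (relab p es) (map norm (code_edges c)).
Proof.
move=> sz gd [rc [f [rest [sf uf sub pe]]]] sm.
have r0 : rest = [::].
  apply: size0nil; have := perm_size pe; rewrite size_cat !size_map sz sm -[LHS]addn0.
  by move=> /addnI.
rewrite r0 cats0 in pe; have [rn _ dn _] := good_norm gd.
have pf : perm_eq f (iota 0 K).
  apply: uniq_perm => //; first exact: iota_uniq.
  move=> x; apply/idP/idP; first exact: sub.
  rewrite mem_iota add0n => /andP[_ xK].
  have : 0 < deg x (relab f (code_edges c)).
    by rewrite -(deg_perm _ pe) (leq_trans _ (dn x xK)).
  rewrite relabE deg_norm /deg !count_map addn_gt0 -!has_count.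
  by move=> /orP[] /hasP[e /(allP rc)/andP[e1 e2] /= /eqP <-]; rewrite mem_nth ?sf.
have sK : size f = K by rewrite (perm_size pf) size_iota.
exists [seq index x f | x <- iota 0 K]; split.
  rewrite perm_sym; apply: uniq_perm; first exact: iota_uniq.
    rewrite map_inj_in_uniq ?iota_uniq // => x y; rewrite -!(perm_mem pf) => xf yf.
    by move=> /(congr1 (nth 0 f)); rewrite !nth_index.
  move=> x; apply/idP/mapP.
    rewrite mem_iota => /= xK; exists (nth 0 f x); last by rewrite index_uniq ?sK.
    by rewrite -(perm_mem pf) mem_nth ?sK.
  by move=> [y]; rewrite -(perm_mem pf) -index_mem sK => yf ->; rewrite mem_iota.
rewrite -relab_norm; apply: perm_trans (perm_relab _ pe) _.
rewrite relab_comp; last by rewrite sf.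
set g := map _ f; suff -> : relab g (code_edges c) = map norm (code_edges c) by [].
apply/eq_in_map => e /(allP rc)/andP[e1 e2] /=.
have nE x : x < size c -> nth 0 g x = x.
  move=> xc; rewrite (nth_map 0) ?sf //.
  have fx : nth 0 f x < K.
    by have := sub (nth 0 f x); rewrite mem_nth ?sf // mem_iota; apply.
  by rewrite (nth_map 0) ?size_iota // nth_iota // add0n index_uniq ?sf.
by rewrite /ledge !nE // -surjective_pairing.
Qed.

(** * Signed counts of isomorphisms, and colourings *)

Section Pairing.
Variables k m : nat.
Implicit Types (G : graph k m) (s : {perm 'I_k}) (h : {perm halfedge m}).

Definition pairing G G' : rat :=
  (\sum_(s : {perm 'I_k}) \sum_(h : {perm halfedge m} | is_iso s h G G') iso_sign s h)%R.

Lemma is_iso_mul s0 h0 s h G1 G2 G3 : is_iso s0 h0 G1 G2 ->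
  is_iso (s0 * s)%g (h0 * h)%g G1 G3 = is_iso s h G2 G3.
Proof.
move=> /forallP iso0; apply/forallP/forallP => iso x.
  have /andP[/eqP hf /eqP hG] := iso ((h0^-1)%g x).
  have /andP[/eqP hf0 /eqP hG0] := iso0 ((h0^-1)%g x).
  rewrite !permM permKV in hG; rewrite !permM hf0 permKV in hf.
  by rewrite hf hG -hG0 permKV !eqxx.
have /andP[/eqP hf0 /eqP hG0] := iso0 x.
have /andP[/eqP hf /eqP hG] := iso (h0 x).
by rewrite !permM hf0 hf hG hG0 !eqxx.
Qed.

Lemma iso_sign_mul s0 h0 s h G1 G2 G3 : is_iso s0 h0 G1 G2 -> is_iso s h G2 G3 ->
  iso_sign (s0 * s)%g (h0 * h)%g = (iso_sign s0 h0 * iso_sign s h)%R.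
Proof.
move=> iso0 iso; rewrite /iso_sign odd_permM signr_addb.
rewrite [RHS]mulrACA; congr (_ * _)%R.
rewrite [X in (_ * X)%R](reindex_inj (is_iso_edge_inj iso0)) /= -big_split /=.
apply: eq_bigr => e _; rewrite permM.
by rewrite {1}[h0 _]surjective_pairing (is_iso_flip iso) /= addbC signr_addb.
Qed.

(** Composition with [(s0, h0)] is a bijection between the isomorphisms from [G2] and those from
    [G1], and it multiplies signs. This is why [free_coef] vanishes on the relators. *)
Lemma pairing_iso s0 h0 G1 G2 G' : is_iso s0 h0 G1 G2 ->
  pairing G1 G' = (iso_sign s0 h0 * pairing G2 G')%R.
Proof.
move=> iso0; rewrite /pairing mulr_sumr.
rewrite [LHS](reindex_inj (mulgI s0)); apply: eq_bigr => s _.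
rewrite mulr_sumr (reindex_inj (mulgI h0)) /=.
rewrite (eq_bigl _ _ (fun h => is_iso_mul s h G' iso0)).
by apply: eq_bigr => h iso; apply: iso_sign_mul iso0 iso.
Qed.

Definition free_coef G' (x : free_space k m) : rat^o :=
  (\sum_(A : agraph k m) (x A : rat) * pairing (val A) G')%R.

Lemma free_coef_is_linear G' : linear (free_coef G').
Proof.
move=> a x y; rewrite /free_coef scaler_sumr -big_split /=.
by apply: eq_bigr => A _; rewrite !ffunE mulrDl -mulrA.
Qed.

HB.instance Definition _ G' := GRing.isLinear.Build _ _ _ _ (free_coef G') (free_coef_is_linear G').

Lemma free_coef_ket G G' : admissible G -> free_coef G' (ket G) = pairing G G'.
Proof.
move=> aG; pose A : agraph k m := Sub G aG.
rewrite /free_coef (bigD1 A) //= big1 => [|B BA]; first by rewrite ffunE eqxx mul1r addr0.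
by rewrite ffunE -[G]/(val A) (inj_eq val_inj) (negPf BA) mul0r.
Qed.

Lemma free_coef_relators G' x : x \in relators k m -> free_coef G' x = 0%R.
Proof.
move=> xR; suff sub : (relators k m <= lker (linfun (free_coef G')))%VS.
  by have := subvP sub _ xR; rewrite memv_ker lfunE /= => /eqP.
apply/subv_sumP => G1 _; apply/subv_sumP => G2 _; apply/subv_sumP => s _.
apply/subv_sumP => h iso; rewrite -memvE memv_ker lfunE /= linearB linearZ /=.
by rewrite !free_coef_ket ?(valP _) // (pairing_iso G' iso) subrr.
Qed.

Definition coef G' : 'Hom(chain_space k m, rat^o) :=
  (linfun (free_coef G') \o quot_repr (relators k m))%VF.

Lemma coef_class G G' : admissible G -> coef G' (graph_class G) = pairing G G'.
Proof.
move=> aG; rewrite /coef comp_lfunE lfunE /= -free_coef_ket //.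
apply/eqP; rewrite -subr_eq0 -linearB; apply/eqP/free_coef_relators.
by rewrite -opprB memvN quot_reprK_mod.
Qed.

Lemma pairing_eq0 G G' : (forall s h, ~~ is_iso s h G G') -> pairing G G' = 0%R.
Proof. by move=> no; rewrite /pairing big1 // => s _; rewrite big1 // => h; rewrite (negPf (no s h)). Qed.

(** Nothing cancels: all terms are 1, and the identity contributes one of them. *)
Lemma pairing_neq0 G : (forall s h, is_iso s h G G -> iso_sign s h = 1%R) -> pairing G G != 0%R.
Proof.
move=> even; rewrite Order.POrderTheory.gt_eqF // /pairing (bigD1 1%g) //=.
apply: Num.Theory.ltr_pwDl; last first.
  apply: Num.Theory.sumr_ge0 => s _; apply: Num.Theory.sumr_ge0 => h /even -> //.
rewrite (bigD1 1%g) /=; last by apply/forallP => x; rewrite !perm1 !eqxx.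
apply: Num.Theory.ltr_pwDl; last by apply: Num.Theory.sumr_ge0 => h /andP[/even -> //].
by rewrite even //; apply/forallP => x; rewrite !perm1 !eqxx.
Qed.

End Pairing.

(** * Invariant colourings of the vertices by hashing *)

Lemma nat_of_pos_inj : injective nat_of_pos.
Proof. by move=> p q /(congr1 bin_of_nat); rewrite -[nat_of_pos p]/(nat_of_bin (Npos p)) -[nat_of_pos q]/(nat_of_bin (Npos q)) !nat_of_binK => -[]. Qed.

Definition pos_sum (T : Type) (f : T -> positive) (a : positive) (l : seq T) : positive :=
  foldr (fun u a => Pos.add (f u) a) a l.

Lemma pos_sum_perm (T : eqType) (f : T -> positive) a l l' :
  perm_eq l l' -> pos_sum f a l = pos_sum f a l'.
Proof.
have E s : nat_of_pos (pos_sum f a s) = \sum_(u <- s) nat_of_pos (f u) + nat_of_pos a.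
  elim: s => [|u s IH]; first by rewrite big_nil.
  by rewrite big_cons -addnA -IH nat_of_add_pos.
by move=> pl; apply: nat_of_pos_inj; rewrite !E (perm_big _ pl).
Qed.

Fixpoint low_bits (w : nat) (x : positive) : positive :=
  match w, x with
  | w'.+1, xI y => xI (low_bits w' y)
  | w'.+1, xO y => xO (low_bits w' y)
  | _, _ => xH
  end.

(** The constants and truncations are heuristic: they spread the colours and keep the numbers short.
    The proofs only use that a new colour is a function of the old one and of the multiset of
    neighbouring colours. *)
Definition mix (x : positive) : positive := Pos.mul (Pos.add x (xI (xI xH))) (low_bits 5 x).

Definition neighbours K (es : seq edge) : seq (seq nat) :=
  foldr (fun e N => update (cons e.1) (update (cons e.2) N e.1) e.2) (nseq K [::]) es.

Definition refine (nb : seq (seq nat)) (col : seq positive) : seq positive :=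
  let g := map mix col in
  map (fun x : seq nat * positive =>
    low_bits 20 (pos_sum (nth xH g) (Pos.add x.2 (xO x.2)) x.1)) (zip nb col).

Lemma nth_refine nb col v : size nb = size col -> v < size col ->
  nth xH (refine nb col) v = low_bits 20 (pos_sum (nth xH (map mix col))
    (Pos.add (nth xH col v) (xO (nth xH col v))) (nth [::] nb v)).
Proof.
move=> sz vs; rewrite /refine (nth_map ([::], xH)) ?size_zip ?sz ?minnn //.
by rewrite nth_zip.
Qed.

Definition hash (col : seq positive) : positive :=
  pos_sum (fun c => Pos.mul (low_bits 8 c) c) xH col.

Definition degree_colors (nb : seq (seq nat)) : seq positive :=
  map (fun ns => Pos.of_succ_nat (size ns)) nb.

Definition root_colors K (nb : seq (seq nat)) (r v : nat) : positive :=
  hash (iter r (refine nb) (map (fun u => if Nat.eqb u v then xO xH else xH) (iota 0 K))).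

(* Isomorphism invariant colourings of the vertices; [r.2 = 0] starts from the
   valences, otherwise from the refinements of the colourings with a marked vertex. *)
Definition colors (r : nat * nat) K (nb : seq (seq nat)) : seq positive :=
  iter r.1 (refine nb)
    (if r.2 is 0 then degree_colors nb else map (root_colors K nb r.2) (iota 0 K)).

Definition nbr (v : nat) (es : seq edge) : seq nat :=
  pmap (fun e => if e.1 == v then Some e.2 else if e.2 == v then Some e.1 else None) es.

Lemma size_neighbours K es : size (neighbours K es) = K.
Proof. by elim: es => [|e es IH] /=; rewrite ?size_nseq // !size_update. Qed.

Lemma nth_neighbours K es v : in_range K es -> loopless es -> v < K ->
  nth [::] (neighbours K es) v = nbr v es.
Proof.
elim: es v => [|e es IH] v /=; first by rewrite nth_nseq => _ _ ->.
move=> /andP[/andP[e1 e2] r] /andP[l ll] vK; rewrite !nth_update ?size_update ?size_neighbours //.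
rewrite !IH // ![_ == v]eq_sym; have [->|_] := eqVneq v e.2; last by have [->|_] := eqVneq v e.1.
by rewrite eq_sym (negPf l).
Qed.

Lemma nbr_relab K p es v : perm_eq p (iota 0 K) -> in_range K es -> v < K ->
  loopless es -> nbr (nth 0 p v) (relab p es) = map (nth 0 p) (nbr v es).
Proof.
move=> pp r vK; have sp : size p = K by rewrite (perm_size pp) size_iota.
have up : uniq p by rewrite (perm_uniq pp) iota_uniq.
elim: es r => //= e es IH /andP[/andP[e1 e2] r] /andP[l ll]; rewrite IH //.
have E x : x < K -> (nth 0 p x == nth 0 p v) = (x == v) by move=> xK; rewrite nth_uniq ?sp.
have [nE|nE] : norm (ledge p e) = (nth 0 p e.1, nth 0 p e.2) \/
               norm (ledge p e) = (nth 0 p e.2, nth 0 p e.1).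
- by rewrite /norm; case: ifP => _; [left | right].
- by rewrite nE /= !E //; case: eqP => //= _; case: eqP.
rewrite nE /= !E //; have [ev|_] := eqVneq e.2 v; last by case: eqP.
by move: l; rewrite ev; case: eqP.
Qed.

Section Invariance.
Variables (K : nat) (es es' : seq edge) (p : seq nat).
Hypotheses (r : in_range K es) (ll : loopless es) (r' : in_range K es') (ll' : loopless es').
Hypotheses (pp : perm_eq p (iota 0 K)) (pe : perm_eq (relab p es) es').

Definition same_colors (c c' : seq positive) :=
  [/\ size c = K, size c' = K & forall v, v < K -> nth xH c' (nth 0 p v) = nth xH c v].

Lemma label_lt v : v < K -> nth 0 p v < K.
Proof.
have sp : size p = K by rewrite (perm_size pp) size_iota.
by move=> vK; have := mem_nth 0 (s := p) (n := v); rewrite sp (perm_mem pp) mem_iota; apply.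
Qed.

Lemma perm_nbr v : v < K -> perm_eq (map (nth 0 p) (nbr v es)) (nbr (nth 0 p v) es').
Proof. by move=> vK; rewrite -(nbr_relab pp) //; apply: perm_pmap. Qed.

Lemma nbr_lt v u : u \in nbr v es -> u < K.
Proof.
rewrite /nbr mem_pmap => /mapP[e /(allP r)/andP[e1 e2]].
by case: eqP => [_ [->]|_] //; case: eqP => [_ [->]|_].
Qed.

Lemma same_colors_refine c c' : same_colors c c' ->
  same_colors (refine (neighbours K es) c) (refine (neighbours K es') c').
Proof.
move=> [sc sc' cc]; split; rewrite ?size_map ?size_zip ?size_neighbours ?sc ?sc' ?minnn //.
move=> v vK; have pK := label_lt vK.
rewrite !nth_refine ?size_neighbours ?sc ?sc' // cc //; congr low_bits.
rewrite (nth_neighbours r ll vK) (nth_neighbours r' ll' pK).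
rewrite -(pos_sum_perm _ _ (perm_nbr vK)) /pos_sum foldr_map.
have : {subset nbr v es <= gtn K} by move=> u /nbr_lt.
elim: (nbr v es) => //= u l IH sub; rewrite IH; last by move=> x xl; apply: sub; rewrite inE xl orbT.
have uK : u < K by apply: sub; rewrite mem_head.
by rewrite !(nth_map xH) ?sc ?sc' ?label_lt // cc.
Qed.

Lemma same_colors_iter n c c' : same_colors c c' ->
  same_colors (iter n (refine (neighbours K es)) c) (iter n (refine (neighbours K es')) c').
Proof. by move=> cc; elim: n => //= n; apply: same_colors_refine. Qed.

Lemma same_colors_hash c c' : same_colors c c' -> hash c = hash c'.
Proof.
move=> [sc sc' cc]; have sp : size p = K by rewrite (perm_size pp) size_iota.
have -> : c = map (nth xH c') p.
  apply: (@eq_from_nth _ xH); rewrite sc ?size_map ?sp // => v vK.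
  by rewrite (nth_map 0) ?sp // cc.
rewrite -[in RHS](mkseq_nth xH c') sc' /hash /pos_sum !foldr_map.
exact: (pos_sum_perm (fun v => Pos.mul (low_bits 8 (nth xH c' v)) (nth xH c' v)) xH pp).
Qed.

Lemma same_colors_colors n :
  same_colors (colors n K (neighbours K es)) (colors n K (neighbours K es')).
Proof.
have up : uniq p by rewrite (perm_uniq pp) iota_uniq.
have sp : size p = K by rewrite (perm_size pp) size_iota.
apply: same_colors_iter; case: n.2 => [|q].
  split; rewrite ?size_map ?size_neighbours // => v vK.
  rewrite !(nth_map [::]) ?size_neighbours ?label_lt // !nth_neighbours ?label_lt //.
  by rewrite -(perm_size (perm_nbr vK)) size_map.
split; rewrite ?size_map ?size_iota // => v vK.
rewrite !(nth_map 0) ?size_iota ?label_lt // !nth_iota ?label_lt // !add0n.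
symmetry; apply: same_colors_hash; apply: same_colors_iter.
split; rewrite ?size_map ?size_iota // => u uK.
rewrite !(nth_map 0) ?size_iota ?label_lt // !nth_iota ?label_lt // !add0n.
by rewrite !nat_eqb nth_uniq ?sp.
Qed.

End Invariance.

(** * Backtracking search for isomorphisms *)

Definition mult (a b : nat) (es : seq edge) :=
  count (fun e => (e.1 == a) && (e.2 == b) || (e.1 == b) && (e.2 == a)) es.

Definition adjacency K (es : seq edge) : seq (seq nat) :=
  foldr (fun e M => update (fun r => update S r e.2) (update (fun r => update S r e.1) M e.2) e.1)
    (nseq K (nseq K 0)) es.

Lemma size_adjacency K es : size (adjacency K es) = K.
Proof. by elim: es => [|e es IH] /=; rewrite ?size_nseq // !size_update. Qed.

Lemma size_nth_adjacency K es a : in_range K es -> a < K -> size (nth [::] (adjacency K es) a) = K.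
Proof.
elim: es a => [|e es IH] a /=; first by rewrite nth_nseq => _ ->; rewrite size_nseq.
move=> /andP[/andP[e1 e2] r] aK; rewrite !nth_update ?size_update ?size_adjacency //.
by do 2?case: ifP => _; rewrite ?size_update ?IH.
Qed.

Lemma nth_adjacency K es a b : in_range K es -> loopless es -> a < K -> b < K ->
  nth 0 (nth [::] (adjacency K es) a) b = mult a b es.
Proof.
elim: es a b => [|e es IH] a b /=; first by rewrite nth_nseq => _ _ -> bK; rewrite nth_nseq bK.
move=> /andP[/andP[e1 e2] r] /andP[l ll] aK bK; rewrite !nth_update ?size_update ?size_adjacency //.
rewrite (negPf l) ![_ == a]eq_sym ![_ == b]eq_sym.
have [->|na] := eqVneq a e.1.
  rewrite (negPf l) /= nth_update ?size_nth_adjacency // !IH // andbF orbF.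
  by case: eqP => [->|_]; rewrite ?add1n ?add0n.
rewrite /=; have [->|nb] := eqVneq a e.2; last by rewrite andbF /= IH.
rewrite nth_update ?size_nth_adjacency // !IH // andbT.
by case: eqP => [->|_]; rewrite ?add1n ?add0n.
Qed.

Lemma mult_relab K p es a b : perm_eq p (iota 0 K) -> in_range K es -> a < K -> b < K ->
  mult (nth 0 p a) (nth 0 p b) (relab p es) = mult a b es.
Proof.
move=> pp r aK bK; have sp : size p = K by rewrite (perm_size pp) size_iota.
have up : uniq p by rewrite (perm_uniq pp) iota_uniq.
rewrite /mult count_map; apply: eq_in_count => e /(allP r)/andP[e1 e2] /=.
rewrite /norm /ledge; case: ifP => _ /=; rewrite !nth_uniq ?sp //.
by rewrite orbC ![(e.2 == _) && _]andbC.
Qed.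

(** Non-adjacent pairs are omitted: between graphs with equally many edges, a bijection that matches
    the multiplicities of all edges of the first leaves no edge of the second over. *)
Fixpoint earlier (u t : nat) (row : seq nat) : seq (nat * nat) :=
  match t, row with
  | t'.+1, a :: row' => if a is 0 then earlier u.+1 t' row' else (u, a) :: earlier u.+1 t' row'
  | _, _ => [::]
  end.

Lemma earlierP u t row x : x \in earlier u t row ->
  exists v, [/\ x.1 = u + v, v < t & nth 0 row v = x.2].
Proof.
elim: t u row => [|t IH] u [|a row] //=.
have step : x \in earlier u.+1 t row -> exists v, [/\ x.1 = u + v, v < t.+1 & nth 0 (a :: row) v = x.2].
  by move=> /IH[v [h1 h2 h3]]; exists v.+1; rewrite addnS -addSn.
case: a step => [//|a] step; rewrite inE => /orP[/eqP ->|//].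
by exists 0; rewrite addn0.
Qed.

Fixpoint earlier_rows (t : nat) (M : seq (seq nat)) : seq (seq (nat * nat)) :=
  if M is r :: M' then earlier 0 t r :: earlier_rows t.+1 M' else [::].

Lemma size_earlier_rows t M : size (earlier_rows t M) = size M.
Proof. by elim: M t => //= r M IH t; rewrite IH. Qed.

Lemma nth_earlier_rows t M i : i < size M ->
  nth [::] (earlier_rows t M) i = earlier 0 (t + i) (nth [::] M i).
Proof.
by elim: M t i => // r M IH t [|i] /= iM; [rewrite addn0 | rewrite IH // addnS].
Qed.

Fixpoint forall_rows (f : nat -> seq nat -> positive -> bool) (w : nat)
    (M : seq (seq nat)) (col : seq positive) : bool :=
  match M, col with
  | r :: M', c :: col' => f w r c && forall_rows f w.+1 M' col'
  | _, _ => true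
  end.

Lemma forall_rowsP f w M col i : forall_rows f w M col -> i < size M -> i < size col ->
  f (w + i) (nth [::] M i) (nth xH col i).
Proof.
elim: M col w i => [|r M IH] [|c col] w [|i] //= /andP[h1 h2]; first by rewrite addn0.
by move=> iM ic; rewrite addnS -addSn; apply: IH.
Qed.

(* Backtracking over the bijections that respect the colours and the
   multiplicities of the edges; [p] lists the images chosen so far. *)
Fixpoint search (M : seq (seq nat)) (col' : seq positive) (leaf : seq nat -> bool)
    (rows : seq (seq (nat * nat))) (col : seq positive) (p : seq nat) : bool :=
  match rows, col with
  | r :: rows', c :: col1 =>
    forall_rows (fun w r' c' =>
      if Pos.eqb c c' then
        if has (Nat.eqb w) p then true else
        if all (fun x => Nat.eqb (nth 0 r' (nth 0 p x.1)) x.2) r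
        then search M col' leaf rows' col1 (rcons p w) else true
      else true) 0 M col'
  | _, _ => leaf p
  end.

Definition sketch := (seq edge * seq (seq nat) * seq (seq (nat * nat)) * seq positive * positive)%type.

(* Two hash values: the second one is only evaluated for graphs that agree on the first. *)
Definition prepare (r : (nat * nat) * (nat * nat)) K (c : code) : positive * sketch :=
  let es := code_edges c in
  let M := adjacency K es in
  let nb := neighbours K es in
  let col := colors r.1 K nb in
  (hash col, (es, M, earlier_rows 0 M, col, hash (colors r.2 K nb))).

Definition iso_search (leaf : seq nat -> bool) (x y : sketch) : bool :=
  let: (_, _, rows, col, _) := x in let: (_, M, _, col', _) := y in
  search M col' leaf rows col [::].

Lemma pos_eqb_refl c : Pos.eqb c c.
Proof. by elim: c. Qed.

(** A successful search speaks of all branches. The branch through the prefixes of [p] passes every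
    test, since colours are invariant and [p] preserves multiplicities, so it ends in [leaf p]. *)
Lemma iso_searchP r K c c' leaf p : ordered K (code_edges c) -> ordered K (code_edges c') ->
  iso_search leaf (prepare r K c).2 (prepare r K c').2 ->
  perm_eq p (iota 0 K) -> perm_eq (relab p (code_edges c)) (code_edges c') -> leaf p.
Proof.
move=> o o' + pp pe; rewrite /prepare /iso_search /=.
set es := code_edges c in o pe *; set es' := code_edges c' in o' pe *.
have [rg ll] := (ordered_in_range o, ordered_loopless o).
have [rg' ll'] := (ordered_in_range o', ordered_loopless o').
have [] := same_colors_colors rg ll rg' ll' pp pe r.1.
move: (colors r.1 K (neighbours K es)) (colors r.1 K (neighbours K es')) => col col' sc sc' cc.
have sp : size p = K by rewrite (perm_size pp) size_iota.
have up : uniq p by rewrite (perm_uniq pp) iota_uniq.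
(* Downward induction on the length [t] of the prefix: [t = K] is the leaf, [t = 0] the whole
   search. *)
have gen t : t <= K -> search (adjacency K es') col' leaf
    (drop t (earlier_rows 0 (adjacency K es))) (drop t col) (take t p) -> leaf p.
  move=> tK; rewrite -(subKn tK); elim: (K - t) (leq_subr t K) => {t tK}[|d IH] dK.
    rewrite subn0 drop_oversize ?size_earlier_rows ?size_adjacency //=.
    by rewrite take_oversize // sp.
  have tK : K - d.+1 < K by rewrite ltn_subrL (leq_trans _ dK).
  set t := K - d.+1 in tK *; have tS : K - d = t.+1 by rewrite /t subnSK.
  rewrite (drop_nth [::]) ?size_earlier_rows ?size_adjacency // (drop_nth xH) ?sc //.
  have pt := label_lt pp tK.
  move=> /(@forall_rowsP _ _ _ _ (nth 0 p t)); rewrite size_adjacency sc' add0n => /(_ pt pt).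
  have ut : nth 0 p t \notin take t p.
    apply/negP => /(nthP 0)[i]; rewrite size_takel ?sp ?(ltnW tK) // => it.
    rewrite nth_take // => /eqP; rewrite nth_uniq ?sp ?(ltn_trans it) //.
    by rewrite (ltn_eqF it).
  have -> : all (fun x => Nat.eqb (nth 0 (nth [::] (adjacency K es') (nth 0 p t))
      (nth 0 (take t p) x.1)) x.2) (nth [::] (earlier_rows 0 (adjacency K es)) t).
    apply/allP => x; rewrite nth_earlier_rows ?size_adjacency // => /earlierP[v [-> vt <-]].
    rewrite !add0n in vt *; have vK := ltn_trans vt tK.
    rewrite nat_eqb nth_take // !nth_adjacency ?(label_lt pp) //.
    by rewrite -(mult_relab pp rg) // /mult (seq.permP pe).
  rewrite cc // pos_eqb_refl has_eqb (negPf ut) => {}h.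
  by apply: IH; [exact: ltnW | rewrite tS (take_nth 0) ?sp].
by move=> h; apply: (gen 0) => //; rewrite !drop0 take0.
Qed.

Definition even_sketch (x : sketch) : bool :=
  iso_search (fun p => ~~ (parity p (+) flips p x.1.1.1.1)) x x.

(** With the constant leaf [false], the search succeeds only if no branch reaches a complete
    bijection. *)
Definition distinct (x y : sketch) : bool :=
  if Pos.eqb x.2 y.2 then iso_search (fun=> false) x y else true.

(** * Dictionaries, and comparison within hash classes *)

Inductive tree (A : Type) := Leaf | Node of option A & tree A & tree A.
Arguments Leaf {A}.

Fixpoint lookup A (k : positive) (t : tree A) : option A :=
  if t is Node o l r then
    match k with xH => o | xO k' => lookup k' l | xI k' => lookup k' r end
  else None.

Fixpoint insert A (k : positive) (x : A) (t : tree A) : tree A :=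
  let: (o, l, r) := if t is Node o l r then (o, l, r) else (None, Leaf, Leaf) in
  match k with
  | xH => Node (Some x) l r
  | xO k' => Node o (insert k' x l) r
  | xI k' => Node o l (insert k' x r)
  end.

Lemma lookup_insert A k k' (x y : A) t :
  lookup k (insert k' x t) = Some y -> y = x \/ lookup k t = Some y.
Proof.
have leaf p : lookup p (@Leaf A) = None by case: p.
elim: k' k t => [k' IH|k' IH|] [k|k|] [|o l r] //=; rewrite ?leaf; try (by right); try (by case=> ->; left).
all: by move/IH; rewrite ?leaf.
Qed.

Lemma pos_eqb_eq p q : Pos.eqb p q -> p = q.
Proof. by elim: p q => [p IH|p IH|] [q|q|] //= /IH ->. Qed.

Section Separated.
Variables (T : Type) (D : T -> T -> bool).

(* Only pairs with equal labels are compared; [t] collects the elements by label. *)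
Fixpoint separated_from (t : tree (seq T)) (l : seq (positive * T)) : bool :=
  if l is x :: l' then
    if lookup x.1 t is Some ys then
      all (D x.2) ys && separated_from (insert x.1 (x.2 :: ys) t) l'
    else separated_from (insert x.1 [:: x.2] t) l'
  else true.

Definition separated (l : seq (positive * T)) : bool := separated_from Leaf l.

Lemma lookup_insert_same A k (x : A) t : lookup k (insert k x t) = Some x.
Proof. by elim: k t => [k IH|k IH|] [|o l r] /=. Qed.

Lemma lookup_insert_other A k k' (x : A) t :
  ~~ Pos.eqb k k' -> lookup k (insert k' x t) = lookup k t.
Proof.
have leaf p : lookup p (@Leaf A) = None by case: p.
by elim: k' k t => [k' IH|k' IH|] [k|k|] [|o l r] //= h; rewrite ?IH ?leaf.
Qed.

Lemma separatedP l : separated l -> pairwise (fun x y => Pos.eqb x.1 y.1 ==> D y.2 x.2) l.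
Proof.
rewrite /separated; move: Leaf => t h.
(* The induction also records that the elements still to come are compared with those already stored
   under their label. *)
suff [] : pairwise (fun x y => Pos.eqb x.1 y.1 ==> D y.2 x.2) l /\
    all (fun y => if lookup y.1 t is Some ys then all (D y.2) ys else true) l by [].
elim: l t h => //= x l IH t.
have step ys : separated_from (insert x.1 (x.2 :: ys) t) l ->
    (lookup x.1 t = Some ys \/ lookup x.1 t = None) ->
    [/\ all (fun y => Pos.eqb x.1 y.1 ==> D y.2 x.2) l,
        pairwise (fun x y => Pos.eqb x.1 y.1 ==> D y.2 x.2) l &
        all (fun y => if lookup y.1 t is Some ys then all (D y.2) ys else true) l].
  move=> /IH[pw al] E; split=> //; move: al; apply: sub_all => y.
    have [e|ne] := boolP (Pos.eqb x.1 y.1); last by [].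
    by rewrite -(pos_eqb_eq e) lookup_insert_same => /andP[->].
  have [e|ne] := boolP (Pos.eqb y.1 x.1); last by rewrite lookup_insert_other.
  by rewrite (pos_eqb_eq e) lookup_insert_same => /andP[_]; case: E => ->.
case E : (lookup x.1 t) => [ys|].
  by case/andP=> h /step[|h1 h2 h3]; [left | rewrite h1 h2 h h3].
by move/(step [::])=> [|h1 h2 h3]; [right | rewrite h1 h2 h3].
Qed.

End Separated.

(** * Independence of even, pairwise distinct graphs *)

Section Dual.
Variables (k m : nat) (r : (nat * nat) * (nat * nat)).
Implicit Types (c : code).

Local Notation gr c := (realize k m (code_edges c)).

Lemma even_coef c : code_ok k.+1 m c -> even_sketch (prepare r k.+1 c).2 ->
  coef (gr c) (class k m (code_edges c)) != 0%R.
Proof.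
move=> /code_okP[] // sc o sm gd ev; rewrite coef_class ?admissible_realize //.
have rg := ordered_in_range o.
have so : all (fun e => e.1 < e.2) (code_edges c) by apply: sub_all o => e /andP[].
apply: pairing_neq0 => s h iso; rewrite (iso_sign_seq sm sm rg rg so iso).
have pe := relab_of_iso sm sm rg rg iso; rewrite (ordered_norm o) in pe.
by have /negPf-> := iso_searchP o o ev (seq_of_perm_iota s) pe.
Qed.

(** Both hash values are invariants, so an isomorphism would make them agree, force the search, and
    be met by it. *)
Lemma distinct_coef c c' : code_ok k.+1 m c -> code_ok k.+1 m c' ->
  Pos.eqb (prepare r k.+1 c).1 (prepare r k.+1 c').1 ==>
    distinct (prepare r k.+1 c').2 (prepare r k.+1 c).2 ->
  coef (gr c) (class k m (code_edges c')) = 0%R /\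
  coef (gr c') (class k m (code_edges c)) = 0%R.
Proof.
move=> /code_okP[] // sc o sm gd /code_okP[] // sc' o' sm' gd' di.
have [rg rg'] := (ordered_in_range o, ordered_in_range o').
have [ll ll'] := (ordered_loopless o, ordered_loopless o').
suff no s h : ~~ is_iso s h (gr c') (gr c).
  rewrite !coef_class ?admissible_realize // !pairing_eq0 // => s h.
  by apply/negP => /is_iso_sym; apply/negP.
apply/negP => iso; have pe := relab_of_iso sm' sm rg' rg iso; rewrite (ordered_norm o) in pe.
have pp := seq_of_perm_iota s; move: di.
have hE q := same_colors_hash pp (same_colors_colors rg' ll' rg ll pp pe q).
rewrite /distinct {1 2 3 5}/prepare /= !hE !pos_eqb_refl /= => di.
by have := iso_searchP o' o di pp pe.
Qed.

Lemma separated_coef cs i j : all (code_ok k.+1 m) cs ->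
  separated distinct (map (prepare r k.+1) cs) ->
  i < size cs -> j < size cs -> i != j ->
  coef (gr (nth [::] cs i)) (class k m (code_edges (nth [::] cs j))) = 0%R.
Proof.
move=> ok /separatedP; rewrite pairwise_map => pw is_ js ij.
have okn x : x < size cs -> code_ok k.+1 m (nth [::] cs x) by move=> xs; apply: all_nthP ok _ xs.
move/(pairwiseP [::]): pw => pw.
have [lt|lt|e] := ltngtP i j; last by rewrite e eqxx in ij.
  exact: (distinct_coef (okn _ is_) (okn _ js) (pw _ _ is_ js lt)).1.
exact: (distinct_coef (okn _ js) (okn _ is_) (pw _ _ js is_ lt)).2.
Qed.

End Dual.

(** * Dimensions and ranks *)

Lemma chain_subspace k m (U : {vspace chain_space k m}) :
  (forall G, admissible G -> graph_class G \in U) -> U = fullv.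
Proof.
move=> h; apply/eqP; rewrite eqEsubv subvf /=; apply/subvP => v _.
have F0 : quot_pi U = 0%R.
  by apply: chain_span => G /h; rewrite -quot_pi_eq0 => /eqP.
by rewrite -quot_pi_eq0 F0 zero_lfunE.
Qed.

Lemma covers_subspace k m (T : seq code) (U : {vspace chain_space k.+1 m}) :
  (forall c, c \in T -> code_ok k.+1 m c) -> covers k.+1 m T ->
  (forall c, c \in T -> class k m (code_edges c) \in U) -> U = fullv.
Proof.
move=> ok cov cl; apply: chain_subspace => G aG.
have [/existsP[e /eqP le]|] := boolP [exists e : 'I_m, G (e, false) == G (e, true)].
  by rewrite (graph_class_loop le) mem0v.
rewrite negb_exists => /forallP nl.
have gd := good_edge_list aG nl.
have [c [cT [p [pp pe]]]] := cov _ (size_edge_list G) gd.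
have [r _ _ _] := gd.
have := class_relab (size_edge_list G) r pp pe; rewrite {1}/class realizeK => ->.
by apply: memvZ; apply: cl.
Qed.

(** The functional [f r] kills all earlier vectors but not [y r]. The list is reversed so that the
    newest vector stands at its head. *)
Lemma triangular_free (K : fieldType) (V : vectType K) (y : nat -> V)
    (f : nat -> 'Hom(V, K^o)) r :
  (forall j, j < r -> f j (y j) != 0%R) ->
  (forall i j, i < j -> j < r -> f j (y i) = 0%R) ->
  free [seq y j | j <- rev (iota 0 r)].
Proof.
elim: r => [|r IH] d z; first by rewrite /= nil_free.
rewrite -addn1 iotaD add0n rev_cat /= free_cons.
rewrite IH ?andbT; last first.
- by move=> i j ij /leqW; apply: z.
- by move=> j /leqW; apply: d.
apply/negP => yr; have := d r (ltnSn r); apply/negP/negPn.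
suff sub : (<<[seq y j | j <- rev (iota 0 r)]>> <= lker (f r))%VS.
  by have := subvP sub _ yr; rewrite memv_ker.
apply/span_subvP => x /mapP[i]; rewrite mem_rev mem_iota => /= ir ->.
by rewrite memv_ker z.
Qed.

Lemma triangular_rank (K : fieldType) (V W : vectType K) (g : 'Hom(V, W)) (x : nat -> V)
    (f : nat -> 'Hom(W, K^o)) r :
  (forall j, j < r -> f j (g (x j)) != 0%R) ->
  (forall i j, i < j -> j < r -> f j (g (x i)) = 0%R) ->
  r <= \dim (limg g).
Proof.
move=> d z; have /eqP := triangular_free (y := fun j => g (x j)) d z.
rewrite size_map size_rev size_iota => <-; apply: dimvS.
by apply/span_subvP => _ /mapP[j _ ->]; apply/memv_img/memvf.
Qed.

Lemma isomorphic_dim (K : fieldType) (V : vectType K) d :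
  \dim {:V} = d -> isomorphic V 'rV[K]_d.
Proof.
move=> <-; set X := vbasis {:V}.
pose f (v : V) : 'rV[K]_(\dim {:V}) := (\row_i coord X i v)%R.
have fl : linear f by move=> a x y; apply/rowP => i; rewrite !mxE linearP.
exists (HB.pack_for {linear V -> 'rV[K]_(\dim {:V})} f (GRing.isLinear.Build _ _ _ _ f fl)).
exists (fun u : 'rV[K]_(\dim {:V}) => \sum_i u ord0 i *: X`_i)%R => [v|u].
  rewrite [RHS](coord_vbasis (memvf v)); apply: eq_bigr => i _.
  by rewrite [f v _ _]mxE.
by apply/rowP => i; rewrite [LHS]mxE (coord_sum_free _ _ (basis_free (vbasisP _))).
Qed.

Lemma dim0_eq0 (K : fieldType) (V : vectType K) : \dim {:V} = 0 -> forall x : V, x = 0%R.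
Proof. by move/eqP; rewrite dimv_eq0 => /eqP f0 x; apply/eqP; rewrite -memv0 -f0 memvf. Qed.

Lemma dim_quotv (K : fieldType) (V : vectType K) (U : {vspace V}) :
  \dim {:quotv U} = \dim {:V} - \dim U.
Proof. by rewrite dimvf -dimv_compl. Qed.

(** * Dimensions of homology from bounds on ranks *)

Section Homology.
Variables n i : nat.
Local Notation rk i := (\dim (limg (boundary n i))).

Lemma limg_boundary_sub : (limg (boundary n i.+1) <= lker (boundary n i))%VS.
Proof.
apply/subvP => _ /memv_imgP[x _ ->]; rewrite memv_ker -comp_lfunE.
by rewrite (boundaryK n i.+1) zero_lfunE.
Qed.

Lemma rank_boundary_le : rk i + rk i.+1 <= \dim {:chains n i}.
Proof.
rewrite -(limg_ker_dim (boundary n i) fullv) capfv addnC leq_add2r.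
exact: dimvS limg_boundary_sub.
Qed.

Lemma dim_homology : \dim {:homology n i} = \dim {:chains n i} - rk i - rk i.+1.
Proof.
rewrite dim_quotv; congr subn.
  rewrite dimvf [X in X = _]/(\dim (lker (boundary n i))).
  by rewrite -(limg_ker_dim (boundary n i) fullv) capfv addnK.
rewrite /boundaries; set U := limg _; pose f : 'Hom(cycles n i, chains n i) := linfun vsval.
have kf : lker f = 0%VS.
  by apply/eqP/lker0P => x y; rewrite !lfunE /= => /subvs_inj.
have fE : limg f = lker (boundary n i).
  apply/vspaceP => x; apply/memv_imgP/idP => [[y _ ->]|xk].
    by rewrite lfunE /= subvsP.
  by exists (vsproj _ x); rewrite ?memvf // lfunE /= vsprojK.
rewrite -(limg_dim_eq (f := f)) ?kf ?capv0 // lpreimK // fE.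
exact: limg_boundary_sub.
Qed.

End Homology.

Section Exactness.
Variables (n : nat) (N a : nat -> nat).
Local Notation rk i := (\dim (limg (boundary n i))).
Hypotheses (dimN : forall i, \dim {:chains n i} <= N i) (rka : forall i, a i <= rk i).

Lemma homology_exact i : N i <= a i + a i.+1 -> \dim {:homology n i} = 0.
Proof.
move=> h; apply/eqP; rewrite dim_homology -subnDA subn_eq0.
exact: leq_trans (dimN i) (leq_trans h (leq_add (rka i) (rka i.+1))).
Qed.

(** In a degree [j] with [N j <= a j + a j.+1], the inequalities [rk j + rk j.+1 <= \dim {:chains n
    j} <= N j] make both rank bounds exact. Used just below and just above the degree in question,
    this determines the two ranks there. *)
Lemma homology_defect i d : N i <= a i + a i.+1 -> N i.+2 <= a i.+2 + a i.+3 ->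
  a i.+1 + a i.+2 + d = \dim {:chains n i.+1} -> \dim {:homology n i.+1} = d.
Proof.
have rkE j : N j <= a j + a j.+1 -> a j = rk j /\ a j.+1 = rk j.+1.
  move=> h; have hh := leq_trans (rank_boundary_le n j) (leq_trans (dimN j) h).
  split; apply/eqP; rewrite eqn_leq rka /=.
    by rewrite -(leq_add2r (rk j.+1)) (leq_trans hh) // leq_add2l.
  by rewrite -(leq_add2l (rk j)) (leq_trans hh) // leq_add2r.
by move=> /rkE[_ E1] /rkE[E2 _] dE; rewrite dim_homology -dE -E1 -E2 -subnDA addKn.
Qed.

End Exactness.

(** * Certificates *)

Section Numerals.
Import Hexadecimal.

Fixpoint digits (h : uint) : seq nat :=
  match h with
  | Nil => [::]
  | D0 h => 0 :: digits h | D1 h => 1 :: digits h | D2 h => 2 :: digits h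
  | D3 h => 3 :: digits h | D4 h => 4 :: digits h | D5 h => 5 :: digits h
  | D6 h => 6 :: digits h | D7 h => 7 :: digits h | D8 h => 8 :: digits h
  | D9 h => 9 :: digits h | Da h => 10 :: digits h | Db h => 11 :: digits h
  | Dc h => 12 :: digits h | Dd h => 13 :: digits h | De h => 14 :: digits h
  | Df h => 15 :: digits h
  end.

End Numerals.

(** The digit 0 ends a row. It is never an entry, because row [i] lists only vertices [j > i]. *)
Fixpoint decode (l : seq nat) : code :=
  if l is x :: l' then
    let c := decode l' in
    if x is 0 then [::] :: c else if c is r :: c' then (x :: r) :: c' else [::]
  else [::].

Inductive digit := X0 | X1 | X2 | X3 | X4 | X5 | X6 | X7 | X8 | X9 | Xa | Xb | Xc | Xd | Xe | Xf.

Definition digit_value (d : digit) : nat :=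
  match d with
  | X0 => 0 | X1 => 1 | X2 => 2 | X3 => 3 | X4 => 4 | X5 => 5 | X6 => 6 | X7 => 7
  | X8 => 8 | X9 => 9 | Xa => 10 | Xb => 11 | Xc => 12 | Xd => 13 | Xe => 14 | Xf => 15
  end.

Definition add_digit (p : positive) (d : digit) : positive :=
  match d with
  | X0 => xO (xO (xO (xO p)))   | X1 => xI (xO (xO (xO p)))
  | X2 => xO (xI (xO (xO p)))   | X3 => xI (xI (xO (xO p)))
  | X4 => xO (xO (xI (xO p)))   | X5 => xI (xO (xI (xO p)))
  | X6 => xO (xI (xI (xO p)))   | X7 => xI (xI (xI (xO p)))
  | X8 => xO (xO (xO (xI p)))   | X9 => xI (xO (xO (xI p)))
  | Xa => xO (xI (xO (xI p)))   | Xb => xI (xI (xO (xI p)))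
  | Xc => xO (xO (xI (xI p)))   | Xd => xI (xO (xI (xI p)))
  | Xe => xO (xI (xI (xI p)))   | Xf => xI (xI (xI (xI p)))
  end.

Inductive name := Name of digit & digit & digit & digit.

(** The leading [xH] preserves leading zeros: every name is a path of sixteen bits in a
    dictionary. *)
Definition key (x : name) : positive :=
  let: Name a b c d := x in add_digit (add_digit (add_digit (add_digit xH a) b) c) d.

Inductive word := Word of digit & digit & digit & digit & digit & digit
  & digit & digit & digit & digit & digit & digit.

(* A word lists images of vertices; no graph of rank at most 7 has more than 12. *)
Definition letters (K : nat) (x : word) : seq nat :=
  let: Word a b c d e f g h i j k l := x in
  take K (map digit_value [:: a; b; c; d; e; f; g; h; i; j; k; l]).

(* One entry per edge of a graph: [Skip], or the name of a graph of another table
   and a map of the vertices. *)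
Inductive certs := Done | Skip of certs | Cert of name & word & certs.

(* An entry consists of a code, an odd automorphism (empty for even graphs), and certificates. *)
Inductive table := Empty | Entry of uint & uint & certs | Append of table & table.

(* Signed sums of graphs; [Last] ends a sum, and [Term true] subtracts. *)
Inductive rows := NoRows | Term of bool & name & rows | Last of name & rows.

Definition entry := (code * (seq nat * certs))%type.
Definition is_even (x : entry) : bool := if x.2.1 is [::] then true else false.

Fixpoint load_onto (t : table) (l : seq entry) : seq entry :=
  match t with
  | Empty => l
  | Entry c o cs => (decode (digits c), (digits o, cs)) :: l
  | Append t1 t2 => load_onto t1 (load_onto t2 l)
  end.

Definition load (t : table) : seq entry := load_onto t [::].

Fixpoint index_from (k i : positive) (l : seq entry) (tr : tree (positive * entry)) :=
  if l is x :: l' then index_from (Pos.succ k) (Pos.succ i) l' (insert k (i, x) tr) else tr.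

(** The name of four zeros stays free, as [to_name] uses it for a missing graph; the first entry
    gets its successor. The stored number is the position counted from 1. *)
Definition index (l : seq entry) : tree (positive * entry) :=
  index_from (Pos.succ (key (Name X0 X0 X0 X0))) xH l Leaf.

Definition entry0 : entry := ([::], ([::], Done)).

Lemma lookup_index l k x : lookup k (index l) = Some x ->
  exists2 i, i < size l & x = (Pos.of_succ_nat i, nth entry0 l i).
Proof.
rewrite /index -[xH]/(Pos.of_succ_nat 0).
suff gen q i l0 tr : (forall k x, lookup k tr = Some x ->
      exists2 i, i < size l & x = (Pos.of_succ_nat i, nth entry0 l i)) ->
    i + size l0 = size l -> drop i l = l0 ->
    lookup k (index_from q (Pos.of_succ_nat i) l0 tr) = Some x ->
    exists2 i, i < size l & x = (Pos.of_succ_nat i, nth entry0 l i).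
  by apply: (gen _ 0) => //; [case=> ? | rewrite drop0].
elim: l0 q i tr => [|y l0 IH] q i tr inv sz dr /=; first exact: inv.
have il : i < size l by rewrite -sz /= addnS ltnS leq_addr.
apply: (IH _ i.+1); first move=> k' x' h; first case: (lookup_insert h) => [->|/inv //].
- by exists i => //; rewrite -[y]/(nth entry0 (y :: l0) 0) -dr nth_drop addn0.
- by rewrite -sz /= addnS.
by rewrite -add1n -drop_drop dr /= drop0.
Qed.

Lemma nat_of_succ n : nat_of_pos (Pos.of_succ_nat n) = n.+1.
Proof.
have S p : nat_of_pos (Pos.succ p) = (nat_of_pos p).+1.
  by elim: p => //= p IH; rewrite NatTrec.doubleE ?IH // !NatTrec.doubleE doubleS.
by elim: n => //= n IH; rewrite S IH.
Qed.

Lemma compare_contE c p q : Pos.compare_cont c p q =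
  if nat_of_pos p < nat_of_pos q then Lt else if nat_of_pos q < nat_of_pos p then Gt else c.
Proof.
have pos r : 0 < nat_of_pos r by elim: r => //= r IH; rewrite NatTrec.doubleE double_gt0.
elim: p q c => [p IH|p IH|] [q|q|] c //=; rewrite ?NatTrec.doubleE ?IH ?ltnS ?ltn_double.
- by [].
- by rewrite ltn_Sdouble leq_double; case: ltngtP.
- by rewrite double_gt0 pos.
- by rewrite ltn_Sdouble leq_double; case: ltngtP.
- by [].
- by rewrite leqNgt double_gt0 pos /= -[1]/(0.*2.+1) ltn_Sdouble pos.
- by rewrite double_gt0 pos.
by rewrite -[1]/(0.*2.+1) ltn_Sdouble pos.
Qed.

Lemma compare_succE a b : Pos.compare (Pos.of_succ_nat a) (Pos.of_succ_nat b) =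
  if a < b then Lt else if b < a then Gt else Eq.
Proof. by rewrite [LHS]compare_contE !nat_of_succ !ltnS. Qed.

(** * Boundaries of certified graphs *)

(** The sign in [collapse_relab]. The edges before [e] are kept in reverse order, which does not
    affect [flips]. *)
Definition contraction_sign (p : seq nat) (e : edge) (pre post : seq edge) : bool :=
  parity (set_nth 0 (map S p) e.1 0) (+) (flips p pre (+) flips p post).

Lemma flips_cat p es es' : flips p (es ++ es') = flips p es (+) flips p es'.
Proof. by rewrite !flipsE count_cat oddD. Qed.

Lemma flips_rev p es : flips p (rev es) = flips p es.
Proof. by rewrite !flipsE count_rev. Qed.

Section Contract.
Variables (k m : nat) (pre post : seq edge) (e : edge).
Let es := rev pre ++ e :: post.
Hypotheses (o : ordered k.+2 es) (sz : size es = m.+1) (gd : good k.+2 es).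
Let i : 'I_m.+1 := inord (size pre).

Lemma size_pre : size pre < m.+1.
Proof. by rewrite -sz size_cat size_rev /= addnS ltnS leq_addr. Qed.

Lemma collapse_contracts p c : code_ok k.+1 m c -> contracts_to k.+1 p e pre post c ->
  quot_pi (relators k.+1 m) (collapse (realize k.+1 m.+1 es) i) =
  ((-1) ^+ contraction_sign p e pre post *: class k m (code_edges c))%R.
Proof.
move=> ok ct; have rg := ordered_in_range o.
have rg' : in_range k.+2 (pre ++ post).
  by move: rg; rewrite /in_range /es !all_cat all_rev /= => /andP[-> /andP[_ ->]].
have [sp pe sub pm] := contracts_toP (ltn0Sn k) ok rg' ct.
have ee : e.1 != e.2.
  by have /allP/(_ e) := ordered_loopless o; rewrite /es mem_cat mem_head orbT; apply.
have pm' : perm_eq (relab p (rev pre ++ post)) (code_edges c).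
  by apply: perm_trans pm; apply: perm_relab; rewrite perm_cat2r perm_rev.
have ei : size (rev pre) = i by rewrite size_rev inordK // size_pre.
have := @collapse_relab k m (rev pre) post (code_edges c) e.1 e.2 p i.
rewrite -surjective_pairing => ->//; last exact: admissible_realize.
by rewrite flips_cat flips_rev.
Qed.

(** A parallel copy of [e] becomes a loop in the contraction. *)
Lemma collapse_parallel : (e \in pre) || (e \in post) ->
  quot_pi (relators k.+1 m) (collapse (realize k.+1 m.+1 es) i) = 0%R.
Proof.
move=> par; have rg := ordered_in_range o.
have eo : (e.1 < e.2) && (e.2 < k.+2).
  by have /allP/(_ e) := o; rewrite /es mem_cat mem_head orbT; apply.
have /andP[lt lt2] := eo.
(* One explicit map that merges the ends: [e.2] goes to [e.1], and the gap at [e.2] is closed. *)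
pose f v := if v < e.2 then v else if v == e.2 then e.1 else v.-1.
pose p := mkseq f k.+2.
have pE v : v < k.+2 -> nth 0 p v = f v by move=> vk; rewrite nth_mkseq.
have f1 : f e.1 = e.1 by rewrite /f lt.
have f2 : f e.2 = e.1 by rewrite /f ltnn eqxx.
have flt v : v < k.+2 -> f v < k.+1.
  move: (lt2); rewrite ltnS => lt2' vk; rewrite /f; case: (ltngtP v e.2) => [ve|ve|_].
  - exact: leq_trans ve lt2'.
  - by rewrite -ltnS prednK // (leq_ltn_trans _ ve).
  exact: leq_trans lt lt2'.
have ei : size (rev pre) = i by rewrite size_rev inordK // size_pre.
have := @collapse_relab k m (rev pre) post (relab p (rev pre ++ post)) e.1 e.2 p i.
rewrite -surjective_pairing => ->//; last exact: admissible_realize.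
- rewrite class_loop ?scaler0 //.
  + by rewrite size_map; apply: succn_inj; rewrite -sz !size_cat /= addnS.
  + apply/allP => _ /mapP[x xs ->].
    have /allP/(_ x) := rg; rewrite mem_cat inE.
    move: xs; rewrite mem_cat => /orP[->|->]; rewrite ?orbT => /(_ isT)/andP[h1 h2];
      by rewrite /norm /ledge /= !pE //; case: ifP => _ /=; rewrite !flt.
  apply/hasP; exists (norm (ledge p e)); last first.
    by rewrite /norm /ledge !pE ?(ltn_trans lt) // f1 f2 leqnn.
  by apply: map_f; rewrite mem_cat mem_rev.
- by rewrite (ltn_eqF lt).
- by rewrite size_mkseq.
- by rewrite !pE ?(ltn_trans lt) // f1 f2.
move=> x; rewrite mem_iota => /= xk; apply/(nthP 0); rewrite size_mkseq.
have [xe|ex] := ltnP x e.2.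
  by exists x; rewrite ?(leqW xk) // pE ?(leqW xk) // /f xe.
exists x.+1 => //; rewrite pE // /f ltnNge (leqW ex) /=.
by rewrite gtn_eqF.
Qed.

End Contract.

Section Level.
Variables (K : nat) (tr : tree (positive * entry)).

(** An edge may be skipped if it is not [required] or has a parallel copy; [terms] accepts only the
    second reason, for which the contraction is zero. Each certified contraction is verified here
    once, and [termsP] relies on that. *)
Fixpoint covered (ds : seq nat) (pre post : seq edge) (cs : certs) : bool :=
  match post, cs with
  | [::], Done => true
  | e :: post', Skip cs' =>
    (if required ds e then has (edge_eqb e) pre || has (edge_eqb e) post' else true)
    && covered ds (e :: pre) post' cs'
  | e :: post', Cert i q cs' =>
    (if lookup (key i) tr is Some x then contracts_to K (letters K.+1 q) e pre post' x.2.1 else false)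
    && covered ds (e :: pre) post' cs'
  | _, _ => false
  end.

(* Terms with an index outside of [lo, hi) do not affect triangularity: they are dropped. *)
Fixpoint terms (lo hi : positive) (neg : bool) (pre post : seq edge) (cs : certs)
    (acc : seq (bool * positive)) : option (seq (bool * positive)) :=
  match post, cs with
  | [::], Done => Some acc
  | e :: post', Skip cs' =>
    if has (edge_eqb e) pre || has (edge_eqb e) post'
    then terms lo hi neg (e :: pre) post' cs' acc else None
  | e :: post', Cert i q cs' =>
    if lookup (key i) tr is Some (k, _) then
      terms lo hi neg (e :: pre) post' cs'
        (match Pos.compare k lo, Pos.compare k hi with
         | Lt, _ => acc
         | _, Lt => (neg (+) contraction_sign (letters K.+1 q) e pre post', k) :: acc
         | _, _ => acc
         end)
    else None
  | _, _ => None
  end.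

End Level.

Definition codes (l : seq entry) : seq code := map fst l.

Lemma has_edge_eqb e es : has (edge_eqb e) es = (e \in es).
Proof.
by rewrite -has_pred1; apply: eq_has => f; rewrite edge_eqbE /= eq_sym.
Qed.

Lemma coveredP K l' c ds cs : ds = degrees K.+1 (code_edges c) ->
  covered K (index l') ds [::] (code_edges c) cs -> closed_under K (codes l') c.
Proof.
move=> dsE cov l e r E; rewrite -dsE => rq el er; move: cov; rewrite E.
rewrite -[rev l]cats0; have : e \notin [::] by [].
elim: l el cs [::] {E} => [|f l IH] /= el [|cs|i q cs] pre epre //=.
- by rewrite rq !has_edge_eqb (negPf epre) (negPf er).
- case E : lookup => [x|] //= /andP[ct _]; have [j jl xE] := lookup_index E.
  exists x.2.1, (letters K.+1 q); split=> //; rewrite xE /=.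
  by rewrite -(nth_map entry0 [::] fst) // mem_nth ?size_map.
- move: el; rewrite inE negb_or => /andP[ef el] /andP[_ /(IH el)].
  by rewrite rev_cons cat_rcons; apply; rewrite inE negb_or ef.
move: el; rewrite inE negb_or => /andP[ef el] /andP[_ /(IH el)].
by rewrite rev_cons cat_rcons; apply; rewrite inE negb_or ef.
Qed.

Section Terms.
Variables (k m : nat) (l' : seq entry) (ns j : nat) (phi : 'Hom(chain_space k.+1 m, rat^o)).
Hypothesis ok' : all (code_ok k.+1 m) (codes l').
Variables (i : nat) (d : rat).
Hypotheses (ji : j <= i) (ins : i < ns).
Hypothesis phiE : forall u, u < size l' ->
  phi (class k m (code_edges (nth entry0 l' u).1)) = (if u == i then d else 0)%R.

(** The signed multiplicity of the graph at position [i]. The functional [phi] takes the value [d]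
    on this graph, not necessarily 1, whence the factor [d] below. *)
Definition weight (acc : seq (bool * positive)) : rat :=
  (\sum_(t <- acc) if Pos.eqb t.2 (Pos.of_succ_nat i) then (-1) ^+ t.1 else 0)%R.

Lemma pos_eqbE p q : Pos.eqb p q = (nat_of_pos p == nat_of_pos q).
Proof.
apply/idP/eqP => [/pos_eqb_eq -> //|/nat_of_pos_inj ->]; exact: pos_eqb_refl.
Qed.

Lemma eqb_succE u v : Pos.eqb (Pos.of_succ_nat u) (Pos.of_succ_nat v) = (u == v).
Proof. by rewrite pos_eqbE !nat_of_succ. Qed.

Lemma weight_cons t acc :
  weight (t :: acc) =
  ((if Pos.eqb t.2 (Pos.of_succ_nat i) then (-1) ^+ t.1 else 0) + weight acc)%R.
Proof. by rewrite /weight big_cons. Qed.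

(** A loop invariant: the sum runs over the edges still to be contracted, and [acc] carries what was
    recorded before. *)
Lemma termsP ds neg pre post cs acc acc' :
  let es := rev pre ++ post in
  ordered k.+2 es -> size es = m.+1 -> good k.+2 es ->
  covered k.+1 (index l') ds pre post cs ->
  terms k.+1 (index l') (Pos.of_succ_nat j) (Pos.of_succ_nat ns) neg pre post cs acc = Some acc' ->
  ((-1) ^+ neg * (\sum_(size pre <= u < m.+1)
      phi (quot_pi _ (collapse (realize k.+1 m.+1 es) (inord u)))) + weight acc * d =
   weight acc' * d)%R.
Proof.
elim: post pre cs acc => [|e post IH] pre cs acc /=.
  rewrite cats0 size_rev => _ -> _; rewrite big_geq // mulr0 add0r.
  by case: cs => // _ [->].
rewrite -cat_rcons -rev_cons => o sz gd.
have o0 := o; have sz0 := sz; have gd0 := gd.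
rewrite rev_cons cat_rcons in o0 sz0 gd0.
rewrite big_ltn ?(size_pre sz0) // [in X in (_ * (X + _))%R]rev_cons cat_rcons.
case: cs => [//|cs|x q cs] /andP[h cov].
  case: ifP => // par /(IH (e :: pre) cs acc o sz gd cov) <-.
  by rewrite (collapse_parallel o0 sz0 gd0) ?linear0 ?add0r // -!has_edge_eqb.
case E : lookup h => [[pk en]|] // ct.
have [u ul [pkE enE]] := lookup_index E.
have oku : code_ok k.+1 m (nth entry0 l' u).1.
  by have := all_nthP [::] ok' u; rewrite size_map (nth_map entry0) //; apply.
rewrite /= enE in ct.
rewrite (collapse_contracts o0 sz0 gd0 oku ct) lfunZ (phiE ul).
set sg := contraction_sign _ _ _ _.
set an := (X in terms _ _ _ _ _ _ _ _ X) => /(IH (e :: pre) cs _ o sz gd cov) <-.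
suff -> : (weight an * d = (-1) ^+ neg * ((-1) ^+ sg * (if u == i then d else 0)) + weight acc * d)%R.
  by rewrite mulrDr -addrA addrCA.
rewrite /an pkE !compare_succE mulrA -signr_addb.
have keep : weight ((neg (+) sg, Pos.of_succ_nat u) :: acc) =
    ((if u == i then (-1) ^+ (neg (+) sg) else 0) + weight acc)%R.
  by rewrite weight_cons eqb_succE.
(* Position [i] passes both comparisons, so its sign is recorded. Any other position contributes
   nothing to the weight of [i], recorded or dropped. *)
have [ui|ui] := eqVneq u i.
  have E' : (if j < i then Gt else Eq) <> Lt by case: ifP.
  rewrite ui ltnNge ji ins /=; case: (if j < i then Gt else Eq) E' => // _;
    by rewrite -ui keep ui eqxx mulrDl.
rewrite mulr0 add0r; congr (_ * _)%R.
have {}keep : weight ((neg (+) sg, Pos.of_succ_nat u) :: acc) = weight acc.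
  by rewrite keep (negPf ui) add0r.
by do 4?[case: ifP => _ //].
Qed.
End Terms.

(** * Triangular blocks in the boundary matrices *)

Definition balanced (x : positive) (acc : seq (bool * positive)) : bool :=
  let own := filter (fun t => Pos.eqb t.2 x) acc in
  Nat.eqb (count fst own) (count (fun t => ~~ t.1) own).

(** Since [terms] keeps only positions from the current pivot to the last one, this says that row
    [j] is nonzero at pivot [j] and zero at all later pivots. *)
Definition pivotal (j : positive) (acc : seq (bool * positive)) : bool :=
  ~~ balanced j acc && all (fun t => if Pos.eqb t.2 j then true else balanced t.2 acc) acc.

Lemma weightE i acc : weight i acc =
  ((count (fun t => ~~ t.1) (filter (fun t => Pos.eqb t.2 (Pos.of_succ_nat i)) acc))%:R -
   (count fst (filter (fun t => Pos.eqb t.2 (Pos.of_succ_nat i)) acc))%:R)%R.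
Proof.
elim: acc => [|[b k] acc IH]; first by rewrite /weight big_nil subrr.
rewrite weight_cons IH /=; case: Pos.eqb => /=; last by rewrite add0r.
case: b => /=; last by rewrite add0n expr0 natrD addrA.
by rewrite add0n expr1 natrD opprD addrCA.
Qed.

Lemma balancedE i acc : balanced (Pos.of_succ_nat i) acc = (weight i acc == 0)%R.
Proof. by rewrite weightE /balanced nat_eqb eq_sym subr_eq0 Num.Theory.eqr_nat. Qed.

Lemma pivotalP i j acc : pivotal (Pos.of_succ_nat j) acc -> i != j -> weight i acc = 0%R.
Proof.
case/andP=> _ al ij; apply/eqP; rewrite -balancedE.
pose Q (t : bool * positive) := Pos.eqb t.2 (Pos.of_succ_nat i).
have [hs|nh] := boolP (has Q acc); last first.
  have f0 : filter Q acc = [::] by elim: acc nh {al} => //= t acc' IH; rewrite negb_or => /andP[/negPf->].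
  by rewrite /balanced -/Q f0.
suff [t [qt]] : exists t, Q t /\ (if Pos.eqb t.2 (Pos.of_succ_nat j) then true else balanced t.2 acc).
  by move: qt; rewrite /Q pos_eqbE => /eqP/nat_of_pos_inj ->; rewrite eqb_succE (negPf ij).
move: al; set P := (P in all P _) => al; rewrite -/(exists t, Q t /\ P t).
elim: (acc) hs al => //= t acc' IH; case qt : (Q t) => /=.
  by move=> _ /andP[ht _]; exists t; split; [apply: qt | apply: ht].
by move=> hs /andP[_]; apply: IH.
Qed.

Section Rows.
Variables (K : nat) (tr tr' : tree (positive * entry)) (hi : positive).

Definition add_terms (lo : positive) (neg : bool) (i : name) (acc : seq (bool * positive)) :=
  if lookup (key i) tr is Some (_, (c, (_, cs))) then
    terms K tr' lo hi neg [::] (code_edges c) cs acc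
  else None.

Fixpoint triangular (R : rows) (lo : positive) (acc : seq (bool * positive)) : bool :=
  match R with
  | NoRows => true
  | Term b i R' => if add_terms lo b i acc is Some acc' then triangular R' lo acc' else false
  | Last i R' =>
    if add_terms lo false i acc is Some acc'
    then pivotal lo acc' && triangular R' (Pos.succ lo) [::] else false
  end.

End Rows.

Fixpoint count_rows (R : rows) : nat :=
  match R with NoRows => 0 | Term _ _ R' => count_rows R' | Last _ R' => (count_rows R').+1 end.

Definition covered_by K (tr' : tree (positive * entry)) (x : entry) : bool :=
  let es := code_edges x.1 in covered K tr' (degrees K.+1 es) [::] es x.2.2.

Section Rank.
Variables (k m : nat) (l l' : seq entry) (ns : nat).
Hypotheses (ok : all (code_ok k.+2 m.+1) (codes l)) (ok' : all (code_ok k.+1 m) (codes l')).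
Hypothesis cov : all (covered_by k.+1 (index l')) l.
Variables (phi : nat -> 'Hom(chain_space k.+1 m, rat^o)) (d : nat -> rat).
Hypothesis d0 : forall i, i < ns -> d i != 0%R.
Hypothesis phiE : forall i u, i < ns -> u < size l' ->
  phi i (class k m (code_edges (nth entry0 l' u).1)) = (if u == i then d i else 0)%R.

Local Notation bd := (collapse_boundary k m).

Lemma boundary_terms j neg i acc acc' :
  add_terms k.+1 (index l) (index l') (Pos.of_succ_nat ns) (Pos.of_succ_nat j) neg i acc = Some acc' ->
  exists v, forall u, j <= u -> u < ns ->
    (phi u (bd v) + weight u acc * d u = weight u acc' * d u)%R.
Proof.
rewrite /add_terms; case E : lookup => [[x [c [o cs]]]|] // tm.
have [w wl [_ wE]] := lookup_index E.
have okc : code_ok k.+2 m.+1 c.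
  by have := all_nthP [::] ok w; rewrite size_map (nth_map entry0) // -wE; apply.
have [sc oc sm gd] := code_okP (ltn0Sn _) okc.
exists ((-1) ^+ neg *: class k.+1 m.+1 (code_edges c))%R => u ju us.
rewrite lfunZ /class collapse_boundaryE ?admissible_realize // lfunZ lfun_sum.
have covw : covered_by k.+1 (index l') (c, (o, cs)).
  by rewrite wE; apply: all_nthP cov _ wl.
have := termsP ok' ju us (fun v => phiE us) (pre := [::]) oc sm gd covw tm.
rewrite big_mkord => <-; congr (_ * _ + _)%R.
by apply: eq_bigr => e _; rewrite inord_val.
Qed.

(** Here [v0] is the part of the current combination already read, and [acc] records the
    coefficients of its boundary. [Last] completes the row, and the next one starts from 0. *)
Lemma triangularP R j acc v0 : j + count_rows R <= ns ->
  (forall u, j <= u -> u < ns -> phi u (bd v0) = (weight u acc * d u)%R) ->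
  triangular k.+1 (index l) (index l') (Pos.of_succ_nat ns) R (Pos.of_succ_nat j) acc ->
  exists x : nat -> chain_space k.+2 m.+1, forall t, t < count_rows R ->
    phi (j + t) (bd (x t)) != 0%R /\
    forall i, j + t < i -> i < ns -> phi i (bd (x t)) = 0%R.
Proof.
elim: R j acc v0 => [|b i R IH|i R IH] j acc v0 /= jR v0E; first by exists (fun=> 0%R).
  case E : add_terms => [acc'|] // ro; have [v vE] := boundary_terms E.
  apply: (IH j acc' (v0 + v)%R jR) ro => u ju us.
  by rewrite !linearD /= -(vE u ju us) addrC v0E.
case E : add_terms => [acc'|] // /andP[pv].
rewrite -[Pos.succ _]/(Pos.of_succ_nat j.+1) => ro; have [v vE] := boundary_terms E.
have [|u _ _|x xE] := IH j.+1 [::] 0%R _ _ ro; first by rewrite addSnnS.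
  by rewrite !linear0 /weight big_nil mul0r.
have vE' u : j <= u -> u < ns -> phi u (bd (v0 + v)%R) = (weight u acc' * d u)%R.
  by move=> ju us; rewrite !linearD /= -(vE u ju us) addrC v0E.
exists (fun t => if t is t'.+1 then x t' else v0 + v)%R => -[|t].
  rewrite addn0 => _; have jn : j < ns by apply: leq_trans jR; rewrite addnS ltnS leq_addr.
  split=> [|u ju us]; rewrite vE' ?(ltnW ju) //.
    by rewrite mulf_neq0 ?d0 // -balancedE; case/andP: pv.
  by rewrite (pivotalP pv) ?mul0r // gtn_eqF.
by rewrite ltnS addnS -addSn; apply: xE.
Qed.

Lemma rows_rank R : count_rows R = ns ->
  triangular k.+1 (index l) (index l') (Pos.of_succ_nat ns) R xH [::] -> ns <= \dim (limg bd).
Proof.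
move=> nR ro; have [||x xE] := triangularP (j := 0) (v0 := 0%R) _ _ ro.
- by rewrite nR.
- by move=> u _ _; rewrite !linear0 /weight big_nil mul0r.
rewrite nR in xE; apply: (triangular_rank (x := x) (f := phi)) => [j /xE[]//|i j ij jr].
by have [_] := xE i (ltn_trans ij jr); apply.
Qed.

End Rank.

(** * Bases of the chain spaces *)

Definition odd_ok K (x : entry) : bool :=
  if is_even x then true else
  let es := code_edges x.1 in
  relabels K x.2.1 es x.1 && (parity x.2.1 (+) flips x.2.1 es).

(** A lower bound of the chain dimension is used only when [all_even] is set; otherwise evenness
    matters only for the [ns] pivots. All listed even graphs must be distinct in any case, since the
    functional of a pivot has to vanish on the other graphs. *)
Definition independent (r : (nat * nat) * (nat * nat)) K (all_even : bool) (ns : nat) (l : seq entry) : bool :=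
  let sk := [seq prepare r K x.1 | x <- l & is_even x] in
  [&& Nat.leb ns (size l), all is_even (take ns l),
      all (fun x => even_sketch x.2) (if all_even then sk else take ns sk) &
      separated distinct sk].

Lemma pairwise_filter_imply (T : Type) (p : pred T) (R : rel T) s :
  pairwise R (filter p s) -> pairwise (fun x y => p x && p y ==> R x y) s.
Proof.
elim: s => //= x s IH; case: ifP => px /=; last by move=> h; rewrite IH // andbT all_predT.
by case/andP=> h /IH ->; rewrite andbT; move: h; rewrite all_filter.
Qed.

Lemma take_filter (T : Type) (p : pred T) n s :
  all p (take n s) -> take n (filter p s) = take n s.
Proof.
elim: s n => [|x s IH] [|n] //=; first by rewrite take0.
by case/andP=> px h; rewrite px /= IH.
Qed.

Section Basis.
Variables (k m : nat) (l : seq entry).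
Hypothesis ok : all (code_ok k.+1 m) (codes l).
Hypothesis odd : all (odd_ok k.+1) l.

Local Notation cls x := (class k m (code_edges x)).
Local Notation evens := (codes (filter is_even l)).

Lemma nth_codes i : i < size l -> nth [::] (codes l) i = (nth entry0 l i).1.
Proof. by move=> il; rewrite (nth_map entry0). Qed.

Lemma odd_class i : i < size l -> ~~ is_even (nth entry0 l i) -> cls (nth entry0 l i).1 = 0%R.
Proof.
move=> il ev; have := all_nthP entry0 odd i il; rewrite /odd_ok (negPf ev).
have okc : code_ok k.+1 m (nth entry0 l i).1.
  by rewrite -nth_codes //; apply: all_nthP ok _ _; rewrite size_map.
have [sc o sm gd] := code_okP (ltn0Sn k) okc.
case/andP=> /(relabelsP (ltn0Sn k))[pp _ pe] sg.
have := class_relab sm (ordered_in_range o) pp pe; rewrite sg expr1 scaleN1r.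
exact: rat_sign_eq0.
Qed.

Lemma ok_evens : all (code_ok k.+1 m) evens.
Proof.
by rewrite /codes all_map all_filter; move: ok; rewrite /codes all_map; apply: sub_all => x /= ->; rewrite implybT.
Qed.

Lemma dim_chains_le : covers k.+1 m (codes l) -> \dim {:chain_space k.+1 m} <= count is_even l.
Proof.
move=> cov; pose X := [seq cls c | c <- evens].
have -> : fullv = <<X>>%VS.
  apply/esym/(covers_subspace (T := codes l)) => // [c cl|c]; first exact: allP ok c cl.
  case/(nthP [::])=> i; rewrite size_map => il <-; rewrite nth_codes //.
  have [ev|ev] := boolP (is_even (nth entry0 l i)); last by rewrite odd_class // mem0v.
  apply: memv_span; apply: map_f.
  elim: (l) i il ev {cov} => // x l' IH [|i] /= il ev; first by rewrite /= ev mem_head.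
  by case: ifP => _; rewrite ?inE IH ?orbT.
by apply: leq_trans (dim_span _) _; rewrite !size_map size_filter.
Qed.

Variables (r : (nat * nat) * (nat * nat)) (all_even : bool) (ns : nat).
Hypothesis ind : independent r k.+1 all_even ns l.

Definition dual (c : code) := coef (realize k m (code_edges c)).

Lemma pivot_lt i : i < ns -> i < size l.
Proof. by case/and4P: ind; rewrite nat_leb => sz _ _ _ h; apply: leq_trans h sz. Qed.

Lemma pivot_even i : i < ns -> is_even (nth entry0 l i).
Proof.
move=> is_; have il := pivot_lt is_; case/and4P: ind => _ ev _ _.
by have := all_nthP entry0 ev i; rewrite nth_take // size_takel; [apply | case/and4P: ind; rewrite nat_leb].
Qed.

Lemma pivot_coef i u : i < ns -> u < size l ->
  dual (nth entry0 l i).1 (cls (nth entry0 l u).1) =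
  (if u == i then dual (nth entry0 l i).1 (cls (nth entry0 l i).1) else 0)%R.
Proof.
move=> is_ ul; have il := pivot_lt is_; case: eqVneq => [->//|ui].
have [ev|ev] := boolP (is_even (nth entry0 l u)); last by rewrite odd_class // linear0.
have iev := pivot_even is_.
have okn x : x < size l -> code_ok k.+1 m (nth entry0 l x).1.
  by move=> xl; rewrite -nth_codes //; apply: all_nthP ok _ _; rewrite size_map.
case/and4P: ind => _ _ _ /separatedP; rewrite pairwise_map => /pairwise_filter_imply.
move/(pairwiseP entry0) => pw; have [lt|lt|e] := ltngtP u i; last by rewrite e eqxx in ui.
  have := pw _ _ ul il lt; rewrite ev iev /= => h.
  exact: (distinct_coef (okn _ ul) (okn _ il) h).2.
have := pw _ _ il ul lt; rewrite ev iev /= => h.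
exact: (distinct_coef (okn _ il) (okn _ ul) h).1.
Qed.

Lemma pivot_coef_neq0 i : i < ns -> dual (nth entry0 l i).1 (cls (nth entry0 l i).1) != 0%R.
Proof.
move=> is_; have il := pivot_lt is_.
have okn : code_ok k.+1 m (nth entry0 l i).1.
  by rewrite -nth_codes //; apply: all_nthP ok _ _; rewrite size_map.
apply: (even_coef (r := r) okn); case/and4P: ind; rewrite nat_leb => sz ev al _.
have {al}: all (fun x => even_sketch x.2)
    (take ns [seq prepare r k.+1 x.1 | x <- filter is_even l]).
  by case: all_even al => // al; rewrite -(cat_take_drop ns (map _ _)) all_cat in al; case/andP: al.
rewrite -map_take take_filter // all_map => al.
by have := all_nthP entry0 al i; rewrite size_takel // nth_take //; apply.
Qed.

Lemma dim_chains_ge : all_even -> count is_even l <= \dim {:chain_space k.+1 m}.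
Proof.
move=> ae; case/and4P: ind => _ _; rewrite ae => al sp.
have oke := ok_evens; rewrite all_map in al.
have skE : [seq prepare r k.+1 x.1 | x <- l & is_even x] = map (prepare r k.+1) evens.
  by rewrite /codes -map_comp.
rewrite skE in sp; have se : size evens = count is_even l by rewrite size_map size_filter.
have /eqP : free [seq cls (nth [::] evens j) | j <- rev (iota 0 (count is_even l))].
  apply: (@triangular_free _ _ _ (fun j => dual (nth [::] evens j))) => [j jl|i j ij jl].
    rewrite -se in jl; apply: (even_coef (r := r)); first exact: all_nthP oke _ jl.
    rewrite /codes size_map in jl.
    by rewrite (nth_map entry0) //; apply: all_nthP al _ jl.
  by apply: (separated_coef oke sp); rewrite ?se // ?(ltn_trans ij jl) // gtn_eqF.
by rewrite size_map size_rev size_iota => <-; apply/dimvS/subvf.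
Qed.

End Basis.

(** * Growing trivalent graphs *)

Section GrowCheck.
Variables (K : nat) (tr : tree (positive * entry)).

Definition relabels_to q i p (es : seq edge) : bool :=
  if lookup (key i) tr is Some x then relabels q (letters q p) es x.2.1 else false.

Fixpoint grows_from (q v w : nat) (es : seq edge) (ds : seq nat) (cs : certs) : bool :=
  if ds is d :: ds' then
    if Nat.ltb d 3 && ~~ Nat.eqb w v then
      match cs with
      | Skip cs' => saturated K q ((v, w) :: es) && grows_from q v w.+1 es ds' cs'
      | Cert i p cs' => relabels_to q i p ((v, w) :: es) && grows_from q v w.+1 es ds' cs'
      | Done => false
      end
    else grows_from q v w.+1 es ds' cs
  else if Nat.ltb q K then
    if cs is Cert i p _ then relabels_to q.+1 i p ((v, q) :: es) else false
  else true.

(** In the tables of partial graphs the slot of the odd automorphism holds the vertex [v]. The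
    certificates follow the free vertices other than [v] in order; a last one attaches a new
    vertex. *)
Definition grows_ok (x : entry) : bool :=
  let es := code_edges x.1 in let q := size x.1 in let ds := degrees q es in
  if x.2.1 is v :: _ then
    [&& Nat.ltb v q, Nat.ltb (nth 0 ds v) 3 & grows_from q v 0 es ds x.2.2]
  else false.

End GrowCheck.

Lemma relabels_toP q i p es l : relabels_to (index l) q i p es ->
  exists c' p, c' \in codes l /\ relabels q p es c'.
Proof.
rewrite /relabels_to; case E : lookup => [x|] // h; have [j jl xE] := lookup_index E.
exists x.2.1, (letters q p); split=> //; rewrite xE /=.
by rewrite -(nth_map entry0 [::] fst) // mem_nth ?size_map.
Qed.

Lemma grows_okP K l x : in_range (size x.1) (code_edges x.1) ->
  grows_ok K (index l) x -> grows K (codes l) x.1.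
Proof.
case: x => c [[|v o'] cs] //= rc; rewrite /grows_ok /=.
set es := code_edges c in rc *; set q := size c in rc *.
case/and3P; rewrite nat_ltb => vq dv gf; exists v; rewrite -/es -/q.
have dE w : w < q -> nth 0 (degrees q es) w = deg w es by move=> wq; apply: nth_degrees.
have gen ds w0 cs0 : grows_from K (index l) q v w0 es ds cs0 ->
    (forall w, w < size ds -> w0 + w != v -> nth 0 ds w < 3 ->
       saturated K q ((v, w0 + w) :: es) \/
       exists c' p, c' \in codes l /\ relabels q p ((v, w0 + w) :: es) c') /\
    (q < K -> exists c' p, c' \in codes l /\ relabels q.+1 p ((v, q) :: es) c').
  elim: ds w0 cs0 => [|d ds IH] w0 cs0 /=.
    by rewrite nat_ltb => h; split=> // qK; rewrite qK in h; case: cs0 h => // i p _ /relabels_toP.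
  rewrite nat_ltb nat_eqb; case: ifP => [/andP[d3 wv]|nd].
    case: cs0 => // [cs0|i p cs0] /andP[h /IH[h1 h2]]; split=> // -[|w].
    - by rewrite addn0; left.
    - by rewrite addnS -addSn; apply: h1.
    - by rewrite addn0; right; apply: relabels_toP h.
    by rewrite addnS -addSn; apply: h1.
  move=> /IH[h1 h2]; split=> // -[|w]; last by rewrite addnS -addSn; apply: h1.
  by rewrite addn0 => _ wv d3; rewrite d3 wv in nd.
have [h1 h2] := gen _ _ _ gf; split=> //; first by rewrite -dE // -nat_ltb.
by move=> w wq wv dw; apply: h1; rewrite ?size_degrees ?dE.
Qed.

(* The tables of the partial graphs, in decreasing order of the number of edges. *)
Fixpoint grow_chain K (us : seq (seq entry)) (top : seq entry) : bool :=
  if us is u :: us' then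
    (let tr := index top in all (grows_ok K tr) u) && grow_chain K us' u
  else has (code_eqb [:: [::]]) (codes top).

Lemma grow_chainP K us top es : 0 < K -> good K es -> (forall v, v < K -> deg v es = 3) ->
  grow_chain K us top -> exists2 c, c \in codes top & embeds K es c.
Proof.
move=> K0 gd d3; elim: us top => [|u us IH] top /=.
  by case/hasP=> c cl e; exists c => //; rewrite -(@code_eqbP [:: [::]] c e); apply: embeds_start.
case/andP=> gr /IH[c cu em]; have [j] := nthP [::] cu; rewrite size_map => ju cE.
rewrite -cE nth_codes // in em; have [rc _] := em.
by apply: (embeds_grow gd d3 _ em); apply: grows_okP rc _; apply: all_nthP gr _ ju.
Qed.

Lemma grow_covers k m us top : 3 * k.+1 = 2 * m -> all (code_ok k.+1 m) (codes top) ->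
  grow_chain k.+1 us top -> covers k.+1 m (codes top).
Proof.
move=> km ok gr es sm gd; have [r ll dg lk] := gd.
(* The valences are at least 3 and their sum is [3 * k.+1], so each of them is 3. *)
have d3 v : v < k.+1 -> deg v es = 3.
  have sums : \sum_(v < k.+1) deg v es = \sum_(v < k.+1) 3.
    by rewrite sum_deg // sm -km sum_nat_const card_ord mulnC.
  have := leqif_sum (fun (v : 'I_k.+1) (_ : true) => leqif_eq (dg v (ltn_ord v))).
  rewrite sums => -[_]; rewrite eqxx => /esym/forallP h vk.
  by have /eqP := h (Ordinal vk).
have [c ct em] := grow_chainP (ltn0Sn k) gd d3 gr.
have [sc o sz _] := code_okP (ltn0Sn k) (allP ok c ct).
have [p [pp pe]] := embeds_all sm gd em sz.
by exists c; split=> //; exists p; rewrite (ordered_norm o) in pe.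
Qed.

(** * Degrees without chains *)

Lemma no_admissible k m : (forall G : graph k m, ~~ admissible G) -> \dim {:chain_space k m} = 0.
Proof.
move=> no; apply/eqP; rewrite dimv_eq0 -(chain_subspace (U := 0%VS)) //.
by move=> G aG; have := no G; rewrite aG.
Qed.

Lemma dim_chains0 n : \dim {:chains n 0} = 0.
Proof. by apply: no_admissible => G; rewrite /admissible /connected ltnn. Qed.

Lemma dim_chains1 n : 0 < n -> \dim {:chains n 1} = 0.
Proof.
case: n => // n _; apply/eqP; rewrite dimv_eq0 -(chain_subspace (U := 0%VS)) // => G _.
by rewrite (@graph_class_loop _ _ G ord0) ?mem0v //; apply: val_inj; rewrite /= !ord1.
Qed.

(** Valences of at least 3 give [3 * i <= 2 * (i - 1 + n)], that is [i <= 2 * n - 2]. *)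
Lemma dim_chains_high n i : n.*2.-2 < i -> \dim {:chains n i} = 0.
Proof.
move=> ni; apply: no_admissible => G; apply/negP => /andP[_ /forallP vG].
have : \sum_(v < i) 3 <= \sum_(v < i) valence G v by apply: leq_sum => v _; apply: vG.
have -> : \sum_(v < i) valence G v = 2 * (i.-1 + n).
  transitivity (\sum_(v < i) \sum_(x | predT x && (G x == v)) 1).
    by apply: eq_bigr => v _; rewrite /valence -sum1_card; apply: eq_bigl => x; rewrite inE.
  by rewrite -(partition_big G predT) // sum1_card card_prod card_bool card_ord mulnC.
rewrite sum_nat_const card_ord; case: i ni {vG G} => // i ni; rewrite /= mulnDr.
have -> : i.+1 * 3 = 2 * i + i.+3 by rewrite mulSnr -[i.+3]addn3 addnA -[2 * i + i]mulSnr mulnC.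
rewrite leq_add2l mul2n ltnS in ni * => h; move: (leq_trans h (leqnn _)).
by move: ni; case: (n.*2) h => [|[|j]] //= _ ji; rewrite !ltnS ltnNge ji.
Qed.

(** * Homology from certified tables *)

Definition exceptions : seq (nat * nat * nat) :=
  [:: (2, 2, 1); (3, 4, 1); (4, 6, 1); (5, 8, 2); (6, 10, 2); (6, 7, 1); (7, 12, 3); (7, 9, 1)].

Definition betti (n i : nat) : nat :=
  foldr (fun x d => if Nat.eqb x.1.1 n && Nat.eqb x.1.2 i then x.2 else d) 0 exceptions.

Lemma betti_exceptions n i : betti n i != 0 -> (n, i) \in unzip1 exceptions.
Proof.
rewrite /betti; elim: exceptions => //= -[[a b] d] l IH; rewrite !nat_eqb inE xpair_eqE /=.
by rewrite ![_ == n]eq_sym ![_ == i]eq_sym; case: (_ && _) => //=.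
Qed.

(** No two exceptional degrees of the same rank are adjacent, so [homology_defect] applies at each
    of them. *)
Lemma betti_neighbours n i : betti n i != 0 ->
  [/\ 1 < i, i <= n.*2.-2, betti n i.-1 = 0 & betti n i.+1 = 0].
Proof.
move=> /betti_exceptions; rewrite !inE /= !xpair_eqE.
by do 7?[case/orP]; case/andP=> /eqP-> /eqP->.
Qed.

(* The number of pivots of the next boundary, the graphs, starting with the pivots,
   and the rows of the boundary. *)
Definition level := (nat * seq entry * rows)%type.

Section Check.
Variables (n : nat) (lv : nat -> level).

(** On trivalent graphs, refinement from the valences leaves a single colour, so in the top degree
    both colourings start from marked vertices. Elsewhere the first one starts from the valences,
    which is cheaper. *)
Definition rounds K : (nat * nat) * (nat * nat) :=
  if Nat.eqb K n.*2.-2 then ((2, 2), (2, 3)) else ((4, 0), (2, 2)).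

(** The count compares the number of even graphs with the two rank bounds plus the Betti number. The
    pivots of the outgoing boundary belong to the level below. *)
Definition level_ok K : bool :=
  let: (ns, l, _) := lv K in
  [&& all (code_ok K (K.-1 + n)) (codes l), all (odd_ok K) l,
      independent (rounds K) K (~~ Nat.eqb (betti n K) 0) ns l &
      Nat.eqb (count is_even l) ((if Nat.ltb 2 K then (lv K.-1).1.1 else 0) + ns + betti n K)].

Definition step_ok K : bool :=
  let: (_, l, R) := lv K in let: (ns, l', _) := lv K.-1 in
  let tr := index l' in
  [&& all (covered_by K.-1 tr) l, Nat.eqb (count_rows R) ns &
      triangular K.-1 (index l) tr (Pos.of_succ_nat ns) R xH [::]].

Definition top_ok (us : seq (seq entry)) : bool :=
  Nat.eqb (lv n.*2.-2).1.1 0 && grow_chain n.*2.-2 us (lv n.*2.-2).1.2.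

Variable us : seq (seq entry).
Hypotheses (n1 : 1 < n) (top : top_ok us).
Hypothesis levels : forall K, 1 < K -> K <= n.*2.-2 -> level_ok K.
Hypothesis steps : forall K, 2 < K -> K <= n.*2.-2 -> step_ok K.

Local Notation gr K := (lv K).1.2.
Local Notation ns K := (lv K).1.1.

Lemma level_okP K : 1 < K -> K <= n.*2.-2 ->
  [/\ all (code_ok K (K.-1 + n)) (codes (gr K)), all (odd_ok K) (gr K),
      independent (rounds K) K (~~ Nat.eqb (betti n K) 0) (ns K) (gr K) &
      count is_even (gr K) = (if 2 < K then ns K.-1 else 0) + ns K + betti n K].
Proof.
move=> K1 Kn; have := levels K1 Kn; rewrite /level_ok; case: (lv K) => [[s l] R] /=.
by case/and4P=> h1 h2 h3; rewrite nat_eqb nat_ltb => /eqP.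
Qed.

Lemma level_covers K : 1 < K -> K <= n.*2.-2 -> covers K (K.-1 + n) (codes (gr K)).
Proof.
(* Induction on the distance from the top degree, whose table is complete by growth. *)
move=> + Kn; rewrite -(subKn Kn); elim: (n.*2.-2 - K) => [|d IH] h.
  rewrite subn0 in h *; case/andP: top => _.
  have [ok _ _ _] := level_okP h (leqnn _).
  case E : n.*2.-2 h ok => [|k] // _ ok; apply: (grow_covers _ ok).
  have n2 : n.*2 = k.+3 by move: n1 E; case: (n) => [|[|n']] //=; rewrite doubleS => _ E'; rewrite -[k.+3]/(k.+1.+2) -E'.
  by rewrite /= mulnDr [2 * n]mul2n n2 -[k.+3]addn3 addnA mulnS addnC -mulSnr.
have h' : 1 < n.*2.-2 - d by apply: leq_trans h _; rewrite leq_sub2l.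
have cov := IH h'; have [ok _ _ _] := level_okP h' (leq_subr _ _).
have [ok' _ _ _] := level_okP h (leq_subr _ _).
have E : n.*2.-2 - d = (n.*2.-2 - d.+1).+1 by rewrite subnSK // -subn_gt0; apply: ltn_trans h'.
have := steps (_ : 2 < n.*2.-2 - d) (leq_subr _ _); rewrite E => /(_ h).
rewrite E in cov ok; move: E h cov ok ok'; set K' := n.*2.-2 - d.+1 => E h cov ok ok'.
rewrite /step_ok /=; case: (lv K') ok' => [[s' l'] R'] /= ok'.
case: (lv K'.+1) cov ok => [[s l] R] /= cov ok /and3P[cv _ _].
case: K' h cov ok ok' cv E => // k h cov ok ok' cv E.
apply: (@covers_contract k.+1 (k + n) _ _ _ _ _ _ _ cov) => //.
(* Below the top degree, twice the number of edges exceeds three times the number of vertices. *)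
- have kn : k.+4 <= n.*2.
    by have := leq_subr d n.*2.-2; rewrite E; move: n1; case: (n) => [|[|n']].
  by rewrite mulnDr [2 * n]mul2n mulnC mulSnr [k * 3]mulnSr [2 * k]mulnC -addnA ltn_add2l addn3.
- by move=> c; apply: (allP ok).
- by move=> c; apply: (allP ok').
move=> c /(nthP [::])[i]; rewrite size_map => il <-; rewrite nth_codes //.
by have := all_nthP entry0 cv i il; apply: coveredP.
Qed.

Definition dim_bound i := if (1 < i) && (i <= n.*2.-2) then count is_even (gr i) else 0.
Definition rank_bound i := if (2 < i) && (i <= n.*2.-2) then ns i.-1 else 0.

Lemma dim_chains_bound i : \dim {:chains n i} <= dim_bound i.
Proof.
rewrite /dim_bound; case: ifP => [/andP[i1 ik]|].
  have cov := level_covers i1 ik; have [ok od _ _] := level_okP i1 ik.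
  by case: i i1 ik cov ok od => // k _ _ cov ok od; apply: dim_chains_le.
move/negbT; rewrite negb_and -leqNgt -ltnNge leq_eqVlt ltnS leqn0.
case/orP=> [/orP[]/eqP->|h]; rewrite leqn0.
- by rewrite dim_chains1 // ltnW.
- by rewrite dim_chains0.
by rewrite dim_chains_high.
Qed.

Lemma rank_boundary_bound i : rank_bound i <= \dim (limg (boundary n i)).
Proof.
rewrite /rank_bound; case: ifP => // /andP[i2 ik].
have [ok od _ _] := level_okP (ltnW i2) ik.
have i1 : 1 < i.-1 by case: i i2 {ik ok od}.
have [ok' od' ind' _] := level_okP i1 (leq_trans (leq_pred i) ik).
have := steps i2 ik; rewrite /step_ok; case: i i2 ik ok od i1 ok' od' ind' => [|[|k]] // _ _.
rewrite [k.+2.-1]/=; case: (lv k.+2) => [[s l] R]; case: (lv k.+1) => [[s' l'] R'].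
rewrite [(s, l, R).1.2]/= [(s', l', R').1.2]/= [(s', l', R').1.1]/=.
move=> ok od k1 ok' od' ind' /and3P[cv]; rewrite nat_eqb => /eqP cR ro.
apply: (rows_rank (m := k + n) ok ok' cv (phi := fun i => dual k (k + n) (nth entry0 l' i).1) _ _ cR ro).
  by move=> i is_; apply: (pivot_coef_neq0 ok' ind' is_).
by move=> i u is_ ul; apply: (pivot_coef ok' od' ind').
Qed.

Lemma bounds_betti i : dim_bound i = rank_bound i + rank_bound i.+1 + betti n i.
Proof.
rewrite /dim_bound /rank_bound /=; case: ifP => [/andP[i1 ik]|out].
  have [_ _ _ ->] := level_okP i1 ik; rewrite ik andbT ltnS i1 /=.
  case: (ltngtP i n.*2.-2) ik => // -> _; case/andP: top; rewrite nat_eqb => /eqP-> _.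
  by rewrite !addn0.
have -> : betti n i = 0.
  by apply/eqP; apply: contraFT out => /betti_neighbours[-> ->].
move: out; rewrite ltnS; case: (ltnP 1 i) => /= [i1|i1 _].
  move=> ik; rewrite ik andbF; have -> //: (i < n.*2.-2) = false.
  by apply: contraFF ik; apply: ltnW.
by rewrite ltnNge (leq_trans i1).
Qed.

Theorem check_homology i : \dim {:homology n i} = betti n i.
Proof.
have exact j : betti n j = 0 -> dim_bound j <= rank_bound j + rank_bound j.+1.
  by move=> b0; rewrite bounds_betti b0 addn0.
have [b0|bn] := eqVneq (betti n i) 0.
  by rewrite b0; apply: (homology_exact dim_chains_bound rank_boundary_bound); apply: exact.
have [i1 ik b0 b2] := betti_neighbours bn.
case: i bn i1 ik b0 b2 => // i bn i1 ik b0 b2.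
apply: (homology_defect dim_chains_bound rank_boundary_bound (exact _ b0) (exact _ b2)).
(* In an exceptional degree the bound of the chain dimension is attained, all listed even graphs
   being verified as even and distinct. *)
rewrite -bounds_betti; apply/eqP; rewrite eqn_leq dim_chains_bound andbT.
have [ok od ind _] := level_okP i1 ik.
rewrite /dim_bound i1 ik; apply: (dim_chains_ge ok ind); first by rewrite nat_eqb.
Qed.

End Check.

(** * The search for certificates *)

Fixpoint compare_row (r s : seq nat) : comparison :=
  match r, s with
  | [::], [::] => Eq
  | [::], _ => Lt
  | _, [::] => Gt
  | x :: r', y :: s' => match Nat.compare x y with Eq => compare_row r' s' | z => z end
  end.

Fixpoint compare_code (c d : code) : comparison :=
  match c, d with
  | [::], [::] => Eq
  | [::], _ => Lt
  | _, [::] => Gt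
  | x :: c', y :: d' => match compare_row x y with Eq => compare_code c' d' | z => z end
  end.

Definition partition := seq (seq nat * seq nat).

Fixpoint add_to_cell (sg : seq nat) (v : nat) (s : partition) : partition :=
  if s is (sg', l) :: s' then
    match compare_row sg sg' with
    | Lt => (sg, [:: v]) :: s
    | Eq => (sg', v :: l) :: s'
    | Gt => (sg', l) :: add_to_cell sg v s'
    end
  else [:: (sg, [:: v])].

Fixpoint cells_from (v : nat) (col : seq nat) (nb : seq (seq nat)) (cl : seq nat) : partition :=
  match nb, cl with
  | ns :: nb', c :: cl' =>
    add_to_cell (c :: foldl (fun a u => insert_sorted (nth 0 col u) a) [::] ns) v
      (cells_from v.+1 col nb' cl')
  | _, _ => [::]
  end.

Fixpoint number_cells (i : nat) (cs : partition) (col : seq nat) : seq nat :=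
  if cs is (_, l) :: cs' then
    number_cells i.+1 cs' (foldl (fun col v => update (fun=> i) col v) col l)
  else col.

(** Colour refinement: cells are split by the sorted colours of the neighbours until their number is
    stable or all are singletons. *)
Fixpoint equitable (fuel K : nat) (nb : seq (seq nat)) (col : seq nat) (n : nat) :
    partition * seq nat :=
  let cs := cells_from 0 col nb col in
  let m := size cs in
  let col' := number_cells 0 cs (nseq K 0) in
  if fuel is f.+1 then
    if Nat.eqb m n then (cs, col') else if Nat.eqb m K then (cs, col')
    else equitable f K nb col' m
  else (cs, col').

Fixpoint smallest_cell (s : partition) : option (seq nat) :=
  if s is (_, l) :: s' then
    let r := smallest_cell s' in
    if l is [:: _, _ & _] then
      if r is Some l' then if Nat.leb (size l) (size l') then Some l else r else Some l
    else r
  else None.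

Definition best_labelings := option (code * seq (seq nat)).

Definition try_labeling K (es : seq edge) (p : seq nat) (best : best_labelings) : best_labelings :=
  let c := add_edges p es (nseq K [::]) in
  if best is Some (c0, ps) then
    match compare_code c c0 with
    | Lt => Some (c, [:: p])
    | Eq => Some (c0, p :: ps)
    | Gt => best
    end
  else Some (c, [:: p]).

(** Individualization and refinement: colours are doubled, each vertex of a smallest nontrivial cell
    is in turn placed just before the rest of its cell, and the partition is refined again. A
    partition into singletons is a labeling. *)
Fixpoint label_cells K (es : seq edge) (nb : seq (seq nat)) (fuel : nat)
    (x : partition * seq nat) (best : best_labelings) : best_labelings :=
  match smallest_cell x.1, fuel with
  | None, _ => try_labeling K es x.2 best
  | Some l, f.+1 =>
    let col2 := map (fun i => (i + i).+1) x.2 in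
    foldl (fun best v =>
      label_cells K es nb f
        (equitable K K nb (update (fun=> let i := nth 0 x.2 v in i + i) col2 v) (size x.1).+1)
        best) best l
  | _, _ => best
  end.

(* The least code among those of the labelings compatible with the partition
   refinement, and all the labelings that realize it. *)
Definition canonical K (es : seq edge) : code * seq (seq nat) :=
  let nb := neighbours K es in
  odflt ([::], [::]) (label_cells K es nb K (equitable K K nb (map size nb) 0) None).

Inductive trie := NoTrie | Trie of option positive & seq (nat * trie).

Fixpoint trie_child (x : nat) (l : seq (nat * trie)) : trie :=
  if l is (y, t) :: l' then if Nat.eqb x y then t else trie_child x l' else NoTrie.

Fixpoint trie_set_child (x : nat) (t : trie) (l : seq (nat * trie)) :=
  if l is (y, u) :: l' then
    if Nat.eqb x y then (y, t) :: l' else (y, u) :: trie_set_child x t l'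
  else [:: (x, t)].

Fixpoint trie_find (w : seq nat) (t : trie) : option positive :=
  match w, t with
  | _, NoTrie => None
  | [::], Trie o _ => o
  | x :: w', Trie _ ch => trie_find w' (trie_child x ch)
  end.

Fixpoint trie_add (w : seq nat) (i : positive) (t : trie) : trie :=
  let: (o, ch) := if t is Trie o ch then (o, ch) else (None, [::]) in
  if w is x :: w' then Trie o (trie_set_child x (trie_add w' i (trie_child x ch)) ch)
  else Trie (Some i) ch.

Definition flatten_code (c : code) : seq nat := foldr (fun r a => r ++ 0 :: a) [::] c.

(* The number of known graphs, their keys, and the graphs in reverse order. *)
Definition store (A : Type) := (positive * trie * seq (code * A))%type.
Definition new_store A : store A := (xH, NoTrie, [::]).

Definition register A (st : store A) (c : code) (a : A) : store A * positive :=
  let: (i, t, l) := st in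
  let w := flatten_code c in
  if trie_find w t is Some j then (st, j)
  else ((Pos.succ i, trie_add w i t, (c, a) :: l), i).

Definition found := seq (option (positive * seq nat)).

Fixpoint last_free (i : nat) (ds : seq nat) (v : nat) : nat :=
  if ds is d :: ds' then last_free i.+1 ds' (if Nat.ltb d 3 then i else v) else v.

Definition grow_code K (st : store unit) (c : code) : store unit * (nat * found) :=
  let q := size c in let es := code_edges c in let ds := degrees q es in
  let v := last_free 0 ds 0 in
  let step r es' st :=
    let: (c', ps) := canonical r es' in
    let: (st', i) := register st c' tt in (st', Some (i, head [::] ps)) in
  let old := filter (fun w => Nat.ltb (nth 0 ds w) 3 && ~~ Nat.eqb w v) (iota 0 q) in
  let: (st1, o) := if Nat.ltb q K then step q.+1 ((v, q) :: es) st else (st, None) in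
  let: (st2, f) := foldl (fun x w =>
    if saturated K q ((v, w) :: es) then (x.1, None :: x.2)
    else let: (st', o) := step q ((v, w) :: es) x.1 in (st', o :: x.2)) (st1, [::]) old in
  (st2, (v, rev (o :: f))).

Fixpoint grow_codes K (fuel : nat) (cs : seq code) (acc : seq (seq (code * (nat * found)))) :=
  if fuel is f.+1 then
    let: (st, out) := foldl (fun x c =>
      let: (st', r) := grow_code K x.1 c in (st', (c, r) :: x.2)) (new_store unit, [::]) cs in
    grow_codes K f (map fst (rev st.2)) (rev out :: acc)
  else (cs, acc).

(* A labeling with the opposite orientation, composed with the inverse of the first. *)
Definition odd_automorphism (es : seq edge) (ps : seq (seq nat)) : seq nat :=
  if ps is p0 :: ps' then
    let sg p := parity p (+) flips p es in
    if filter (fun p => sg p (+) sg p0) ps' is p :: _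
    then foldl (fun q xy => set_nth 0 q xy.1 xy.2) [::] (zip p0 p) else [::]
  else [::].

(** The merged vertex comes first, and the others keep their order. *)
Definition contraction (K : nat) (e : edge) : seq nat :=
  map (fun v => if Nat.eqb v e.1 then 0 else if Nat.eqb v e.2 then 0 else
                if Nat.ltb v e.1 then v.+1 else if Nat.ltb v e.2 then v else v.-1) (iota 0 K).

(* Calls [f] with each edge, the edges before it in reverse order, and those after. *)
Fixpoint over_edges A (f : edge -> seq edge -> seq edge -> A -> A) (pre post : seq edge) (a : A) : A :=
  if post is e :: post' then f e pre post' (over_edges f (e :: pre) post' a) else a.

Definition contract_code K (st : store (seq nat)) (c : code) : store (seq nat) * found :=
  let es := code_edges c in let ds := degrees K es in
  over_edges (fun e pre post x =>
    if required ds e && ~~ has (edge_eqb e) pre && ~~ has (edge_eqb e) post then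
      let p := contraction K e in
      let es' := map (ledge p) (catrev pre post) in
      let: (c', ps) := canonical K.-1 es' in
      let: (st', i) := register x.1 c' (odd_automorphism es' ps) in
      (st', Some (i, map (nth 0 (head [::] ps)) p) :: x.2)
    else (x.1, None :: x.2)) [::] es (st, [::]).

(** Rows of the boundary need the contractions of all simple edges; graphs outside the rows keep the
    shorter list from [contract_code]. *)
Definition all_contractions K (t : trie) (c : code) : found :=
  over_edges (fun e pre post x =>
    if ~~ has (edge_eqb e) pre && ~~ has (edge_eqb e) post then
      let p := contraction K e in
      let: (c', ps) := canonical K.-1 (map (ledge p) (catrev pre post)) in
      (if trie_find (flatten_code c') t is Some i
       then Some (i, map (nth 0 (head [::] ps)) p) else None) :: x
    else None :: x) [::] (code_edges c) [::].

Definition graph_info := (code * seq nat * found)%type.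
Definition even_info (x : graph_info) : bool := if x.1.2 is [::] then true else false.

Fixpoint contract_levels K (cs : seq (code * seq nat)) : seq (nat * trie * seq graph_info) :=
  match K with
  | (_.+2 as K').+1 =>
    let: (st, out) := foldl (fun x c =>
      let: (st', f) := contract_code K x.1 c.1 in (st', (c, f) :: x.2))
      (new_store (seq nat), [::]) cs in
    (K, st.1.2, rev out) :: contract_levels K' (rev st.2)
  | _ => [:: (K, NoTrie, map (fun c => (c, [::])) cs)]
  end.

(** * Encoding of the certificates *)

Definition hex_digit (n : nat) : uint -> uint :=
  nth Hexadecimal.Df [:: Hexadecimal.D0; Hexadecimal.D1; Hexadecimal.D2; Hexadecimal.D3;
    Hexadecimal.D4; Hexadecimal.D5; Hexadecimal.D6; Hexadecimal.D7; Hexadecimal.D8;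
    Hexadecimal.D9; Hexadecimal.Da; Hexadecimal.Db; Hexadecimal.Dc; Hexadecimal.Dd;
    Hexadecimal.De] n.

Definition encode (l : seq nat) : uint := foldr hex_digit Hexadecimal.Nil l.

Definition to_digit (n : nat) : digit :=
  nth X0 [:: X0; X1; X2; X3; X4; X5; X6; X7; X8; X9; Xa; Xb; Xc; Xd; Xe; Xf] n.

Fixpoint name_digits (n : nat) (p : N) : seq digit :=
  if n is n'.+1 then
    let bit p := match p with
      | Npos (xI q) => (1, Npos q) | Npos (xO q) => (0, Npos q) | Npos xH => (1, N0) | N0 => (0, N0)
      end in
    let: (b0, p) := bit p in let: (b1, p) := bit p in
    let: (b2, p) := bit p in let: (b3, p) := bit p in
    to_digit (b0 + 2 * b1 + 4 * b2 + 8 * b3) :: name_digits n' p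
  else [::].

Definition to_name (o : option positive) : name :=
  if o is Some p then
    if name_digits 4 (Npos p) is [:: d; c; b; a] then Name a b c d else Name X0 X0 X0 X0
  else Name X0 X0 X0 X0.

Definition to_word (l : seq nat) : word :=
  let d := nth X0 (map to_digit l) in
  Word (d 0) (d 1) (d 2) (d 3) (d 4) (d 5) (d 6) (d 7) (d 8) (d 9) (d 10) (d 11).

Definition bits (h : Number.uint) : seq bool :=
  if h is Number.UIntHexadecimal h' then
    flatten (map (fun d => map (fun b => odd (d %/ b)) [:: 8; 4; 2; 1]) (digits h'))
  else [::].

Fixpoint number A (i : positive) (l : seq A) : seq (positive * A) :=
  if l is x :: l' then (i, x) :: number (Pos.succ i) l' else [::].

Definition tree_of A (l : seq (positive * A)) : tree A :=
  foldl (fun t x => insert x.1 x.2 t) Leaf l.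

(* The even graphs selected by a sequence of bits. *)
Fixpoint flagged (l : seq (positive * graph_info)) (b : seq bool) : seq positive :=
  match l, b with
  | x :: l', y :: b' =>
    if even_info x.2 then let r := flagged l' b' in if y then x.1 :: r else r
    else flagged l' b
  | _, _ => [::]
  end.

Fixpoint targets (neg : bool) (pre post : seq edge) (f : found) : seq (bool * positive) :=
  match post, f with
  | e :: post', Some (i, p) :: f' =>
    (neg (+) contraction_sign p e pre post', i) :: targets neg (e :: pre) post' f'
  | e :: post', None :: f' => targets neg (e :: pre) post' f'
  | _, _ => [::]
  end.

Definition combination := seq (bool * positive).

Definition columns (infos : tree graph_info) (contr : tree found) (open : tree bool)
    (s : combination) : seq positive :=
  let ts := flatten (map (fun x =>
    match lookup x.2 infos, lookup x.2 contr with
    | Some g, Some f => targets x.1 [::] (code_edges g.1.1) f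
    | _, _ => [::]
    end) s) in
  let is_open i := if lookup i open is Some b then b else false in
  foldr (fun t r => if is_open t.2 && ~~ has (Pos.eqb t.2) r && ~~ balanced t.2 ts
                    then t.2 :: r else r) [::] ts.

(* Repeatedly selects the rows with a single open column. *)
Fixpoint triangulate (fuel : nat) (rs : seq (combination * seq positive)) (open : tree bool)
    : seq (combination * positive) :=
  if fuel is f.+1 then
    let: (rest, open', out) := foldl (fun x r =>
      let: (rest, open, out) := x in
      match filter (fun i => if lookup i open is Some b then b else false) r.2 with
      | [:: i] => (rest, insert i false open, (r.1, i) :: out)
      | _ => (r :: rest, open, out)
      end) ([::], open, [::]) rs in
    if out is [::] then [::] else catrev out (triangulate f (rev rest) open')
  else [::].

Fixpoint encode_found (ren : tree positive) (f : found) : certs :=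
  match f with
  | [::] => Done
  | None :: f' => Skip (encode_found ren f')
  | Some (i, p) :: f' =>
    Cert (to_name (lookup i ren)) (to_word p) (encode_found ren f')
  end.

Fixpoint join_pairs (l : seq table) : seq table :=
  if l is t1 :: t2 :: l' then Append t1 t2 :: join_pairs l' else l.

(** Sixteen rounds of pairwise joining suffice for the [2^16] possible names, and produce a balanced
    term instead of a deep one. *)
Definition encode_table (ren : tree positive) (l : seq graph_info) : table :=
  head Empty (iter 16 join_pairs (map (fun x =>
    Entry (encode (flatten_code x.1.1)) (encode x.1.2) (encode_found ren x.2)) l)).

Definition encode_row (ren : tree positive) (s : combination) (R : rows) : rows :=
  let id i := to_name (lookup i ren) in
  if s is x :: s' then
    foldr (fun y r => Term y.1 (id y.2) r) (Last (id x.2) R) s'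
  else R.

(* For each level, bits selecting the pivots and the rows among the even graphs, and
   further rows: combinations given by signs, positions and multiplicities. *)
Definition hints := seq (Number.uint * Number.uint * seq (seq (bool * nat * nat))).

(** In each table the pivots come first, in the order in which the level above eliminated them;
    names refer to positions after this renaming. *)
Fixpoint encode_levels (lv : seq (nat * trie * seq graph_info)) (hs : hints) (pivots : seq positive)
    : seq (nat * table * rows) :=
  match lv, hs with
  | (K, t, infos) :: lv', (_, hr, combs) :: hs' =>
    let ninfos := number xH infos in
    let itree := tree_of ninfos in
    let specs := map (fun i => [:: (false, i)]) (flagged ninfos (bits hr)) ++
      map (fun s => flatten (map (fun x => nseq x.2 (x.1.1, Pos.of_succ_nat x.1.2)) s)) combs in
    let contr := foldl (fun c x =>
      if lookup x.2 c is Some _ then c else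
      if lookup x.2 itree is Some g then insert x.2 (all_contractions K t g.1.1) c else c)
      Leaf (flatten specs) in
    let below := if lv' is (_, _, infos') :: _ then number xH infos' else [::] in
    let hp := if hs' is (hp, _, _) :: _ then bits hp else [::] in
    let open := tree_of (map (fun i => (i, true)) (flagged below hp)) in
    let ord := triangulate 10000 (map (fun s => (s, columns itree contr open s)) specs) open in
    let order pivots l :=
      let piv := tree_of (map (fun i => (i, tt)) pivots) in
      pivots ++ filter (fun i => if lookup i piv is Some _ then false else true) (map fst l) in
    let renaming l := tree_of (map (fun x => (x.2, x.1)) (number xH l)) in
    let pivots' := map snd ord in
    let all := order pivots ninfos in
    let ren := renaming all in
    let ren' := renaming (order pivots' below) in
    let tab := encode_table ren' (pmap (fun i =>
      if lookup i itree is Some g then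
        Some (g.1, if lookup i contr is Some f then f else g.2) else None) all) in
    (size pivots, tab, foldr (fun r => encode_row ren r.1) NoRows ord)
      :: encode_levels lv' hs' pivots'
  | _, _ => [::]
  end.

(** A trivalent graph on [K] vertices has [3 * K / 2] edges, and each round of growth adds one. *)
Definition find_certificates (n : nat) (hs : hints) : seq (nat * table * rows) * seq table :=
  let K := n.*2.-2 in
  let: (cubic, states) := grow_codes K (3 * K)./2 [:: [:: [::]]] [::] in
  let top := map (fun c => (c, let es := code_edges c in odd_automorphism es (canonical K es).2)) cubic in
  let same := fun m => tree_of (map (fun i => (i, i)) (map fst (number xH (nseq m tt)))) in
  let sizes := size cubic :: map size states in
  let enc := map (fun x => encode_table (same x.1)
      (map (fun y : code * (nat * found) => (y.1, [:: y.2.1], y.2.2)) x.2)) (zip sizes states) in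
  (encode_levels (contract_levels K top) hs [::], enc).

Definition load_levels (d : seq (nat * table * rows)) : seq level :=
  map (fun x => (x.1.1, load x.1.2, x.2)) d.

(** Levels are stored from [2 * n - 2] vertices downward, so the position of level [K] is its
    distance from the top. *)
Definition check n (lv : seq level) (us : seq (seq entry)) : bool :=
  let f K := nth (0, [::], NoRows) lv (n.*2.-2 - K) in
  [&& Nat.ltb 1 n, top_ok n f us, all (level_ok n f) (iota 2 (n.*2.-2 - 1)) &
      all (step_ok f) (iota 3 (n.*2.-2 - 2))].

Definition check_data n (d : seq (nat * table * rows) * seq table) : bool :=
  check n (load_levels d.1) (map load d.2).

Theorem check_dataP n d : check_data n d -> forall i, \dim {:homology n i} = betti n i.
Proof.
rewrite /check_data /check => /and4P[]; rewrite nat_ltb => n1 top /allP lv /allP st.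
have n2 : 2 <= n.*2.-2 by case: n n1 {top lv st} => [|[|n]].
apply: (check_homology n1 top) => K K1 Kn; [apply: lv | apply: st];
  rewrite mem_iota K1 /= ?subn1 ?subn2; move: Kn; case: (n.*2.-2) n2 => [|[|j]] //.
Qed.

(** * Certificates for ranks 2 to 7 *)

Delimit Scope hex_uint_scope with huint.

Definition hints2 : hints :=
  [:: (0x0%huint, 0x0%huint, [::])].

Definition hints3 : hints :=
  [:: (0x0%huint, 0x8%huint, [::]);
      (0x8%huint, 0x0%huint, [::]);
      (0x0%huint, 0x0%huint, [::])].

Definition hints4 : hints :=
  [:: (0x0%huint, 0xd%huint, [::]);
      (0xe%huint, 0x0%huint, [::]);
      (0x0%huint, 0x0%huint, [::]);
      (0x0%huint, 0x8%huint, [::]);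
      (0x8%huint, 0x0%huint, [::])].

Definition hints5 : hints :=
  [:: (0x0%huint, 0xdf7c%huint, [::]);
      (0xa755e%huint, 0x5c904%huint, [::]);
      (0xcb84%huint, 0xd4b2%huint, [::]);
      (0xd4350%huint, 0xf6166%huint, [::]);
      (0xaafe%huint, 0xb002%huint, [::]);
      (0xf%huint, 0x0%huint, [::]);
      (0x0%huint, 0x0%huint, [::])].

Definition hints6 : hints :=
  [:: (0x0%huint, 0xfffefefffffffc%huint, [::]);
      (0xca0cc82983c102ae3b9d4af01214a4312%huint, 0x3f5f36de7dbd6ebe6459bdaa66e6aa270%huint, [::]);
      (0x0448c8a0734554106212ac415e586a8941fcdc26fa3087435000%huint, 0xf9e7d97986dae577de8d53dea3bd9f6ffd89a8e8f69cd4bd46a8%huint, [::]);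
      (0x8546afc48a99223349e79a213cd21c4bb85e2836081b1a0456fb832cd1a1472d2b70d900%huint, 0xf53de94d7f6417cfb10ad5d895e797aa2b57767dd594ab883c4538aa88e6bf2e795e3677%huint, [::]);
      (0xecd72bff1d4bd98f81dd8c5ef5f5f9c2d2eef6f496ac3fbb3eff79db7ddf1e4%huint, 0x06dcc373cc20c058a558debc002800941c4249e165061802a089222053506c8%huint, [::]);
      (0xfbf3bf17d7fbfdefafffcfffbfe%huint, 0xaa1484000064280040105008000%huint, [::]);
      (0x3ffff%huint, 0xc0000%huint, [::]);
      (0xa%huint, 0x4%huint, [::]);
      (0x8%huint, 0x0%huint, [::])].

(* For graphs with 9 vertices, single rows give only 2492 of the 2494 pivots. *)
Definition hints7 : hints :=
  [:: (0x0%huint, 0xfdfffffffffffffffffffffffffffbffffffffffffffffefffffffffffffffffffffffffffc%huint, [::]);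
      (0x96500880e0452c0641782284c4441802cc5722244840000802806c904240116060118006042101c186223441080403038401006140014802b1024100716a21a0607a050146050c48008071c582e50080820c6168018c3a481c03218e948078a200000801501ce430c607c40001508027212039800100024006d6f8002229049072a0c088001001000000418c00a08801c84%huint, 0xdf6fff7dbdfd9f1efff8e8d6fafffefa7adbbfaffb97fdfbbbff5dbefdbffbff1bf6dffff7ddfefeefcd8eed7faffdeffffdbb5dff6ff5fdff6dbfff7ef0debdc3935e5efacf7bddfb5f3b3b7e7bbcfefdf7dfbfaf6d11abeafcfad9fbfe9fe3debf5b7ce7ceeefef2fc7337ff7dfdffe4f3ccffeffba7ffaba7b34fc55cffbb755e67c5c93bfe9eef2d6f9adff773fa328%huint, [::]);
      (0x300502ca018c430910910901520e8d7445262df0353e473260d784a16436388189254040240110683b0cec78c18050c061a6cc186961a97862e6211a9090c54c1fe728d0755181d030a1051fa8165519d1dcc6408f5010167524d99015880106dc28600614451802774a0000024a6084082bc4398319100031401038c46100c249a05284f926694440012020dd617c04c184040638902c84000ce708608101bc284a8b9a81a028891d93e280ac524412919000480a0a000070000000250df70844589d160007000238f100862421c0805221208d808884a0f10380501483955493428190ea6a403208808824012000010241391e414202d97c5045fc38280a03092c02755e0026295a080000095267564a01035c46d5029c44c80b2e00002304016995038b35a3d660b083900008051645f69c00480cd8803410854d705011cb06180000624348529d1186a401804028%huint, 0xfb69f7fe768f765fcf6ef7f7ee6f77bfd9deebb9e37cdba9b53b7f5e916fb0ca099ffedeaffecf73c6a56b965fef65ffffbfefe6efefd73bd57aec330f5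3cbcf4d89b78bfcc8a78792dbbff7ff9fb7c6e8f977dfff53f2395efafdffdff7d7efa1f5afffffba5fb46fde9ffebedcfeffd7a5df6b7e35bb7defbcdf7f7b1fb73db66bb567b27eaa9acbebb9ffbee4b7bf8fbbf9b6772ff6f0f6920f8dbe7dfffbf7bdc9bbd55b4fbef55564ff3faecbf56fff77b5b7fddfafd7e97e7df33713f5ab835edffcec9d5dde77ee52df7be0d54d9ecfb289bf7a3b43ed7fef63ea3bc6734bbe7f94bcbffdaaf77eedfc7f7697fdd747e3bebe4dee174b695bdfd3fe367efc3b94a1fb9f2afc11fded7b5768a2d6b2a6d755167b32d17fc3bcacfffff9fbbfaeae35ffc3af253b27cffff6efdb3acaa27ac75857cf5ff3f0eb3cffdaa2b4f74dfff2b2d6c3a4bdf9b3b77697ef%huint, [::]);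
      (0x38e6429550ccd702207fdd3d708c13ac600af44100c0640b608c3180df1a415848ea5e0021bf604ec0600018ad10825e0e20182c320a04e12c41caf94adfc36967fc554d74f7db5e8321966e7671e6733d130ac109b5a1ea97d7cc0c8374d25231d74c5c9a0a039c2522211fe6d08000189005a421f4c2c9510b803d596acc428b2b624253d1381692e428b4cc2086e4e107e67e106017f7c7068b5d206aa381f90b3ff3b7efadc1ffe1e67aff677fcb9831576feff5fb814a808f20231a7da738095505c42ed6a6014050f50d0406b48684e60ab77760282a0ac57aca32a737748601a80c8318410d291e5242f979000e604860222800ad1394caef86501004421cf7f90e6db597f1c84108010401200254686454448b01087f0c00e39802f9b10101d75c0008984a2407f84d001cbff0d870104c8037353e3f863ff9950ab82988030530c6028a960ec16526e30a7729c6d79402d18c1e4a74f21001000529d9782354037378412beccf628ace11c4018200a05414eb070505e322aae4c2150077094ce8629102d2cf3449ffc487968f6698e30d4006ee86f19ae91048553312b25b2b13f8404e4eb293a28be75f69c188c92869c1342c042a160800638ecab8036e830dab06348f0048f635b8f030e8e73206a340574aa5923a976b399e30c19dfcc58a1478040865a9f4e20fcb9d100bab48a14e203001889377b364c22e06b461cc8b006917c048ec3909b0318043236ab387a40c00a1c2666%huint, 0xbd4a193ae216a9f14cc895c212e2ae304529e0b068fbadad1736caff4cf63df77e1cd5ffbf55e4ed6e9f77f57b4f7a036afbee4e37f35c083a7c8c352b2cf06bd898a209a2c5e2ccea5a6e5ab91f29de7af37d57a71610110a02dd51a48776ef6e8d8bd3a5c8b37b12524683427dff117bfaf7bffbb5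c7a1ba317bfeff3793d98d77f507ef566f4acdefefa56577aa21361a59135342c21ef0b0343baa878b6979ddca6bee17485bb085653e9566ed5327b4fea7921adba2f40af6ffa0e34f9e5d7e8dfc1b35fe5ca0a75e18d5fbf77dbbb9e49d2b78988df2765221ca14b390d3f5fde7bfddb3cc37f17536ffdf7b6fae1fcddd53defe3c7fffdf34975ffcfb1da3b6cf88eae9cfed315fdea377af1b4081bfdfeb52ee90fef9fd975a759b64136d763c013f78f57fefed7fbdfb729df01eb75ed393fa0b41ff369c07e5bfc6f3e2eaf9c5e3ed35e2e59aaed74fa7b0079d98f55d3efbd1fb0d86ecf1f9fe36fe4fbc4c8029f6834c15e16b8813ff913cf3ff5e4befc87adf7ecebf641e7da53608d3fb8cb4768b0e3599a6b3ef9cb9a0995616b07a690cc9083925bdf7d0430f7fb3ff5b4bf73e36157b1c1bb7bb1064ffdb1e97d7ddebfb5f6bd56cf4b5ed9d881f27aa791a7aff69940959939c0a19738edafd8e39f31e5a72ff83fffd0827141edb2578e21ef7dbf688c6904c7ce9bcd99c8e125b3cffe57382cf9d70f7eff9faabf8e44396bffb831ef67d47ed1e6b14445a267e9fb9778fd%huint, [:: [:: (false, 9, 1);  (false, 8, 1);  (true, 144, 2)];  [:: (false, 165, 1);  (false, 674, 2);  (true, 234, 4);  (false, 10, 2);  (false, 77, 1);  (true, 654, 1);  (true, 147, 1);  (false, 1784, 2);  (false, 187, 2);  (true, 764, 2)]]);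
      (0x8cdb9f77dfaff3f7fbffffdf9fb7fffac77f7bffafb5d5b97ffdedfdceffb6bdff563e67ffee19d2426a80ace49e412803a0b953a5ff81d3c0845196189312bb68d771591fb6980455c0cdf5d7e3d45a08945be936dda3051040fbeee9b2d54d94812f4ebd543bb0d0933bdbfcf10ddc319bef5fdf7a1edbfeb9c5f6ad1819f2fbb75b3976fb6c15fff15fa3ebbde830e2f8d0cf4c7fe67ca58904efb2c7fad7f8eecde94e8e4a41a09100caa97dc3004fc1c0067b79ff5de3aedff7fc0400501839f70d7afee7d354b98f0fbde88f553a5cbade8579cf9e906abf8519f8bfd53ff57ffff59080ff917fbffe26cedd69dcf257dea5d1327c07fed1d6fefcd7bdecc4ed291f73cbee96d390ffd6ffaff517e545e590ade2f5fb3efc723f6348f41a0c20890855e40d403e0cff6ffd7c01d0bc3eedc5d364bdff89e9972ffbdc9741705bfa0047bb181ec2487adeff96003838c8f8fff07e8d1c187118bfedb39a4cec60d816f8ff83f79692073807af3fdeff7cbfe9701788304d31baa3bd3cf0d45f6f7b7a7ae6e5f423de5e6a7d4edee47b418297e87dde3f9fd9fe4001dccce630d780bfea37c9b0f9e01b7d37ffdf05a61f54908927b32ca0093ffe288db78e7dc80f00255a2ee1c6bc332857afafb9309932fa48f0763bbbdaddaa5fb9daeb36ee5afc8f7d9071600143726feec4110fcf6935ff2317faf8a27bdcf8bf96e1cf43ac997e7f5dda9b4e0c1ff777d6bc9885323ec7bf3716fee89caded7f8f9f38%huint, 0xefb67ece77a9a3ed5a82d80a15b859aa0f0e7349a68e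af2ccfbfa8880e35d263a9b62b9e682c42306f0553c25db0f519e7500a61989aee05a8502d349a1f547a246982c7120ed9849752eb6920c0766eda64fa9cb5251d479e743b0132611170096e1d1026a58d7d5009100d72462200465651c3386a91071fcf6081608d28e0526414e49849687601c42ea054d49f62345c49bdb6c692bd8a54a8eacbe3a5eae6691252514493cccf91abd3abe525b6563a11243a7170d513df8e98075c67cc9b8ed8c6881c5206842e9d70bc11a5429015b991cc3c18f9a167a14299575c1b885e2a8013d313820936d694c08031e629440080c6152f0412108c708b6ce04786d16376a60815a21ddfcda146193b83b655008adf53d284154e9228c0abdc809021df415efac1a672f38be2966903c873fa00201777cffbe80fcb080449810239aee6e4206238af302021106e746a499d17f59a000f008d07eb6a9673a4ff12d62f019f447beda2d6f9ac343bbfb290803c275992420d170a2e18529dc3b000a7292342ad2510220875b4817181ca88a7918785ea04201f013a9e9121c162ccb02b1de5086aec6a6918251308111127b082b700e60f9260c702045081b09370a95487411c0c81e0101309080306c0106fbf70590061250f790c0342b1129249aad8258155c035ac743c9a0c9240cc14c3248059480033e2265c2d78ce4260534604719283292230c8652449ecd8387bf0e00613430b07146a899858540082ee3148%huint, [::]);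
      (0x553f7e52111ffd42eeeb26b7cbe18b7db4ff3cf7f3eb37e7d99fe4fc66df2be5531f7ffff76defbe9ff7f7f9dbcf9868dfe7f5373397ff26d2b4ff9d7751f7ee5d7e2f7fe15edabeefeff73eff4ecffeeff5ffcf51d3cfe7a8926ebecd7bfdff0ef6e79b0fff735fe7cc17fd9f7d3ffbebfffeff37d3b1f5eee7dfbaa8df65bfb6d4eaff12abf59f9438f583f962df7fbd77ba72dbab649bddfad3ff68fbf610fff35fe976ffefbeb24f76aaffdffddb7f5bdeeb45dbf5397bf6fd5bc7bd3bbddd22cbbd3bdfbbffffceefd77ff7ff7bdffdb47f5f9f7ae7fdf6ff357ff3ffdb4f1ed6a6fc3770ffa8a1afeff9e7fc79eafbf7f9e5cbc4eeedfbdfeff47795df6f2e67ffeaa7fd0e5bcecc29ef0ff77bb4d587df257f47766bf6df5e47f2f7fdbfbffae67adff67dfdb7f76ff2bfff5f6b77fffff7cfdffce1ffdfdcd6d5ff7abf6feefbffd93fffdefdf4%huint, 0xcb9132547c0d328dde063b0248e82c21a2cf1000157573503066411fc90b4800820cdd107cc02050d0100469bd0dddb222800b5fd80a1b13733a25283be0880180e300165c182489c3ac4a81010001e00010064cdac77b06206120c51a848444442420000a00790650062c8e02464000138288910820800004100883e74038e0109f08012c0143b037c00cb0be9303630d3a2b19bad4138a900e620008000f40010e0be07720000003ef2327101007c0045c07e0c808089f727640146b038bb80230406026e8e01022ac0040220a200100008f401080000080d3c489c4008501d0000806d2893181364a000053c88338d40c4040687146fa30204000003c5000b8812078400084001088380601fe700a4884c0c0b41f288380248070821102100048113805440000008004082850002380505a010084001828408010a80082440004028010011000210440%huint,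 [::]);
      (0x9a7b7cfe3ddbaaef93fb7f5fefdffdf5fc7cc57fbf9dc93bb757ffff7fc6177f9291dbfffd57e5fbbb3ffe77bfbfffcffbdffff37eb77cf3afff7ff6fe34fbef9e5bfbfe7ca7fb7cffcc7faafd7adeffafff76ff7bfffff93eff73fd8dffd7beedfd7fbfffbcdffbfbd7bdffff3a7dffffefffdc3ef5ffffeffffff8%huint, 0x8eafc3021f240714e944409068010c029940380083095520202011388868a8819a02820103a61a0001400184404c00300400110560440200400080010185451860ad200880d8084a0117035a028c28148101044020c2001600201400560040241081000000000001002942000147808000000043f040000010000800%huint, [::]);
      (0x5e57718f7ff5fb0f9afbfefecfcffef77ffbefffe7b3f7ffffffcebf7fff3f7bffc%huint, 0xd3e15643450020f22010101108c0090040010000105040b010003080800080a0002%huint, [::]);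
      (0x69fe7cfffffffff8%huint, 0x8a80800021400000%huint, [::]);
      (0xff%huint, 0x0%huint, [::]);
      (0x0%huint, 0x0%huint, [::])].

(* The proof term contains the result of the search, and only checks it again. *)
Ltac certify n h :=
  let d := eval vm_compute in (find_certificates n h) in
  pose (x := d); exists x; vm_cast_no_check (erefl true).

Lemma certificates2 : exists d, check_data 2 d = true.
Proof. certify 2 hints2. Qed.

Lemma certificates3 : exists d, check_data 3 d = true.
Proof. certify 3 hints3. Qed.

Lemma certificates4 : exists d, check_data 4 d = true.
Proof. certify 4 hints4. Qed.

Lemma certificates5 : exists d, check_data 5 d = true.
Proof. certify 5 hints5. Qed.

Lemma certificates6 : exists d, check_data 6 d = true.
Proof. certify 6 hints6. Qed.

Lemma certificates7 : exists d, check_data 7 d = true.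
Proof. certify 7 hints7. Qed.

Lemma dim_homology_betti n i : 2 <= n <= 7 -> \dim {:homology n i} = betti n i.
Proof.
have main k : (exists d, check_data k d = true) -> \dim {:homology k i} = betti k i.
  by case=> d /check_dataP.
case: n => [|[|[|[|[|[|[|[|n]]]]]]]] // _; apply: main.
- exact: certificates2.
- exact: certificates3.
- exact: certificates4.
- exact: certificates5.
- exact: certificates6.
exact: certificates7.
Qed.

Local Open Scope ring_scope.
Theorem theorem5p1 :
  isomorphic (homology 2 2) 'rV[rat]_1 /\
  isomorphic (homology 3 4) 'rV[rat]_1 /\
  isomorphic (homology 4 6) 'rV[rat]_1 /\
  isomorphic (homology 5 8) 'rV[rat]_2 /\
  isomorphic (homology 6 10) 'rV[rat]_2 /\
  isomorphic (homology 6 7) 'rV[rat]_1 /\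
  isomorphic (homology 7 12) 'rV[rat]_3 /\
  isomorphic (homology 7 9) 'rV[rat]_1 /\
  (forall n i : nat, (2 <= n <= 7)%N ->
     (n, i) \notin [:: (2, 2); (3, 4); (4, 6); (5, 8);
                       (6, 10); (6, 7); (7, 12); (7, 9)]%N ->
     forall x : homology n i, x = 0).
Proof.
do 8![split; first by apply: isomorphic_dim; rewrite dim_homology_betti].
move=> n i ni out; apply: dim0_eq0; rewrite dim_homology_betti //.
by apply/eqP; apply: contraNT out; apply: betti_exceptions.
Qed.
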